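(* Let $n,N,k\in\mathbb N$, let $U\subset\mathbb R^n$ be a bounded open set, and let $\mathrm H:U\times\mathbb R^\Lambda\to[0,\infty)$ be a Carathéodory function with $\mathrm H(x,0)=0$ for a.e. $x\in U$, satisfying the following two conditions. (1) There is a continuous function $c:[0,1]\times[0,\infty)\to[0,\infty)$ with $c(1,\cdot)=c(\cdot,0)=0$ and $c>0$ on $(0,1)\times(0,\infty)$ such that $$\mathrm H(x,tX)\le \mathrm H(x,X)-c(t,|X|)\qquad \forall\, t\in[0,1],\ \forall\, X\in\mathbb R^\Lambda,\ \text{a.e. } x\in U .$$ (2) For every $R>0$ there is a non-decreasing $\omega_R\in C(0,\infty)$ with $\omega_R(0^+)=0$ such that $$|\mathrm H(x,X)-\mathrm H(x,X')|\le \omega_R(|X-X'|)\qquad \text{a.e. } x\in U,\ \forall\, X,X'\in\overline{\mathbb B}_R(0),\ X\neq X'.$$ Assume that $u\in W^{k,\infty}(U,\mathbb R^N)$ satisfies $$\mathrm E_\infty(u,U)\le \mathrm E_\infty(u+\phi,U)\qquad\forall\,\phi\in W^{k,\infty}_0(U,\mathbb R^N).$$ Then $$\operatorname*{ess\,sup}_{U}\mathrm H\big(\cdot,\mathrm D^{\vec k}u\big)=\sup_{\partial U}\mathrm H\big(\cdot,\mathrm D^{\vec k}u\big)^*.$$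
   Context: Notation: $\mathbb R^\Lambda\cong\mathbb R^N\times\mathbb R^{Nn}\times\dots\times\mathbb R^{Nn^k}$, so $\Lambda=N(1+n+\dots+n^k)$; $\overline{\mathbb B}_R(0)$ is the closed ball of radius $R$ centred at $0$ in $\mathbb R^\Lambda$ and $|\cdot|$ is the Euclidean norm. $\mathrm H$ Carathéodory means: $x\mapsto \mathrm H(x,X)$ is Lebesgue measurable for every $X$, and $X\mapsto\mathrm H(x,X)$ is continuous for a.e. $x$. For $u\in W^{k,\infty}(U,\mathbb R^N)$, the jet of order $k$ is $\mathrm D^{\vec k}u:=(u,\mathrm Du,\dots,\mathrm D^ku):U\to\mathbb R^\Lambda$, and $$\mathrm E_\infty(u,U):=\operatorname*{ess\,sup}_{x\in U}\mathrm H\big(x,\mathrm D^{\vec k}u(x)\big).$$ $W^{k,\infty}_0(U,\mathbb R^N)$ is the space of $W^{k,\infty}(U,\mathbb R^N)$ maps with zero boundary values, $W^{k,\infty}(U,\mathbb R^N)\cap W^{k,1}_0(U,\mathbb R^N)$. Essential limsup: for $h\in L^\infty(U)$, $$h^*(x):=\lim_{\varepsilon\to0}\Big(\operatorname*{ess\,sup}_{B_\varepsilon(x)\cap U}h\Big),\qquad x\in\overline U .$$ *)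

(* Defs.v *)
From HB Require Import structures.
From mathcomp Require Import all_boot all_order all_algebra.
From mathcomp Require Import all_classical all_reals all_analysis.
From mathcomp Require Import ess_sup_inf.

Set Implicit Arguments.
Unset Strict Implicit.
Unset Printing Implicit Defensive.

Import Order.TTheory GRing.Theory Num.Def Num.Theory.
Import numFieldNormedType.Exports.

Local Open Scope classical_set_scope.
Local Open Scope ring_scope.

(* [borel_rV R n] is R^n with the product sigma-algebra, on which Lebesgue
   measure is an iterated product.  The type ['rV[R]_n] itself carries the
   completion: its measurable sets are the Lebesgue measurable ones. *)

Definition borel_rV (R : realType) (n : nat) : Type := 'rV[R]_n.

HB.instance Definition _ (R : realType) n := Pointed.copy (borel_rV R n) 'rV[R]_n.

Section product_sigma_algebra.
Variables (R : realType) (n : nat).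

Definition rV_coord (i : 'I_n) (x : borel_rV R n) : R := (x : 'rV[R]_n) ord0 i.

Definition borel_rV_display : measure_display. Proof. exact: default_measure_display. Qed.

HB.instance Definition _ := @isMeasurable.Build borel_rV_display
  (borel_rV R n) (g_sigma_preimage rV_coord)
  (@sigma_algebra0 _ setT _)
  (@sigma_algebraC _ _)
  (@sigma_algebra_bigcup _ setT _).

Lemma measurable_rV_coord (i : 'I_n) : measurable_fun [set: borel_rV R n] (rV_coord i).
Proof.
move=> _ Y mY; rewrite setTI; apply: sub_sigma_algebra => /=.
rewrite -bigcup_seq/=; exists i => /=; first by rewrite mem_index_enum.
by exists Y => //; rewrite setTI.
Qed.

Lemma measurable_fun_rV d (T : measurableType d) (f : T -> borel_rV R n) :
  (forall i, measurable_fun [set: T] (rV_coord i \o f)) ->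
  measurable_fun [set: T] f.
Proof.
move=> mf; apply: (measurability
  (\big[setU/set0]_(i < n) preimage_set_system setT (rV_coord i) measurable)) => //.
move=> _ [C + <-]; rewrite -bigcup_seq => -[i _ [A mA <-]].
by rewrite setTI setTI -comp_preimage -[X in measurable X]setTI; exact: mf.
Qed.

End product_sigma_algebra.

Section lebesgue_rV.
Variable R : realType.

Definition rV_cons n (p : R * borel_rV R n) : borel_rV R n.+1 :=
  row_mx (p.1%:M : 'rV[R]_1) (p.2 : 'rV[R]_n).

Definition rV_uncons n (x : borel_rV R n.+1) : R * borel_rV R n :=
  (rV_coord ord0 x, @rsubmx R 1 1 n x).

Lemma rV_consK n : cancel (@rV_cons n) (@rV_uncons n).
Proof.
case=> t y; rewrite /rV_uncons /rV_cons row_mxKr /=; congr pair.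
transitivity ((row_mx (t%:M : 'rV[R]_1) y) ord0 (lshift n ord0)).
  by congr (row_mx _ _ _ _); exact/val_inj.
by rewrite row_mxEl mxE.
Qed.

Lemma measurable_rV_cons n : measurable_fun setT (@rV_cons n).
Proof.
apply: measurable_fun_rV => i.
case: (splitP (i : 'I_(1 + n))) => j ij.
  have -> : i = lshift n j by exact/val_inj.
  rewrite (_ : _ \o _ = fst); first exact: measurable_fst.
  apply/funext => p; apply: (etrans (row_mxEl (p.1%:M : 'rV[R]_1) p.2 ord0 j)).
  by rewrite mxE (ord1 j).
have -> : i = rshift 1 j by exact/val_inj.
rewrite (_ : _ \o _ = @rV_coord R n j \o snd).
  by apply: measurableT_comp; [exact: measurable_rV_coord|exact: measurable_snd].
by apply/funext => p; exact: (row_mxEr (p.1%:M : 'rV[R]_1) p.2 ord0 j).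
Qed.

Lemma measurable_rV_uncons n : measurable_fun setT (@rV_uncons n).
Proof.
apply: measurable_fun_pair; first exact: (measurable_rV_coord ord0).
apply: measurable_fun_rV => i.
rewrite (_ : _ \o _ = @rV_coord R n.+1 (rshift 1 i)).
  exact: measurable_rV_coord.
by apply/funext => x /=; rewrite /rV_coord mxE.
Qed.

Section step.
Variables (n : nat) (m : {sigma_finite_measure set (borel_rV R n) -> \bar R}).

Definition lebesgue_step :=
  pushforward (@lebesgue_measure R \x m)%E (@rV_cons n).

Let step0 : lebesgue_step set0 = 0%E.
Proof. by rewrite /lebesgue_step /pushforward preimage_set0 measure0. Qed.

Let step_ge0 A : (0 <= lebesgue_step A)%E.
Proof. exact: (measure_ge0 (@lebesgue_measure R \x m)%E). Qed.

Let step_sigma_additive : semi_sigma_additive lebesgue_step.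
Proof.
have mf A : measurable A -> measurable (@rV_cons n @^-1` A).
  by move=> mA; rewrite -[X in measurable X]setTI; exact: measurable_rV_cons.
move=> F mF tF mUF; rewrite /lebesgue_step /pushforward preimage_bigcup.
apply: measure_semi_sigma_additive.
- by move=> i; exact: mf.
- apply/trivIsetP => /= i j _ _ ij; rewrite -preimage_setI.
  by move/trivIsetP : tF => /(_ _ _ _ _ ij) ->//; rewrite preimage_set0.
- by rewrite -preimage_bigcup; exact: mf.
Qed.

HB.instance Definition _ := isMeasure.Build _ _ _ lebesgue_step
  step0 step_ge0 step_sigma_additive.

Let step_sigma_finite : sigma_finite setT lebesgue_step.
Proof.
have /sigma_finiteP[F [TF ndF Foo]] := sigma_finiteT (@lebesgue_measure R).
have /sigma_finiteP[G [TG ndG Goo]] := sigma_finiteT m.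
exists (fun i => @rV_uncons n @^-1` (F i `*` G i)).
  apply/esym/seteqP; split => // x _.
  have [i _ Fi] : (\bigcup_i F i) (rV_uncons x).1 by rewrite -TF.
  have [j _ Gj] : (\bigcup_i G i) (rV_uncons x).2 by rewrite -TG.
  exists (maxn i j) => //; split.
    by move: Fi; exact/subsetPset/ndF/leq_maxl.
  by move: Gj; exact/subsetPset/ndG/leq_maxr.
move=> i; have [mFi Fioo] := Foo i; have [mGi Gioo] := Goo i; split.
  rewrite -[X in measurable X]setTI.
  by apply: measurable_rV_uncons => //; exact: measurableX.
rewrite /lebesgue_step /pushforward -comp_preimage (_ : _ \o _ = id); last first.
  by apply/funext => p /=; rewrite rV_consK.
rewrite preimage_id product_measure1E//.
by rewrite lte_mul_pinfty// ge0_fin_numE.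
Qed.

HB.instance Definition _ := Measure_isSigmaFinite.Build _ _ _ lebesgue_step
  step_sigma_finite.

End step.

Fixpoint borel_lebesgue n : {sigma_finite_measure set (borel_rV R n) -> \bar R} :=
  match n with
  | 0 => @dirac _ (borel_rV R 0) (0 : 'rV[R]_0) R
  | n'.+1 => lebesgue_step (borel_lebesgue n')
  end.

Definition lebesgue_display : measure_display.
Proof. exact: default_measure_display. Qed.

Definition lebesgue_measurable n : set (set 'rV[R]_n) :=
  caratheodory_measurable (mu_ext (borel_lebesgue n)).

Let lebesgue_measurable0 n : @lebesgue_measurable n set0.
Proof. exact: caratheodory_measurable_set0. Qed.

Let lebesgue_measurableC n A :
  @lebesgue_measurable n A -> @lebesgue_measurable n (~` A).
Proof. exact: caratheodory_measurable_setC. Qed.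

Let lebesgue_measurable_bigcup n (F : (set 'rV[R]_n)^nat) :
  (forall i, lebesgue_measurable (F i)) -> lebesgue_measurable (\bigcup_i F i).
Proof. exact: caratheodory_measurable_bigcup. Qed.

HB.instance Definition _ n := @isMeasurable.Build lebesgue_display 'rV[R]_n
  (@lebesgue_measurable n) (@lebesgue_measurable0 n) (@lebesgue_measurableC n)
  (@lebesgue_measurable_bigcup n).

Definition lebesgue n : set 'rV[R]_n -> \bar R :=
  @completed_measure_extension _ _ _ (borel_lebesgue n).

Let lebesgue0 n : @lebesgue n set0 = 0%E.
Proof. exact: measure0. Qed.

Let lebesgue_ge0 n A : (0 <= @lebesgue n A)%E.
Proof. exact: measure_ge0. Qed.

Let lebesgue_sigma_additive n : semi_sigma_additive (@lebesgue n).
Proof. exact: (@measure_semi_sigma_additive _ _ _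
  (@completed_measure_extension _ _ _ (borel_lebesgue n))). Qed.

HB.instance Definition _ n := isMeasure.Build _ _ _ (@lebesgue n)
  (@lebesgue0 n) (@lebesgue_ge0 n) (@lebesgue_sigma_additive n).

Let lebesgue_sigma_finite n : sigma_finite setT (@lebesgue n).
Proof.
exact: (completed_measure_extension_sigma_finite
  (sigma_finiteT (borel_lebesgue n))).
Qed.

HB.instance Definition _ n := Measure_isSigmaFinite.Build _ _ _ (@lebesgue n)
  (@lebesgue_sigma_finite n).

End lebesgue_rV.

Lemma borel_lebesgue_rect (R : realType) n (A : 'I_n -> set (measurableTypeR R)) :
  (forall i, measurable (A i)) ->
  borel_lebesgue R n [set x : 'rV[R]_n | forall i, A i (x ord0 i)] =
  (\prod_(i < n) lebesgue_measure (A i))%E.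
Proof.
elim: n A => [|n IHn] A mA.
  rewrite big_ord0 /= /dirac indicE mem_set//=; first by case.
have mB (i : 'I_n) : measurable (A (lift ord0 i)) by exact: mA.
pose B : set (borel_rV R n) := [set x : 'rV[R]_n | forall i, A (lift ord0 i) (x ord0 i)].
rewrite big_ord_recl -(IHn _ mB) -[X in borel_lebesgue R n X]/B.
rewrite /= /lebesgue_step /pushforward.
have mBB : measurable B.
  have -> : B = \big[setI/setT]_(i < n) (@rV_coord R n i @^-1` A (lift ord0 i)).
    apply/seteqP; split => x; rewrite -bigcap_seq.
      by move=> Bx i _; exact: Bx.
    by move=> Bx i; apply: (Bx i); exact: (mem_index_enum (i : 'I_n)).
  apply: bigsetI_measurable => i _.
  by have := @measurable_rV_coord R n i measurableT _ (mB i); rewrite setTI.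
rewrite -product_measure1E//; congr (_ _); apply/seteqP.
have E0 (p : R * borel_rV R n) : (rV_cons p : 'rV[R]_n.+1) ord0 ord0 = p.1.
  by rewrite -[p in RHS]rV_consK.
have E1 (p : R * borel_rV R n) i : (rV_cons p : 'rV[R]_n.+1) ord0 (lift ord0 i) = (p.2 : 'rV[R]_n) ord0 i.
  have -> : lift ord0 i = rshift 1 i by exact/val_inj.
  exact: (row_mxEr (p.1%:M : 'rV[R]_1) p.2 ord0 i).
split => [p /= Ap|p [/= p1 p2] i].
  by split; [rewrite -E0|move=> i; rewrite -E1].
by case: (unliftP ord0 i) => [j ->|->]; rewrite ?E1 ?E0.
Qed.

Section sobolev.
Variables (R : realType) (n : nat).
Implicit Types (U : set 'rV[R]_n) (f g : 'rV[R]_n -> R) (s : seq 'I_n).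

Definition lmeasurable U f : Prop :=
  measurable_fun U f.

Definition partial (i : 'I_n) f : 'rV[R]_n -> R := 'D_(delta_mx ord0 i) f.

Definition partials s f : 'rV[R]_n -> R := foldr partial f s.

Definition smooth f : Prop := forall s,
  continuous (partials s f) /\
  forall i x, derivable (partials s f) x (delta_mx ord0 i).

Definition support f : set 'rV[R]_n := closure [set x | f x != 0].

Definition test_fun U f : Prop :=
  [/\ smooth f, compact (support f) & support f `<=` U].

Definition loc_integrable U f : Prop :=
  lmeasurable U f /\
  forall K : set 'rV[R]_n, compact K -> K `<=` U ->
    (\int[@lebesgue R n]_(x in K) `|f x|%:E < +oo)%E.

Definition is_weak_deriv U s f g : Prop :=
  [/\ loc_integrable U f, loc_integrable U g &
    forall phi, test_fun U phi ->
      \int[@lebesgue R n]_(x in U) (f x * partials s phi x) =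
      (-1) ^+ size s * \int[@lebesgue R n]_(x in U) (g x * phi x)].

(* A representative of the weak derivative, which is unique up to null sets. *)
Definition weak_deriv U s f : 'rV[R]_n -> R :=
  xget (cst 0) [set g | is_weak_deriv U s f g].

Definition Lp_norm (p : \bar R) U f : \bar R :=
  'N[@lebesgue R n]_p[EFin \o (f \_ U)].

Definition in_Lp (p : \bar R) U f : Prop :=
  lmeasurable U f /\ (Lp_norm p U f < +oo)%E.

(* A coordinate of R^Lambda is a component of the map together with a word of
   length at most [k] in the [n] coordinate directions, so that D^j u has all
   its n^j entries (not only one per multi-index). *)

Definition jet_index (N k : nat) : finType :=
  ('I_N * {j : 'I_k.+1 & j.-tuple 'I_n})%type.

Definition jet_dim (N k : nat) : nat := #|jet_index N k|.

Lemma jet_dimE N k : jet_dim N k = (N * \sum_(j < k.+1) n ^ j)%N.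
Proof.
rewrite /jet_dim card_prod card_ord card_tagged sumnE big_map big_enum /=.
by congr muln; apply: eq_bigr => j _; rewrite card_tuple card_ord.
Qed.

Definition component N (u : 'rV[R]_n -> 'rV[R]_N) (a : 'I_N) : 'rV[R]_n -> R :=
  fun x => u x ord0 a.

Definition jet_of (D : seq 'I_n -> ('rV[R]_n -> R) -> 'rV[R]_n -> R) N k
    (u : 'rV[R]_n -> 'rV[R]_N) (x : 'rV[R]_n) : 'rV[R]_(jet_dim N k) :=
  \row_l let i : jet_index N k := enum_val l in
         D (tagged i.2) (component u i.1) x.

Definition jet N k U : ('rV[R]_n -> 'rV[R]_N) -> _ := @jet_of (weak_deriv U) N k.

Definition classical_jet N k : ('rV[R]_n -> 'rV[R]_N) -> _ := @jet_of partials N k.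

Definition sobolev N k (p : \bar R) U (u : 'rV[R]_n -> 'rV[R]_N) : Prop :=
  forall i : jet_index N k, exists2 g,
    is_weak_deriv U (tagged i.2) (component u i.1) g & in_Lp p U g.

(* The closure of C_c^oo(U; R^N) in W^{k,p}(U; R^N); the weak jet of a test map
   is its classical one. *)
Definition sobolev0 N k (p : \bar R) U (u : 'rV[R]_n -> 'rV[R]_N) : Prop :=
  sobolev k p U u /\
  forall e : R, 0 < e -> exists2 phi : 'rV[R]_n -> 'rV[R]_N,
    forall a, test_fun U (component phi a) &
    (\sum_(l < jet_dim N k) Lp_norm p U
       (component (fun x => jet k U u x - classical_jet k phi x)%R l) < e%:E)%E.

Definition sobolev0_infty N k U (u : 'rV[R]_n -> 'rV[R]_N) : Prop :=
  sobolev k +oo%E U u /\ sobolev0 k 1%E U u.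

(* [ess_sup] is over the whole space, hence the extension by -oo off [A]. *)
Definition ess_sup_on (A : set 'rV[R]_n) f : \bar R :=
  ess_sup (@lebesgue R n) (patch (cst -oo%E) A (EFin \o f)).

Lemma ess_sup_onE A f : ess_sup_on A f =
  ereal_inf [set y | {ae @lebesgue R n, forall x, A x -> ((f x)%:E <= y)%E}].
Proof.
rewrite /ess_sup_on ess_supEae; congr ereal_inf; apply/seteqP.
split => y /=; apply: filterS => x; rewrite /patch.
  by move=> + Ax; rewrite mem_set.
by case: ifPn => [/set_mem Ax /(_ Ax)|]//; rewrite leNye.
Qed.

(* The library norm on row vectors is the sup norm. *)
Definition enorm m (x : 'rV[R]_m) : R := Num.sqrt (\sum_i x ord0 i ^+ 2).

Definition eball (x : 'rV[R]_n) (e : R) : set 'rV[R]_n :=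
  [set y | enorm (y - x) < e].

Definition ess_limsup U f (x : 'rV[R]_n) : \bar R :=
  lim (ess_sup_on (eball x e `&` U) f @[e --> 0^'+]).

Definition boundary U : set 'rV[R]_n := closure U `\` interior U.

Definition caratheodory_fun m U (H : 'rV[R]_n -> 'rV[R]_m -> R) : Prop :=
  (forall X, lmeasurable U (H ^~ X)) /\
  {ae @lebesgue R n, forall x, U x -> continuous (H x)}.

Definition E_infty N k (H : 'rV[R]_n -> 'rV[R]_(jet_dim N k) -> R)
    (u : 'rV[R]_n -> 'rV[R]_N) U : \bar R :=
  ess_sup_on U (fun x => H x (jet k U u x)).

End sobolev.

(* Main.v *)
Require Import Defs.
From mathcomp Require Import all_boot all_order all_algebra.
From mathcomp Require Import all_classical all_reals all_analysis.
From mathcomp Require Import measurable_realfun ess_sup_inf ring lra.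

(** Write h for x |-> H(x, D^k u(x)), M for its essential supremum over U and m for
the supremum over the boundary of its essential upper limit.  The inequality
m <= M is clear, each essential upper limit being an infimum of essential
suprema over parts of U.  Suppose m < M and pick m' strictly between.

Near every boundary point h is almost everywhere at most m', so h <= m' holds
almost everywhere outside a compact K contained in U.  Take a test function
zeta equal to 1 on a neighbourhood of K and compare u with (1 - e zeta) u for a
small e > 0.  On K the jet is multiplied by t = 1 - e, and the radial condition
lowers h by c(t, |D^k u|); where h is close to M the jet stays away from 0,
since H(x, 0) = 0 and H(x, .) has a modulus of continuity, so the gain is
bounded below there.  Off K the jet moves by at most a constant times e, so h
stays below m' plus a small error.  Altogether the essential supremum drops
strictly below M ([energy_decrease]), which contradicts minimality.  The sign
of m, needed to know that the relevant level is positive, comes from the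
boundary of a nonempty bounded open set being nonempty ([boundary_nonempty])
and from open sets having positive measure ([open_lebesgue_gt0]).

Three facts about Sobolev maps make the comparison legitimate, and most of the
file is devoted to them.

The jet is built from an arbitrarily chosen representative of each weak
derivative, so weak derivatives must be unique almost everywhere: this is the
fundamental lemma of the calculus of variations ([pairing_eq0_ae]).

The jet of zeta u has to be known exactly where zeta = 1 and bounded
elsewhere.  The Leibniz formula is obtained one derivative at a time from
test functions of the form zeta psi ([leibnizP]).

The variation - e zeta u must have zero boundary values, that is, be
approximated by smooth compactly supported maps in W^{k,1}.  It is mollified;
for a small radius the derivatives of the mollified map are the mollified weak
derivatives ([partials_mollify]), and mollification converges in L^1.

Convergence of mollification in L^1 ([approximable_intg]) rests on the
mollifiers being contractions of L^1, by Tonelli ([L1norm_mollify]).  The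
indicator of a box is approximated pointwise off finitely many hyperplanes, and
the passage from boxes to Borel sets is a pi-lambda argument, from Borel sets
to Lebesgue sets an outer approximation, and from sets to functions an
approximation by simple functions.  The mollifiers are tensor products of the
one-dimensional bump exp(-1/(1+lx)) exp(-1/(1-lx)), whose integral over R^n
factors. *)

Set Implicit Arguments.
Unset Strict Implicit.
Unset Printing Implicit Defensive.

Import Order.TTheory GRing.Theory Num.Def Num.Theory.
Import numFieldNormedType.Exports.

Local Open Scope classical_set_scope.
Local Open Scope ring_scope.

(** * Smooth functions on R^n *)

Section smooth_functions.
Variables (R : realType) (n : nat).
Implicit Types (f g : 'rV[R]_n -> R) (s : seq 'I_n).

Lemma coord_le_norm (x : 'rV[R]_n) i : `|x ord0 i| <= `|x|.
Proof.
rewrite [leRHS]/Num.norm /= mx_normrE.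
exact: (@le_bigmax _ _ _ _ (fun ij => `|x ij.1 ij.2|) (ord0, i)).
Qed.

Lemma norm_ltP (x : 'rV[R]_n) (e : R) : 0 < e ->
  `|x| < e <-> forall i, `|x ord0 i| < e.
Proof.
move=> e0; split=> [xe i|xe]; first exact: le_lt_trans (coord_le_norm x i) xe.
rewrite [ltLHS]/Num.norm /= mx_normrE; apply/bigmax_ltP; split=> // -[i j] _ /=.
by rewrite (ord1 i).
Qed.

Lemma norm_leP (x : 'rV[R]_n) (e : R) : 0 <= e ->
  `|x| <= e <-> forall i, `|x ord0 i| <= e.
Proof.
move=> e0; split=> [xe i|xe]; first exact: le_trans (coord_le_norm x i) xe.
rewrite [leLHS]/Num.norm /= mx_normrE; apply/bigmax_leP; split=> // -[i j] _ /=.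
by rewrite (ord1 i).
Qed.

Lemma ball_rVP (x : 'rV[R]_n) (e : R) y :
  ball x e y <-> `|x - y| < e.
Proof. by rewrite -ball_normE. Qed.

Definition cont_diff f : Prop :=
  continuous f /\ forall i x, derivable f x (delta_mx ord0 i).

Lemma partials_rcons s i f : partials (rcons s i) f = partials s (partial i f).
Proof. by rewrite /partials foldr_rcons. Qed.

(** Smoothness quantifies over words of derivatives, which makes induction awkward;
this coinduction principle reduces it to an invariant stable under one partial
derivative. *)
Lemma smooth_coind (P : ('rV[R]_n -> R) -> Prop) :
  (forall f, P f -> cont_diff f) ->
  (forall f i, P f -> P (partial i f)) ->
  forall f, P f -> smooth f.
Proof.
move=> PC Pp f + s; elim/last_ind: s f => [|s i IH] f Pf; first exact: PC.
by rewrite partials_rcons; exact/IH/Pp.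
Qed.

Lemma smooth_cont_diff f : smooth f -> cont_diff f.
Proof. by move=> /(_ [::]). Qed.

Lemma smooth_partial i f : smooth f -> smooth (partial i f).
Proof. by move=> sf s; rewrite -partials_rcons; exact: sf. Qed.

Lemma smooth_partials s f : smooth f -> smooth (partials s f).
Proof.
move=> sf; elim/last_ind: s f sf => [//|s i IH] f sf.
by rewrite partials_rcons; exact/IH/smooth_partial.
Qed.

Lemma cont_diffD f g : cont_diff f -> cont_diff g -> cont_diff (f \+ g).
Proof.
move=> [cf df] [cg dg]; split=> [x|i x]; first exact: cvgD (cf x) (cg x).
exact: derivableD (df i x) (dg i x).
Qed.

Lemma cont_diffM f g : cont_diff f -> cont_diff g -> cont_diff (f \* g).
Proof.
move=> [cf df] [cg dg]; split=> [x|i x]; first exact: cvgM (cf x) (cg x).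
exact: derivableM (df i x) (dg i x).
Qed.

Lemma partialD i f g : cont_diff f -> cont_diff g ->
  partial i (f \+ g) = partial i f \+ partial i g.
Proof.
move=> [_ df] [_ dg]; apply/funext => x.
by rewrite /partial /= -deriveD.
Qed.

Lemma partialM i f g : cont_diff f -> cont_diff g ->
  partial i (f \* g) = (partial i f \* g) \+ (f \* partial i g).
Proof.
move=> [_ df] [_ dg]; apply/funext => x.
rewrite /partial (deriveM (df i x) (dg i x)) /= addrC.
by congr (_ + _); rewrite /GRing.scale /= mulrC.
Qed.

(** A partial derivative of a product is a sum of two products, so products alone are
not an invariant for [smooth_coind]; the algebra generated by smooth functions
is one. *)
Inductive smooth_alg : ('rV[R]_n -> R) -> Prop :=
| smooth_alg_base f of smooth f : smooth_alg f
| smooth_algD f g of smooth_alg f & smooth_alg g : smooth_alg (f \+ g)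
| smooth_algM f g of smooth_alg f & smooth_alg g : smooth_alg (f \* g).

Lemma smooth_alg_cont_diff f : smooth_alg f -> cont_diff f.
Proof.
elim=> {}f => [/smooth_cont_diff//|g _ cf _ cg|g _ cf _ cg].
  exact: cont_diffD.
exact: cont_diffM.
Qed.

Lemma smooth_alg_smooth f : smooth_alg f -> smooth f.
Proof.
move: f; apply: smooth_coind; first exact: smooth_alg_cont_diff.
move=> f i; elim=> {}f => [sf|g sf IHf sg IHg|g sf IHf sg IHg].
- exact/smooth_alg_base/smooth_partial.
- by rewrite partialD; [exact: smooth_algD|exact: smooth_alg_cont_diff..].
- rewrite partialM; [|exact: smooth_alg_cont_diff..].
  by apply: smooth_algD; exact: smooth_algM.
Qed.

Lemma smoothM f g : smooth f -> smooth g -> smooth (f \* g).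
Proof.
by move=> sf sg; apply/smooth_alg_smooth/smooth_algM; exact: smooth_alg_base.
Qed.

Lemma partial_cst i (c : R) : partial i (cst c : 'rV[R]_n -> R) = cst 0.
Proof. by apply/funext => x; rewrite /partial derive_cst. Qed.

Lemma smooth_cst (c : R) : smooth (cst c : 'rV[R]_n -> R).
Proof.
apply: (@smooth_coind (fun f => exists c, f = cst c)); last by exists c.
  move=> _ [{}c ->]; split=> [|i x]; first exact: cst_continuous.
  exact: derivable_cst.
by move=> _ i [{}c ->]; exists 0; rewrite partial_cst.
Qed.

Lemma partialsZ s (c : R) f : smooth f ->
  partials s (cst c \* f) = cst c \* partials s f.
Proof.
elim/last_ind: s f => [//|s i IH] f sf.
rewrite !partials_rcons partialM; [|exact: smooth_cont_diff (@smooth_cst c)|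
  exact: smooth_cont_diff].
rewrite partial_cst (_ : _ \+ _ = cst c \* partial i f).
  exact/IH/smooth_partial.
by apply/funext => x /=; rewrite mul0r add0r.
Qed.

(** This locality is what turns statements about supports, and about sets on which a
cutoff is constant, into statements about derivatives. *)
Lemma partials_local s f g (A : set 'rV[R]_n) : open A ->
  (forall x, A x -> f x = g x) ->
  forall x, A x -> partials s f x = partials s g x.
Proof.
move=> oA fg; elim: s => [//|i s IH] x Ax; apply: near_eq_derive.
by move: (open_nbhs_nbhs (conj oA Ax)); apply: filterS => y /IH.
Qed.

(** Directional derivatives are derivatives along a line, at any point of the line:
the form in which one-variable theorems apply. *)
Lemma is_derive_line f (x v : 'rV[R]_n) (h df : R) :
  is_derive (h *: v + x) v f df -> is_derive h 1 (fun h : R => f (h *: v + x)) df.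
Proof.
move=> [fd <-].
have E : (fun k => k^-1 *: (((fun h => f (h *: v + x)) \o shift h) (k *: 1) -
    f (h *: v + x))) =
  (fun k => k^-1 *: ((f \o shift (h *: v + x)) (k *: v) - f (h *: v + x))).
  by apply/funext => k /=; rewrite [k *: 1]mulr1 scalerDl addrA.
by split; rewrite /derivable /derive /= E.
Qed.

Lemma is_derive_line0 f (x v : 'rV[R]_n) (df : R) :
  is_derive (0 : R) 1 (fun h : R => f (h *: v + x)) df -> is_derive x v f df.
Proof.
move=> [fd <-].
have E : (fun k => k^-1 *: (((fun h => f (h *: v + x)) \o shift 0) (k *: 1) -
    f (0 *: v + x))) =
  (fun k => k^-1 *: ((f \o shift x) (k *: v) - f x)).
  by apply/funext => k /=; rewrite [k *: 1]mulr1 scale0r !add0r addr0.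
by split; [exact/derivable1P|rewrite /derive /= E].
Qed.

Lemma is_derive_reflect f (a y v : 'rV[R]_n) (df : R) : is_derive (a - y) v f df ->
  is_derive y v (fun y => f (a - y)) (- df).
Proof.
move=> fd; apply: is_derive_line0.
rewrite (_ : (fun h : R => _) = (fun h => f (h *: v + (a - y))) \o -%R); last first.
  by apply/funext => h /=; rewrite opprD addrCA scaleNr.
have fd0 : is_derive (- 0 : R) 1 (fun h : R => f (h *: v + (a - y))) df.
  by apply: is_derive_line; rewrite oppr0 scale0r add0r.
have -> : - df = df * (- 1) by rewrite mulrN1.
exact: (@is_derive1_comp _ (fun h : R => f (h *: v + (a - y))) -%R 0 df (-1)).
Qed.

Lemma partial_reflect i f a : cont_diff f ->
  partial i (fun y => f (a - y)) = (fun y => - partial i f (a - y)).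
Proof.
move=> [_ df]; apply/funext => y; rewrite /partial.
have := is_derive_reflect (derivableP (df i (a - y))).
by move=> [_ ->].
Qed.

Lemma smooth_reflect f a : smooth f -> smooth (fun y => f (a - y)).
Proof.
move=> sf; apply: (@smooth_coind
  (fun g => exists2 h, smooth h & g = (fun y => h (a - y)))); last by exists f.
- move=> _ [h sh ->]; have [ch dh] := smooth_cont_diff sh.
  split=> [y|i y].
    apply: (@continuous_comp _ _ _ (fun y : 'rV[R]_n => a - y) h); last exact: ch.
    by apply: (@continuousB R 'rV[R]_n); [exact: cst_continuous|exact: cvg_id].
  by have [] := is_derive_reflect (derivableP (dh i (a - y))).
- move=> _ i [h sh ->]; exists (cst (-1) \* partial i h).
    by apply: smoothM; [exact: smooth_cst|exact: smooth_partial].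
  rewrite partial_reflect; last exact: smooth_cont_diff.
  by apply/funext => y /=; rewrite mulN1r.
Qed.

Lemma partials_reflect s f a : smooth f ->
  partials s (fun y => f (a - y)) = (fun y => (-1) ^+ size s * partials s f (a - y)).
Proof.
elim/last_ind: s f => [|s i IH] f sf.
  by apply/funext => y /=; rewrite expr0 mul1r.
rewrite !partials_rcons partial_reflect; last exact: smooth_cont_diff.
have -> : (fun y => - partial i f (a - y)) =
    (cst (-1) \* (fun y => partial i f (a - y))).
  by apply/funext => y /=; rewrite mulN1r.
have sf' := smooth_partial i sf.
rewrite (partialsZ s (-1) (smooth_reflect a sf')) (IH _ sf').
by apply/funext => y /=; rewrite size_rcons exprS !mulrA.
Qed.

Lemma lipschitz_line f i (C : R) :
  (forall x, derivable f x (delta_mx ord0 i)) ->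
  (forall x, `|partial i f x| <= C) ->
  forall x (t : R), `|f (t *: delta_mx ord0 i + x) - f x| <= C * `|t|.
Proof.
move=> df fC; set v := delta_mx ord0 i.
(* A negative step from x is a positive step back from its end point. *)
have pos (x : 'rV[R]_n) (t : R) : 0 <= t -> `|f (t *: v + x) - f x| <= C * `|t|.
  rewrite le_eqVlt => /orP[/eqP<-|t0].
    by rewrite scale0r add0r subrr !normr0 mulr0.
  have D (h : R) : is_derive h 1 (fun h : R => f (h *: v + x)) (partial i f (h *: v + x)).
    by apply: is_derive_line; exact: derivableP.
  have cf : {within `[0, t], continuous (fun h => f (h *: v + x))}.
    by apply: derivable_within_continuous => h _; have [] := D h.
  have [c _] := MVT t0 (fun h _ => D h) cf.
  rewrite scale0r add0r subr0 => ->.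
  by rewrite normrM ler_wpM2r.
move=> x t; have [/pos//|t0] := leP 0 t.
have := pos (t *: v + x) (- t); rewrite addrA scaleNr addNr add0r distrC normrN.
by apply; rewrite oppr_ge0 ltW.
Qed.

(** Move from x to y one coordinate at a time, using the mean value theorem on each
segment. *)
Lemma lipschitz_partial f (C : R) :
  (forall i x, derivable f x (delta_mx ord0 i)) ->
  (forall i x, `|partial i f x| <= C) ->
  forall x y, `|f y - f x| <= C * \sum_i `|(y - x) ord0 i|.
Proof.
move=> df fC x y.
have H (s : seq 'I_n) (d : 'rV[R]_n) :
    `|f (\sum_(i <- s) d ord0 i *: delta_mx ord0 i + x) - f x| <=
      C * \sum_(i <- s) `|d ord0 i|.
  elim: s => [|i s IH]; first by rewrite !big_nil add0r subrr normr0 mulr0.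
  rewrite !big_cons mulrDr -addrA.
  apply: le_trans (ler_distD (f (\sum_(i <- s) d ord0 i *: delta_mx ord0 i + x)) _ _) _.
  by apply: lerD => //; apply: lipschitz_line.
have := H (index_enum _) (y - x).
by rewrite -row_sum_delta subrK.
Qed.

(** Continuity comes for free from bounded partial derivatives; this spares a
separate continuity argument for convolutions. *)
Lemma lipschitz_partial_continuous f (C : R) :
  (forall i x, derivable f x (delta_mx ord0 i)) ->
  (forall i x, `|partial i f x| <= C) -> continuous f.
Proof.
move=> df fC x; apply/(@cvgrPdist_lt _ _ _ (nbhs x)) => e e0.
have C0 : 0 <= `|C| * n%:R + 1 by rewrite addr_ge0// mulr_ge0.
near=> y.
rewrite distrC; apply: le_lt_trans (lipschitz_partial df fC x y) _.
apply: (@le_lt_trans _ _ (`|C| * n%:R * `|y - x|)).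
  apply: le_trans (ler_wpM2r _ (ler_norm C)) _; first exact: sumr_ge0.
  rewrite -mulrA ler_wpM2l//.
  apply: le_trans (ler_sum _ (fun i _ => (_ : _ <= `|y - x|))) _.
    by move=> i _; exact: coord_le_norm.
  by rewrite big_const_ord iter_addr_0 mulr_natl.
apply: (@le_lt_trans _ _ ((`|C| * n%:R + 1) * `|y - x|)).
  by rewrite ler_wpM2r// lerDl.
rewrite mulrC -ltr_pdivlMr; last by rewrite ltr_wpDl// mulr_ge0.
rewrite -normrN opprB; near: y.
apply: (@cvgr_dist_lt _ _ _ _ _ id x) => //.
by rewrite divr_gt0// ltr_wpDl// mulr_ge0.
Unshelve. all: by end_near. Qed.

End smooth_functions.

(** * One-dimensional bumps and their tensor products *)

Section flat_functions.
Variable R : realType.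
Implicit Types (p : {poly R}) (x : R).

(** The functions p(1/x) exp(-1/x) extended by 0 to x <= 0.  Letting the polynomial p
vary makes the family stable under differentiation, which is how flatness at 0
is propagated to all orders. *)
Definition flat p x : R := if 0 < x then p.[x^-1] * expR (- x^-1) else 0.

Lemma expr_le_fact_expR k (y : R) : 0 <= y -> y ^+ k.+1 <= k.+1`!%:R * expR y.
Proof.
move=> y0; have := expR_ge1Dxn k y0.
rewrite -ler_pdivrMl ?ltr0n ?fact_gt0// mulrC => h.
by apply: le_trans h; rewrite lerDr.
Qed.

(** The exponential series dominates each monomial: y^(i+1) exp(-y) <= (i+1)! with
y = 1/x. *)
Lemma flat_le p : exists C : R, forall x, `|flat p x| <= C * `|x|.
Proof.
exists (\sum_(i < size p) `|p`_i| * (i.+1`!)%:R) => x; rewrite /flat.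
case: ifPn => [x0|_]; last first.
  by rewrite normr0 mulr_ge0// sumr_ge0// => i _; rewrite mulr_ge0.
rewrite normrM (gtr0_norm (expR_gt0 _)) (gtr0_norm x0) horner_coef mulr_suml.
apply: le_trans (ler_wpM2r (expR_ge0 _) (ler_norm_sum _ _ _)) _.
rewrite mulr_suml; apply: ler_sum => i _.
rewrite normrM -!mulrA ler_wpM2l// normrX ger0_norm ?invr_ge0 ?(ltW x0)//.
rewrite expRN ler_pdivrMr ?expR_gt0//.
have := @expr_le_fact_expR i x^-1; rewrite invr_ge0 (ltW x0) => /(_ isT).
rewrite exprSr => h.
have := ler_wpM2r (ltW x0) h.
by rewrite -mulrA mulVf ?gt_eqF// mulr1 -!mulrA [expR _ * x]mulrC.
Qed.

(** The polynomial of the derivative: (p(1/x) e^(-1/x))' is (p - p')(1/x) e^(-1/x) / x^2. *)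
Definition flat_deriv p : {poly R} := 'X^2 * (p - p^`()).

Lemma is_derive_horner p x : is_derive x 1 (horner p) p^`().[x].
Proof.
apply: DeriveDef; first exact: derivable_horner.
by rewrite -derive1E derivE.
Qed.

(** Away from 0 this is calculus.  At 0 the difference quotient of the function of p is
the function of 'X p, which tends to 0 by [flat_le]. *)
Lemma is_derive_flat p x : is_derive x 1 (flat p) (flat (flat_deriv p) x).
Proof.
have [x0|x0|->] := ltgtP x 0.
- apply: (@near_eq_is_derive R R R (cst 0)).
    near=> y; rewrite /flat ltNge ifF//.
    apply/negbTE; rewrite negbK ltW//; near: y; exact: lt_nbhsl.
  by rewrite /flat ltNge (ltW x0) /=; exact: is_derive_cst.
- apply: (@near_eq_is_derive R R R (fun y : R => p.[y^-1] * expR (- y^-1))).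
    near=> y; rewrite /flat ifT//; near: y; exact: lt_nbhsr.
  rewrite /flat x0.
  have xn0 : x != 0 by rewrite gt_eqF.
  have dV : is_derive x 1 (fun y : R => y^-1) (- (x ^- 2)).
    have := @is_deriveV _ id x 1 1 xn0 (is_derive_id _ _).
    by rewrite [_ *: _]mulr1.
  have dp : is_derive x 1 (fun y => p.[y^-1]) (p^`().[x^-1] * (- (x ^- 2))).
    by apply: (@is_derive1_comp _ (horner p)); exact: is_derive_horner.
  have de : is_derive x 1 (fun y => expR (- y^-1)) (expR (- x^-1) * (x ^- 2)).
    apply: (@is_derive1_comp _ expR (fun y => - y^-1)).
    by have := is_deriveN dV; rewrite opprK.
  apply: (is_derive_eq (is_deriveM dp de)).
  rewrite /flat_deriv hornerM hornerXn hornerD hornerN /GRing.scale /=.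
  by rewrite exprVn; ring.
- rewrite {2}/flat ltxx.
  have [C HC] := flat_le (p * 'X).
  have f0 : flat p 0 = 0 by rewrite /flat ltxx.
  have lim0 : h^-1 *: ((flat p \o shift 0) (h *: 1) - flat p 0) @[h --> 0^'] --> (0 : R).
    apply/cvgr0Pnorm_lt => e e0.
    near=> h; rewrite f0 subr0 /= addr0 [h *: 1]mulr1.
    have -> : h^-1 *: flat p h = flat (p * 'X) h.
      rewrite /flat; case: ifP; rewrite ?scaler0// hornerM hornerX => _.
      by rewrite /GRing.scale /=; ring.
    apply: le_lt_trans (HC h) _.
    apply: (@le_lt_trans _ _ ((`|C| + 1) * `|h|)).
      by rewrite ler_wpM2r// ler_wpDr// ler_norm.
    rewrite mulrC -ltr_pdivlMr ?ltr_wpDl//.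
    by near: h; apply: dnbhs0_lt; rewrite divr_gt0// ltr_wpDl.
  split; first by apply/cvg_ex; exists 0.
  exact/cvg_lim.
Unshelve. all: by end_near. Qed.

End flat_functions.

Section smooth1.
Variable R : realType.
Implicit Types (f g : R -> R).

Definition smooth1 f : Prop := forall k x, derivable (derive1n k f) x 1.

Lemma smooth1_derive1 f : smooth1 f -> smooth1 (derive1 f).
Proof. by move=> sf k x; have := sf k.+1 x; rewrite /derive1n iterSr. Qed.

Lemma smooth1_derivable f x : smooth1 f -> derivable f x 1.
Proof. by move=> /(_ 0%N x). Qed.

(** Closed under differentiation by the product rule; the scalar in front of the base
functions absorbs the inner derivative. *)
Inductive flat_alg : (R -> R) -> Prop :=
| flat_alg_base p a c : flat_alg (fun x => c * flat p (a + c * x))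
| flat_algZ (c : R) f of flat_alg f : flat_alg (cst c \* f)
| flat_algD f g of flat_alg f & flat_alg g : flat_alg (f \+ g)
| flat_algM f g of flat_alg f & flat_alg g : flat_alg (f \* g).

Lemma flat_alg_derive f : flat_alg f ->
  exists2 g, flat_alg g & forall x : R, is_derive x 1 f (g x).
Proof.
elim=> {f}[p a c|c f _ [g ag fg]|f g af [f' af' ff'] ag [g' ag' gg']|
  f g af [f' af' ff'] ag [g' ag' gg']].
- exists (cst c \* (fun x => c * flat (flat_deriv p) (a + c * x))).
    by apply: flat_algZ; exact: flat_alg_base.
  move=> x /=.
  have dg : is_derive x 1 (fun y : R => a + c * y) c.
    have := is_deriveD (is_derive_cst a x 1) (is_deriveM (is_derive_cst c x 1) (is_derive_id x 1)).
    by rewrite scaler0 addr0 add0r [_ *: _]mulr1.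
  have df := @is_derive1_comp _ (flat p) _ x _ _ (is_derive_flat p (a + c * x)) dg.
  have := is_deriveM (is_derive_cst c x 1) df.
  by rewrite scaler0 addr0 /GRing.scale /= [_ * c]mulrC.
- exists (cst c \* g); first exact: flat_algZ.
  move=> x; have := is_deriveM (is_derive_cst c x 1) (fg x).
  by rewrite scaler0 addr0.
- exists (f' \+ g'); first exact: flat_algD.
  by move=> x; exact: is_deriveD (ff' x) (gg' x).
- exists ((f \* g') \+ (g \* f')).
    by apply: flat_algD; exact: flat_algM.
  by move=> x; exact: is_deriveM (ff' x) (gg' x).
Qed.

Lemma flat_alg_smooth1 f : flat_alg f -> smooth1 f.
Proof.
move=> + k; elim: k f => [|k IH] f af x.
  by have [g _ fg] := flat_alg_derive af; have [] := fg x.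
rewrite /derive1n iterSr; apply: IH.
have [g ag fg] := flat_alg_derive af.
suff -> : (derive1 f) = g by [].
by apply/funext => y; rewrite derive1E; have [_ ->] := fg y.
Qed.

Lemma flat1E (x : R) : flat 1 x = if 0 < x then expR (- x^-1) else 0.
Proof. by rewrite /flat hornerC mul1r. Qed.

Lemma flat1_ge0 (x : R) : 0 <= flat 1 x.
Proof. by rewrite flat1E; case: ifP => // _; exact: expR_ge0. Qed.

Lemma flat1_gt0 (x : R) : (0 < flat 1 x) = (0 < x).
Proof. by rewrite flat1E; case: ifP => _; rewrite ?expR_gt0 ?ltxx. Qed.

Definition bump (l x : R) : R := flat 1 (1 + l * x) * flat 1 (1 - l * x).

Lemma bump_ge0 l x : 0 <= bump l x.
Proof. by rewrite mulr_ge0// flat1_ge0. Qed.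

(** The two factors are positive exactly for x > - 1/l and x < 1/l. *)
Lemma bump_gt0 l x : 0 < l -> (0 < bump l x) = (`|x| < l^-1).
Proof.
move=> l0; apply/idP/idP => [b0|].
  have : 0 < 1 + l * x /\ 0 < 1 - l * x.
    rewrite -(flat1_gt0 (1 + _)) -(flat1_gt0 (1 - _)) !lt0r !flat1_ge0 !andbT.
    by split; apply: contraTneq b0; rewrite /bump => ->; rewrite ?mul0r ?mulr0 ltxx.
  by move=> [h1 h2]; rewrite ltr_norml -div1r ltr_pdivlMr// -mulNr ltr_pdivrMr//; lra.
rewrite ltr_norml -div1r -mulNr ltr_pdivlMr// ltr_pdivrMr// => /andP[h1 h2].
by rewrite mulr_gt0// flat1_gt0; lra.
Qed.

Lemma bump_smooth1 l c : l != 0 -> smooth1 (fun x => c * bump l x).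
Proof.
move=> l0; apply: flat_alg_smooth1.
have -> : (fun x => c * bump l x) = cst (c / - (l ^+ 2)) \*
    ((fun x => l * flat 1 (1 + l * x)) \* (fun x => (- l) * flat 1 (1 + (- l) * x))).
  by apply/funext => x; rewrite /bump /= !mulNr; field.
by apply/flat_algZ/flat_algM; exact: flat_alg_base.
Qed.

End smooth1.

Section tensor_product.
Variables (R : realType) (n : nat).
Implicit Types (g : 'I_n -> R -> R).

Definition tensor g (x : 'rV[R]_n) : R := \prod_i g i (x ord0 i).

Lemma continuous_coord i : continuous (fun x : 'rV[R]_n => x ord0 i).
Proof. exact: coord_continuous. Qed.

Lemma continuous_tensor g : (forall i, continuous (g i)) -> continuous (tensor g).
Proof.
move=> cg; rewrite /tensor; elim: (index_enum _) => [|i s IH].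
  under eq_fun do rewrite big_nil; exact: cst_continuous.
under eq_fun do rewrite big_cons.
move=> x; apply: (@continuousM R 'rV[R]_n (fun x => g i (x ord0 i))); last exact: IH.
apply: (@continuous_comp 'rV[R]_n R R (fun x => x ord0 i) (g i)).
  exact: continuous_coord.
exact: cg.
Qed.

Lemma is_derive_tensor g i (x : 'rV[R]_n) : derivable (g i) (x ord0 i) 1 ->
  is_derive x (delta_mx ord0 i) (tensor g)
    (tensor (fun j => if j == i then derive1 (g i) else g j) x).
Proof.
move=> dg; apply: is_derive_line0.
pose C := \prod_(j | j != i) g j (x ord0 j).
have -> : (fun h : R => tensor g (h *: delta_mx ord0 i + x)) =
    (fun h => g i (h + x ord0 i) * C).
  apply/funext => h; rewrite /tensor (bigD1 i)//= !mxE !eqxx mulr1.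
  congr (_ * _); apply: eq_bigr => j ji.
  by rewrite !mxE (negbTE ji) andbF mulr0 add0r.
rewrite [tensor _ x](bigD1 i)//= eqxx.
have -> : \prod_(j | j != i) (if j == i then derive1 (g i) else g j) (x ord0 j) = C.
  by apply: eq_bigr => j /negbTE ->.
rewrite mulrC.
have dh : is_derive (0 : R) 1 (fun h : R => h + x ord0 i) 1.
  have := is_deriveD (is_derive_id (0 : R) 1) (is_derive_cst (x ord0 i) (0 : R) 1).
  by rewrite addr0.
have dgi : is_derive (0 + x ord0 i) 1 (g i) (derive1 (g i) (x ord0 i)).
  by rewrite add0r derive1E; exact: derivableP.
have dc := @is_derive1_comp _ (g i) (fun h : R => h + x ord0 i) 0 _ _ dgi dh.
have := is_deriveM dc (is_derive_cst C (0 : R) 1).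
by rewrite scaler0 add0r mulr1.
Qed.

Lemma smooth1_continuous (f : R -> R) : smooth1 f -> continuous f.
Proof.
by move=> sf x; apply/differentiable_continuous/derivable1_diffP/smooth1_derivable.
Qed.

(** A partial derivative of a tensor product differentiates a single factor, so tensor
products of smooth functions form an invariant for [smooth_coind]. *)
Lemma smooth_tensor g : (forall i, smooth1 (g i)) -> smooth (tensor g).
Proof.
move=> sg; apply: (@smooth_coind _ _ (fun f =>
  exists2 g, (forall i, smooth1 (g i)) & f = tensor g)); last by exists g.
- move=> _ [{}g {}sg ->]; split=> [|i x].
    by apply: continuous_tensor => i; exact: smooth1_continuous.
  by have [] := is_derive_tensor (smooth1_derivable (sg i) (x := x ord0 i)).
- move=> _ i [{}g {}sg ->].
  exists (fun j => if j == i then derive1 (g i) else g j).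
    by move=> j; case: ifP => // _; exact: smooth1_derive1.
  apply/funext => x.
  by have [_ <-] := is_derive_tensor (smooth1_derivable (sg i) (x := x ord0 i)).
Qed.

End tensor_product.

(** * Borel sets and Lebesgue measure on R^n *)

Section lebesgue_basic.
Variables (R : realType) (n : nat).
Local Notation mu := (@lebesgue R n).
Local Notation T := 'rV[R]_n.
Local Notation B := (borel_rV R n).

Lemma dense_rat_rV (x : T) (e : R) : 0 < e ->
  exists q : 'rV[rat]_n, `|map_mx ratr q - x| < e.
Proof.
move=> e0.
have H (i : 'I_n) : {q : rat | `|ratr q - x ord0 i| < e}.
  apply: cid; have : x ord0 i - e < x ord0 i + e by rewrite ltrBlDr -addrA ltrDl addr_gt0.
  move=> /rat_in_itvoo [q]; rewrite in_itv/= => /andP[h1 h2].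
  by exists q; rewrite ltr_norml ltrBrDl h1 ltrBlDl h2.
exists (\row_i sval (H i)); apply/(norm_ltP _ e0) => i.
by rewrite !mxE; exact: svalP (H i).
Qed.

(** Balls for the sup norm are of this form, as are the boxes and the hyperplanes used below. *)
Lemma borel_box (A : 'I_n -> set R) : (forall i, measurable (A i)) ->
  measurable ([set x : T | forall i, A i (x ord0 i)] : set B).
Proof.
move=> mA.
have -> : [set x : T | forall i, A i (x ord0 i)] =
    \big[setI/setT]_(i < n) (@rV_coord R n i @^-1` A i).
  apply/seteqP; split => x; rewrite -bigcap_seq.
    by move=> Ax i _; exact: Ax.
  by move=> Ax i; apply: (Ax i); exact: (mem_index_enum (i : 'I_n)).
apply: bigsetI_measurable => i _.
by have := @measurable_rV_coord R n i measurableT _ (mA i); rewrite setTI.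
Qed.

Lemma borel_ball (x : T) (e : R) : 0 < e -> measurable (ball x e : set B).
Proof.
move=> e0; have -> : ball x e = [set y : T | forall i, ball (x ord0 i) e (y ord0 i)].
  apply/seteqP; split=> y.
    move/ball_rVP/(norm_ltP _ e0) => h i /=; rewrite -ball_normE /=.
    by have := h i; rewrite !mxE.
  move=> h; apply/ball_rVP/(norm_ltP _ e0) => i; have := h i.
  by rewrite -ball_normE /= !mxE.
by apply: (@borel_box (fun i => ball (x ord0 i) e)) => i; rewrite ball_itv; exact: measurable_itv.
Qed.

(** An open set is the union of the rational balls that it contains. *)
Lemma open_borel (A : set T) : open A -> measurable (A : set B).
Proof.
move=> oA.
(* The rational balls contained in A; the others are replaced by the empty set. *)
pose F (qm : 'rV[rat]_n * nat) : set T :=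
  let b := ball (map_mx ratr qm.1 : T) (qm.2.+1%:R^-1) in
  if `[< b `<=` A >] then b else set0.
have -> : A = \bigcup_qm F qm.
  apply/seteqP; split=> [x Ax|x [qm _]]; last first.
    by rewrite /F; case: asboolP => // bA; exact: bA.
  have [e /= e0 bA] := (@nbhs_ballP _ T x A).1 (open_nbhs_nbhs (conj oA Ax)).
  have [m Hm] : exists m : nat, m.+1%:R^-1 < e / 2.
    by have [m _ Hm] := near_infty_natSinv_lt (PosNum (divr_gt0 e0 (@ltr0Sn R 1)));
      exists m; apply: Hm => /=.
  have m0 : 0 < m.+1%:R^-1 :> R by rewrite invr_gt0.
  have [q qx] := dense_rat_rV x m0.
  have xb : ball (map_mx ratr q : T) (m.+1%:R^-1) x by apply/ball_rVP.
  exists (q, m) => //; rewrite /F /= ifT//; apply/asboolP => y.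
  move/ball_rVP => qy; apply: bA; apply/ball_rVP.
  apply: le_lt_trans (ler_distD (map_mx ratr q : T) x y) _.
  rewrite (splitr e); apply: ltrD; last exact: lt_trans qy Hm.
  by rewrite distrC; exact: lt_trans qx Hm.
apply: (@countable_bigcupT_measurable _ B) => // qm; rewrite /F; case: ifP => _ //.
by apply: borel_ball; rewrite invr_gt0.
Qed.

Lemma borel_measurable_lebesgue (A : set T) :
  measurable (A : set B) -> measurable A.
Proof. exact: caratheodory_measurable_mu_ext. Qed.

Lemma lebesgue_borel (A : set T) :
  measurable (A : set B) -> mu A = borel_lebesgue R n A.
Proof. exact: measurable_mu_extE. Qed.

Lemma open_lebesgue (A : set T) : open A -> measurable A.
Proof. by move=> /open_borel; exact: borel_measurable_lebesgue. Qed.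

Lemma closed_lebesgue (A : set T) : closed A -> measurable A.
Proof.
by move=> cA; rewrite -[A]setCK; apply: measurableC; apply/open_lebesgue/closed_openC.
Qed.

Lemma compact_lebesgue (A : set T) : compact A -> measurable A.
Proof. by move=> cA; apply: closed_lebesgue; exact: compact_closed (@norm_hausdorff _ _) cA. Qed.

Lemma borel_fun_lebesgue d (Y : measurableType d) (f : T -> Y) :
  measurable_fun [set: B] f -> measurable_fun [set: T] f.
Proof.
move=> mf _ A mA; rewrite setTI; apply: borel_measurable_lebesgue.
by have := mf measurableT _ mA; rewrite setTI.
Qed.

Lemma continuous_borel (f : T -> R) : continuous f -> measurable_fun [set: B] f.
Proof.
move=> cf; apply: (measurability _ (RGenOInfty.measurableE R)).
move=> _ [_ [x ->] <-]; rewrite setTI; apply: open_borel.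
by apply: open_comp => [y _|]; [exact: cf|exact: rray_open].
Qed.

Lemma continuous_lmeasurable (f : T -> R) : continuous f -> measurable_fun [set: T] f.
Proof. by move=> /continuous_borel; exact: borel_fun_lebesgue. Qed.

(** Tonelli on R^n is available for the iterated Borel measure, whereas the Sobolev
notions use its completion; for Borel integrands the two integrals agree. *)
Lemma ge0_integral_lebesgue_borel (f : T -> \bar R) :
  measurable_fun [set: B] f -> (forall x, 0 <= f x)%E ->
  (\int[mu]_x f x = \int[borel_lebesgue R n]_(x in [set: B]) f x)%E.
Proof.
move=> mf f0.
have mid : measurable_fun [set: T] (id : T -> B).
  by move=> _ A mA; rewrite setTI; exact: borel_measurable_lebesgue.
transitivity (\int[pushforward mu (id : T -> B)]_(x in [set: B]) f x)%E.
  by rewrite ge0_integral_pushforward.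
apply: eq_measure_integral => A mA _.
exact: lebesgue_borel.
Qed.

Lemma lebesgue_box (A : 'I_n -> set R) : (forall i, measurable (A i)) ->
  mu [set x : T | forall i, A i (x ord0 i)] =
  (\prod_(i < n) lebesgue_measure (A i : set (measurableTypeR R)))%E.
Proof.
by move=> mA; rewrite lebesgue_borel; [exact: borel_lebesgue_rect|exact: borel_box].
Qed.

End lebesgue_basic.

(** * Integrals of tensor products and the mollifiers *)

Section tensor_integral.
Variable R : realType.
Local Notation leb := (@lebesgue_measure R).
Local Open Scope ereal_scope.

Lemma measurable_tensor n (g : 'I_n -> R -> R) :
  (forall i, measurable_fun [set: measurableTypeR R] (g i)) ->
  measurable_fun [set: borel_rV R n] (tensor g : borel_rV R n -> R).
Proof.
move=> mg; apply: (@measurable_prod _ (borel_rV R n) R setT 'I_n (index_enum _)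
  (fun i (x : borel_rV R n) => g i ((x : 'rV[R]_n) ord0 i))) => i _.
exact: measurableT_comp (mg i) (measurable_rV_coord i).
Qed.

(** The Borel measure on R^(n+1) is a product measure, so Tonelli peels off one factor
at a time. *)
Lemma integral_tensor n (g : 'I_n -> R -> R) :
  (forall i, measurable_fun [set: measurableTypeR R] (g i)) ->
  (forall i x, (0 <= g i x)%R) ->
  \int[borel_lebesgue R n]_(x in [set: borel_rV R n]) (tensor g x)%:E =
  \prod_(i < n) \int[leb]_x (g i x)%:E.
Proof.
elim: n g => [|n IHn] g mg g0.
  rewrite big_ord0 [X in integral X]/= integral_dirac//; last first.
    by apply/measurable_EFinP; exact: measurable_tensor.
  by rewrite diracT mul1e /tensor big_ord0.
pose g' (i : 'I_n) := g (lift ord0 i).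
have g'0 i x : (0 <= g' i x)%R by exact: g0.
have mg' : measurable_fun [set: borel_rV R n] (tensor g' : borel_rV R n -> R).
  by apply: measurable_tensor => i; exact: mg.
have tg0 m (h : 'I_m -> R -> R) x : (forall i x, 0 <= h i x)%R -> (0 <= tensor h x)%R.
  by move=> h0; apply: prodr_ge0.
rewrite [X in integral X]/= /lebesgue_step ge0_integral_pushforward//; last 3 first.
- exact: measurable_rV_cons.
- by apply/measurable_EFinP; exact: measurable_tensor.
- by move=> x _; rewrite lee_fin tg0.
have E (p : R * borel_rV R n) : ((EFin \o tensor g) \o rV_cons (n := n)) p =
    ((g ord0 p.1)%:E * (tensor g' p.2)%:E).
  rewrite /= /tensor big_ord_recl EFinM; congr (_ * _)%E; first congr (_%:E).
    by congr (g _ _); rewrite -[p in RHS]rV_consK.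
  congr (_%:E); apply: eq_bigr => i _; congr (g _ _).
  have -> : lift ord0 i = rshift 1 i by exact/val_inj.
  exact: (row_mxEr (p.1%:M : 'rV[R]_1) p.2 ord0 i).
pose F (p : measurableTypeR R * borel_rV R n) := (g ord0 p.1)%:E * (tensor g' p.2)%:E.
transitivity (\int[(leb \x borel_lebesgue R n)]_p F p).
  by apply: eq_integral => p _; exact: E.
rewrite (fubini_tonelli1 (m1 := leb) (m2 := borel_lebesgue R n) F); last 2 first.
- apply: emeasurable_funM; apply/measurable_EFinP.
    exact: measurableT_comp (mg ord0) measurable_fst.
  exact: measurableT_comp mg' measurable_snd.
- by move=> p; apply: mule_ge0; rewrite lee_fin; [exact: g0|exact: tg0].
rewrite /fubini_F /F /=.
under eq_integral => x _.
  rewrite ge0_integralZl//; last 3 first.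
  - exact/measurable_EFinP.
  - by move=> y _; rewrite lee_fin tg0.
  - by rewrite lee_fin.
  over.
rewrite ge0_integralZr//; last 3 first.
- exact/measurable_EFinP.
- by move=> x _; rewrite lee_fin.
- by apply: integral_ge0 => y _; rewrite lee_fin tg0.
by rewrite big_ord_recl IHn// => i; exact: mg.
Qed.

End tensor_integral.

Section mollifier.
Variable R : realType.
Local Notation leb := (@lebesgue_measure R).
Implicit Types l : R.

Definition bump_mass l : \bar R := (\int[leb]_x (bump l x)%:E)%E.

Lemma smooth1_bump l : 0 < l -> smooth1 (bump l).
Proof.
move=> l0; have := @bump_smooth1 R l 1 (lt0r_neq0 l0).
by congr smooth1; apply/funext => x; rewrite mul1r.
Qed.

Lemma bump_continuous l : 0 < l -> continuous (bump l).
Proof. by move=> l0; exact/smooth1_continuous/smooth1_bump. Qed.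

Lemma bump_measurable l : 0 < l -> measurable_fun [set: measurableTypeR R] (bump l).
Proof. by move=> l0; apply: continuous_measurable_fun; exact: bump_continuous. Qed.

Lemma bump_even l x : bump l (- x) = bump l x.
Proof. by rewrite /bump mulrN opprK mulrC. Qed.

Lemma flat1_le1 (x : R) : flat 1 x <= 1.
Proof.
rewrite flat1E; case: ifP => // x0.
by rewrite expR_le1 oppr_le0 invr_ge0 ltW.
Qed.

Lemma flat1_ge (x : R) : 2^-1 <= x -> expR (- 2) <= flat 1 x.
Proof.
move=> hx; have x0 : 0 < x by apply: lt_le_trans hx; rewrite invr_gt0.
rewrite flat1E x0 ler_expR lerN2 -[leRHS]invrK lef_pV2 ?posrE ?invr_gt0//.
Qed.

Lemma bump_mass_fin l : 0 < l -> bump_mass l \is a fin_num.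
Proof.
move=> l0; rewrite ge0_fin_numE; last first.
  by apply: integral_ge0 => x _; rewrite lee_fin bump_ge0.
pose I := `[(- l^-1), l^-1]%classic : set R.
apply: (@le_lt_trans _ _ (\int[leb]_x (cst 1%:E \_ I) x)%E).
  apply: ge0_le_integral => //.
  - by move=> x _; rewrite lee_fin bump_ge0.
  - by apply/measurable_EFinP; exact: bump_measurable.
  - by apply/(measurable_restrictT _ (measurable_itv _)); exact: measurable_cst.
  move=> x _; rewrite patchE; case: ifPn => [_|/negP xI].
    rewrite lee_fin; apply: le_trans (ler_pM _ _ (flat1_le1 _) (flat1_le1 _)) _.
    - exact: flat1_ge0.
    - exact: flat1_ge0.
    - by rewrite mulr1.
  rewrite lee_fin leNgt bump_gt0//; apply: contra_notN xI.
  by rewrite ltr_norml inE/I/= in_itv/= => /andP[/ltW -> /ltW ->].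
rewrite -integral_mkcond.
rewrite integral_cst; last exact: measurable_itv.
rewrite mul1e [X in (X < _)%E](lebesgue_measure_itv `[(- l^-1), l^-1])/=.
by case: ifP => // _; rewrite -EFinB ltry.
Qed.

Lemma bump_mass_gt0 l : 0 < l -> (0 < bump_mass l)%E.
Proof.
move=> l0; have il0 : 0 < l^-1 by rewrite invr_gt0.
pose I := `[(- (l^-1 / 2)), (l^-1 / 2)]%classic : set R.
apply: (@lt_le_trans _ _ (\int[leb]_x (cst (expR (- 2) ^+ 2)%:E \_ I) x)%E).
  rewrite -integral_mkcond integral_cst; last exact: measurable_itv.
  rewrite [X in (_ < _ * X)%E](lebesgue_measure_itv `[(- (l^-1 / 2)), (l^-1 / 2)])/= lte_fin ifT.
    rewrite -EFinB -EFinM lte_fin mulr_gt0// ?exprn_gt0 ?expR_gt0//.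
    by rewrite opprK -splitr.
  by rewrite gtrN// divr_gt0.
apply: ge0_le_integral => //.
- by move=> x _; rewrite patchE; case: ifP => // _; rewrite lee_fin exprn_ge0// expR_ge0.
- by apply/(measurable_restrictT _ (measurable_itv _)); exact: measurable_cst.
- by apply/measurable_EFinP; exact: bump_measurable.
move=> x _; rewrite patchE; case: ifPn => [|_]; last by rewrite lee_fin bump_ge0.
rewrite inE /I /= in_itv /= => /andP[h1 h2].
have l1 : l * (l^-1 / 2) = 2^-1 by rewrite mulrA divff ?mul1r ?gt_eqF.
have h3 : l * x <= 2^-1 by rewrite -l1 ler_pM2l.
have h4 : - 2^-1 <= l * x by rewrite -l1 -mulrN ler_pM2l.
by rewrite lee_fin expr2 ler_pM ?expR_ge0//; apply: flat1_ge; lra.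
Qed.

(** Translation invariance is only established on the line, where it follows from a change
of variables; the kernel on R^n being a tensor product, it inherits the
result.  The reflection is absorbed by the evenness of the bump. *)
Lemma bump_mass_shift l (a : R) : 0 < l ->
  (\int[leb]_x (bump l (a - x))%:E = bump_mass l)%E.
Proof.
move=> l0; rewrite /bump_mass.
pose F (x : R) := x - a.
have dF (x : R) : is_derive x 1 F 1.
  have := is_deriveB (is_derive_id x 1) (is_derive_cst a x 1).
  by rewrite subr0.
have F1 : derive1 F = cst 1.
  by apply/funext => x; rewrite derive1E; have [_ ->] := dF x.
rewrite (@increasing_ge0_integration_by_substitutionT R F (bump l)).
- apply: eq_integral => x _; rewrite F1 /= mulr1.
  by rewrite -bump_even opprB.
- by move=> x y xy; rewrite ltrD2r.
- by rewrite F1; exact: cst_continuous.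
- by rewrite F1; exact: is_cvg_cst.
- by rewrite F1; exact: is_cvg_cst.
- by move=> x; have [] := dF x.
- apply/cvgrNyPle => A; near=> x; rewrite lerBlDr.
  by near: x; apply: nbhs_ninfty_le; rewrite num_real.
- apply/cvgryPge => A; near=> x; rewrite lerBrDr.
  by near: x; apply: nbhs_pinfty_ge; rewrite num_real.
- exact: bump_continuous.
- exact: bump_ge0.
Unshelve. all: by end_near. Qed.

Variable n : nat.
Local Notation T := 'rV[R]_n.

(** The kernel has mass 1 and lives in the cube of half-width 1/l. *)
Definition moll l : T -> R := tensor (fun _ x => (fine (bump_mass l))^-1 * bump l x).

Lemma bump_mass_fine_gt0 l : 0 < l -> 0 < fine (bump_mass l).
Proof. by move=> l0; rewrite fine_gt0// bump_mass_gt0//= ltey_eq bump_mass_fin. Qed.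

Lemma moll_ge0 l z : 0 < l -> 0 <= moll l z.
Proof.
move=> l0; apply: prodr_ge0 => i _.
by rewrite mulr_ge0 ?bump_ge0// invr_ge0 ltW// bump_mass_fine_gt0.
Qed.

Lemma smooth_moll l : 0 < l -> smooth (moll l).
Proof. by move=> l0; apply: smooth_tensor => i; apply: bump_smooth1; rewrite gt_eqF. Qed.

Lemma moll_supp l z : 0 < l -> moll l z != 0 -> `|z| < l^-1.
Proof.
move=> l0 h; apply/norm_ltP; first by rewrite invr_gt0.
move=> i; rewrite -bump_gt0// lt0r bump_ge0 andbT.
apply: contraNneq h => b0.
by rewrite /moll /tensor (bigD1 i)//= b0 mulr0 mul0r.
Qed.

Lemma moll_even l z : moll l (- z) = moll l z.
Proof. by apply: eq_bigr => i _; rewrite mxE bump_even. Qed.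

Lemma integral_moll l (x : T) : 0 < l ->
  (\int[@lebesgue R n]_y (moll l (x - y))%:E = 1)%E.
Proof.
move=> l0.
pose g (i : 'I_n) (t : R) := (fine (bump_mass l))^-1 * bump l (x ord0 i - t).
have E y : moll l (x - y) = tensor g y.
  by apply: eq_bigr => i _; rewrite !mxE.
have cb (i : 'I_n) : continuous (fun t : R => bump l (x ord0 i - t)).
  move=> t; apply: (@continuous_comp R R R (fun t => x ord0 i - t) (bump l)).
    by apply: (@continuousB R R); [exact: cst_continuous|exact: cvg_id].
  exact: bump_continuous.
have cg i : continuous (g i).
  by move=> t; apply: (@continuousM R R (cst (fine (bump_mass l))^-1) (fun t => bump l (x ord0 i - t))); [exact: cst_continuous|exact: cb].
have mg i : measurable_fun [set: measurableTypeR R] (g i).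
  by apply: continuous_measurable_fun; exact: cg.
have g0 i t : 0 <= g i t.
  by rewrite mulr_ge0 ?bump_ge0// invr_ge0 ltW// bump_mass_fine_gt0.
rewrite (eq_integral (EFin \o tensor g)); last by move=> y _; rewrite E.
rewrite ge0_integral_lebesgue_borel; last 2 first.
- by apply/measurable_EFinP; exact: measurable_tensor.
- by move=> y; rewrite lee_fin prodr_ge0.
rewrite integral_tensor// big1// => i _.
under eq_integral do rewrite EFinM.
rewrite ge0_integralZl//.
- rewrite bump_mass_shift// -[bump_mass l]fineK ?bump_mass_fin//.
  by rewrite -EFinM mulVf ?gt_eqF// bump_mass_fine_gt0.
- by apply/measurable_EFinP; apply: continuous_measurable_fun; exact: cb.
- by move=> t _; rewrite lee_fin bump_ge0.
- by rewrite lee_fin invr_ge0 ltW// bump_mass_fine_gt0.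
Qed.

End mollifier.

(** * Convolution with a smooth kernel *)

Section integrable_functions.
Context d (T : measurableType d) (R : realType).
Variable mu : {measure set T -> \bar R}.
Implicit Types (f g h : T -> R) (r : R).

Definition Rintegrable f : Prop := mu.-integrable [set: T] (EFin \o f).

Lemma Rintegrable_measurable f : Rintegrable f -> measurable_fun [set: T] f.
Proof. by move=> /measurable_int /measurable_EFinP. Qed.

Lemma RintegrableD f g : Rintegrable f -> Rintegrable g -> Rintegrable (f \+ g).
Proof.
move=> fi gi; rewrite /Rintegrable.
rewrite (_ : EFin \o _ = (EFin \o f) \+ (EFin \o g))%E; last exact/funext.
exact: integrableD.
Qed.

Lemma RintegrableZ r f : Rintegrable f -> Rintegrable (cst r \* f).
Proof.
move=> fi; rewrite /Rintegrable.
rewrite (_ : EFin \o _ = (fun x => r%:E * (f x)%:E)%E); last exact/funext.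
exact: integrableZl.
Qed.

Lemma RintegrableB f g : Rintegrable f -> Rintegrable g -> Rintegrable (f \- g).
Proof.
move=> fi gi; rewrite /Rintegrable.
rewrite (_ : EFin \o _ = (EFin \o f) \- (EFin \o g))%E; last exact/funext.
exact: integrableB.
Qed.

Lemma RintegrableMr f g (C : R) : Rintegrable f -> measurable_fun [set: T] g ->
  (forall x, `|g x| <= C) -> Rintegrable (f \* g).
Proof.
move=> fi mg gC; rewrite /Rintegrable.
rewrite (_ : EFin \o _ = (EFin \o f) \* (EFin \o g))%E; last exact/funext.
apply: integrableMl => //.
exists C; split; first exact: num_real.
by move=> M CM x _; apply: le_trans (gC x) (ltW CM).
Qed.

Definition L1norm f : \bar R := (\int[mu]_x `|f x|%:E)%E.

Lemma L1norm_fin f : Rintegrable f -> (L1norm f < +oo)%E.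
Proof. by move=> /integrableP[_]. Qed.

Lemma L1norm_le f g h : measurable_fun [set: T] f -> measurable_fun [set: T] g ->
  measurable_fun [set: T] h -> (forall x, `|f x| <= `|g x| + `|h x|) ->
  (L1norm f <= L1norm g + L1norm h)%E.
Proof.
move=> mf mg mh fgh; rewrite /L1norm -ge0_integralD//; last 2 first.
- by apply/measurable_EFinP; exact: measurableT_comp.
- by apply/measurable_EFinP; exact: measurableT_comp.
apply: ge0_le_integral => //.
- by apply/measurable_EFinP; exact: measurableT_comp.
- by apply/measurable_EFinP; apply: measurable_funD; exact: measurableT_comp.
- by move=> x _; rewrite -EFinD lee_fin.
Qed.

Lemma eq_norm1 f g : f =1 g -> L1norm f = L1norm g.
Proof. by move=> /funext ->. Qed.

Lemma L1normZ r f : measurable_fun [set: T] f ->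
  L1norm (cst r \* f) = (`|r|%:E * L1norm f)%E.
Proof.
move=> mf; rewrite /L1norm -ge0_integralZl//.
- by apply: eq_integral => x _; rewrite /= normrM EFinM.
- by apply/measurable_EFinP; exact: measurableT_comp.
Qed.

Lemma L1norm_distC f g : L1norm (f \- g) = L1norm (g \- f).
Proof. by apply: eq_integral => x _; rewrite distrC. Qed.

End integrable_functions.
Arguments L1norm {d T R} mu f%_ring_scope.

Section convolution.
Variables (R : realType) (n : nat).
Local Notation mu := (@lebesgue R n).
Local Notation T := 'rV[R]_n.
Implicit Types (f g h rho : T -> R).

Definition conv rho f (x : T) : R := (\int[mu]_y (f y * rho (x - y)))%R.

(** The class of kernels: smooth with all derivatives bounded, so that one may
differentiate under the integral against any integrable function. *)
Definition bounded_smooth rho : Prop :=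
  smooth rho /\ forall s, exists C : R, forall x, `|partials s rho x| <= C.

Lemma bounded_smooth_partial i rho :
  bounded_smooth rho -> bounded_smooth (partial i rho).
Proof.
move=> [sr br]; split; first exact: smooth_partial.
by move=> s; have [C HC] := br (rcons s i); exists C; rewrite -partials_rcons.
Qed.

Lemma continuous_reflect rho (x : T) : continuous rho ->
  continuous (fun y : T => rho (x - y)).
Proof.
move=> cr y; apply: (@continuous_comp _ _ _ (fun y : T => x - y) rho); last exact: cr.
by apply: (@continuousB R T); [exact: cst_continuous|exact: cvg_id].
Qed.

Lemma Rintegrable_conv rho f (C : R) (x : T) : continuous rho ->
  (forall x, `|rho x| <= C) -> Rintegrable mu f -> Rintegrable mu (fun y => f y * rho (x - y)).
Proof.
move=> cr rC fi; apply: (@RintegrableMr _ _ _ _ f (fun y => rho (x - y)) C) => //.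
by apply: continuous_lmeasurable; exact: continuous_reflect.
Qed.

Lemma bounded_smoothP rho : bounded_smooth rho ->
  continuous rho /\ exists C : R, forall x, `|rho x| <= C.
Proof. by move=> [sr /(_ [::])]; split=> //; have [] := smooth_cont_diff sr. Qed.

(** Differentiation under the integral along the i-th coordinate line, the derivative
of the integrand being dominated by a multiple of |f|. *)
Lemma is_derive_conv rho f i x : bounded_smooth rho -> Rintegrable mu f ->
  is_derive x (delta_mx ord0 i) (conv rho f) (conv (partial i rho) f x).
Proof.
move=> br fi; have [cr [C0 HC0]] := bounded_smoothP br.
have bri := bounded_smooth_partial i br.
have [cri [C HC]] := bounded_smoothP bri.
have [_ dr] := smooth_cont_diff br.1.
apply: is_derive_line0.
(* The integrand along the coordinate line, as a function of its real parameter. *)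
pose F (t : R) (y : T) := f y * rho (t *: delta_mx ord0 i + x - y).
have dF (t : R) (y : T) : is_derive t 1 (F ^~ y)
    (f y * partial i rho (t *: delta_mx ord0 i + x - y)).
  have h : is_derive t 1 (fun t : R => rho (t *: delta_mx ord0 i + (x - y)))
      (partial i rho (t *: delta_mx ord0 i + (x - y))).
    by apply: is_derive_line; exact: derivableP.
  have := is_deriveM (is_derive_cst (f y) t 1) h.
  rewrite scaler0 addr0 /F; congr (is_derive _ _ _ _); last by rewrite addrA.
  by apply/funext => t'; rewrite -addrA.
have E0 : 0 *: delta_mx ord0 i + x = x by rewrite scale0r add0r.
have intF (t : R) : mu.-integrable [set: T] (EFin \o F t).
  exact: (Rintegrable_conv (t *: delta_mx ord0 i + x) cr HC0 fi).
have d1F t y : partial1of2 F t y = f y * partial i rho (t *: delta_mx ord0 i + x - y).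
  by rewrite partial1of2E; have [_ ->] := dF t y.
pose G (y : T) := `|f y| * `|C|.
have GF (t : R) (y : T) : `|partial1of2 F t y| <= G y.
  rewrite d1F normrM ler_wpM2l//; exact: le_trans (HC _) (ler_norm _).
have intG : mu.-integrable [set: T] (EFin \o G).
  have fi' : Rintegrable mu (normr \o f) by exact: integrable_norm.
  by apply: (@RintegrableMr _ _ _ _ _ (cst `|C|) `|C| fi') => // y; rewrite normr_id.
have I0 : `](-1), 1[%classic (0 : R) by rewrite /= in_itv/= ltrN10 ltr01.
have G0 (y : T) : 0 <= G y by rewrite mulr_ge0.
have lim := @cvg_differentiation_under_integral R _ T mu F setT measurableT 0 (-1) 1 I0
  (fun t _ => intF t) (fun t y _ _ => let: DeriveDef h _ := dF t y in h) G G0 intG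
  (fun t y _ _ => GF t y).
have E1 : (\int[mu]_(y in [set: T]) partial1of2 F 0 y)%R = conv (partial i rho) f x.
  by apply: eq_Rintegral => y _; rewrite d1F E0.
rewrite E1 in lim.
pose K (h : R) := conv rho f (h *: delta_mx ord0 i + x).
have E2 : (fun h : R => h^-1 *: ((K \o shift 0) (h *: 1) - K 0)) =
    (fun h : R => h^-1 *: (K (h + 0) - K 0)).
  by apply/funext => h /=; rewrite [h *: 1]mulr1.
rewrite -/K.
split; first by rewrite /derivable E2; apply/cvg_ex; exists (conv (partial i rho) f x).
by rewrite /derive E2; apply/cvg_lim.
Qed.

Lemma partial_conv rho f i : bounded_smooth rho -> Rintegrable mu f ->
  partial i (conv rho f) = conv (partial i rho) f.
Proof.
by move=> br fi; apply/funext => x; have [_ <-] := is_derive_conv i x br fi.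
Qed.

Lemma conv_bounded rho f : bounded_smooth rho -> Rintegrable mu f ->
  exists C : R, forall x, `|conv rho f x| <= C.
Proof.
move=> br fi; have [cr [C HC]] := bounded_smoothP br.
have fi' : Rintegrable mu (normr \o f) by exact: integrable_norm.
exists (`|C| * (\int[mu]_y `|f y|)%R) => x; rewrite /conv.
apply: le_trans (le_normr_Rintegral measurableT (Rintegrable_conv x cr HC fi)) _.
rewrite -RintegralZl//; apply: le_Rintegral => //.
- by apply: integrable_norm; exact: (Rintegrable_conv x cr HC fi).
- exact: (RintegrableZ `|C| fi').
- by move=> y _; rewrite normrM mulrC ler_wpM2r//; exact: le_trans (HC _) (ler_norm _).
Qed.

(** A convolution differentiates onto its kernel, so convolutions with kernels in the
class form an invariant for [smooth_coind]. *)
Lemma smooth_conv rho f : bounded_smooth rho -> Rintegrable mu f -> smooth (conv rho f).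
Proof.
move=> br fi; apply: (@smooth_coind _ _ (fun g =>
  exists2 rho, bounded_smooth rho & g = conv rho f)); last by exists rho.
- move=> _ [{}rho {}br ->].
  have dr i x : derivable (conv rho f) x (delta_mx ord0 i).
    by have [] := is_derive_conv i x br fi.
  split=> //.
  have H (i : 'I_n) : exists C : R, forall x, `|partial i (conv rho f) x| <= C.
    by rewrite partial_conv//; apply: conv_bounded => //; exact: bounded_smooth_partial.
  pose C i := sval (cid (H i)).
  apply: (@lipschitz_partial_continuous _ _ _ (\sum_i `|C i|)) => // i x.
  apply: le_trans (svalP (cid (H i)) x) _; apply: le_trans (ler_norm _) _.
  by rewrite (bigD1 i)//= lerDl sumr_ge0.
- move=> _ i [{}rho {}br ->]; exists (partial i rho); first exact: bounded_smooth_partial.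
  exact: partial_conv.
Qed.

Lemma partials_conv rho f s : bounded_smooth rho -> Rintegrable mu f ->
  partials s (conv rho f) = conv (partials s rho) f.
Proof.
move=> + fi; elim/last_ind: s rho => [//|s i IH] rho br.
rewrite !partials_rcons partial_conv// IH//; exact: bounded_smooth_partial.
Qed.

Lemma convD rho f g x : bounded_smooth rho -> Rintegrable mu f -> Rintegrable mu g ->
  conv rho (f \+ g) x = conv rho f x + conv rho g x.
Proof.
move=> br fi gi; have [cr [C HC]] := bounded_smoothP br.
rewrite /conv -RintegralD//; last 2 first.
- exact: Rintegrable_conv HC fi.
- exact: Rintegrable_conv HC gi.
by apply: eq_Rintegral => y _; rewrite mulrDl.
Qed.

Lemma convZ rho r f x : bounded_smooth rho -> Rintegrable mu f ->
  conv rho (cst r \* f) x = r * conv rho f x.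
Proof.
move=> br fi; have [cr [C HC]] := bounded_smoothP br.
rewrite /conv -RintegralZl//; last exact: Rintegrable_conv HC fi.
by apply: eq_Rintegral => y _; rewrite mulrA.
Qed.

Lemma convB rho f g x : bounded_smooth rho -> Rintegrable mu f -> Rintegrable mu g ->
  conv rho (f \- g) x = conv rho f x - conv rho g x.
Proof.
move=> br fi gi; have [cr [C HC]] := bounded_smoothP br.
rewrite /conv -RintegralB//; last 2 first.
- exact: Rintegrable_conv HC fi.
- exact: Rintegrable_conv HC gi.
by apply: eq_Rintegral => y _; rewrite mulrBl.
Qed.

Lemma conv_eq0 rho f x : (forall y, f y * rho (x - y) = 0) -> conv rho f x = 0.
Proof.
move=> H; rewrite /conv; under eq_Rintegral do rewrite H.
by rewrite Rintegral_cst ?mul0r.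
Qed.

Lemma conv_measurable rho f : bounded_smooth rho -> Rintegrable mu f ->
  measurable_fun [set: T] (conv rho f).
Proof.
move=> br fi; apply: continuous_lmeasurable.
by have [] := smooth_cont_diff (smooth_conv br fi).
Qed.

Lemma compact_support_bounded f : continuous f -> compact (Defs.support f) ->
  exists C : R, forall x, `|f x| <= C.
Proof.
move=> cf cs.
have : compact (f @` Defs.support f).
  by apply: continuous_compact => //; exact: continuous_subspaceT.
move=> /compact_bounded [M [_ HM]].
exists (`|M| + 1) => x.
have [fx0|fx0] := eqVneq (f x) 0; first by rewrite fx0 normr0 addr_ge0.
apply: (HM (`|M| + 1)); last by exists x => //; exact: subset_closure.
by apply: le_lt_trans (ler_norm M) _; rewrite ltrDl.
Qed.

Lemma partials_support s f x : ~ Defs.support f x -> partials s f x = 0.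
Proof.
move=> fx; have oA : open (~` Defs.support f) by apply: closed_openC; exact: closed_closure.
rewrite (@partials_local _ _ s f (cst 0) _ oA _ x)//; last first.
  move=> y fy; apply/eqP; apply: contra_notT fy => fy.
  exact: subset_closure.
have -> : partials s (cst 0 : T -> R) = cst 0.
  by elim: s => [//|i s IH] /=; rewrite IH partial_cst.
by [].
Qed.

Lemma support_partials s f : Defs.support (partials s f) `<=` Defs.support f.
Proof.
rewrite {1}/Defs.support => x; rewrite closureE; apply.
split; first exact: closed_closure.
by move=> y /= fy; apply: contrapT => /(partials_support s); apply/eqP.
Qed.

Lemma compact_support_bounded_smooth f :
  smooth f -> compact (Defs.support f) -> bounded_smooth f.
Proof.
move=> sf cs; split=> // s; apply: compact_support_bounded.
  by have [] := smooth_cont_diff (smooth_partials s sf).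
exact: subclosed_compact (@closed_closure _ _) cs (@support_partials s f).
Qed.

Lemma moll_bounded_smooth (l : R) : 0 < l -> bounded_smooth (@moll R n l).
Proof.
move=> l0; apply: compact_support_bounded_smooth; first exact: smooth_moll.
apply: bounded_closed_compact; last exact: closed_closure.
have sub : Defs.support (@moll R n l) `<=` closed_ball (0 : T) l^-1.
  rewrite /Defs.support => x; rewrite closureE; apply; split; first exact: closed_ball_closed.
  move=> y /= /(moll_supp l0) yl; apply: subset_closed_ball; apply/ball_rVP.
  by rewrite sub0r normrN.
exists l^-1; split; first exact: num_real.
move=> M lM x /sub; rewrite closed_ballE ?invr_gt0// /closed_ball_ /= sub0r normrN.
by move=> h; apply: le_trans h (ltW lM).
Qed.

End convolution.

(** * Mollification converges in L^1 *)

Section mollification.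
Variables (R : realType) (n : nat).
Local Notation mu := (@lebesgue R n).
Local Notation T := 'rV[R]_n.
Local Notation B := (borel_rV R n).
Implicit Types (f g : T -> R) (j : nat).

Definition mollify j f : T -> R := conv (@moll R n j.+1%:R) f.

Let j0 j : 0 < j.+1%:R :> R. Proof. by rewrite ltr0n. Qed.

Lemma measurable_coord i : measurable_fun [set: T] (fun x : T => x ord0 i).
Proof. by apply: continuous_lmeasurable; exact: continuous_coord. Qed.

Lemma measurable_sub_borel : measurable_fun [set: T * T] (fun p => p.1 - p.2 : B).
Proof.
apply: measurable_fun_rV => i.
have -> : @rV_coord R n i \o (fun p : T * T => p.1 - p.2 : B) =
    (fun p => p.1 ord0 i - p.2 ord0 i).
  by apply/funext => p; rewrite /rV_coord /= !mxE.
apply: measurable_funB.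
  exact: measurableT_comp (measurable_coord i) measurable_fst.
exact: measurableT_comp (measurable_coord i) measurable_snd.
Qed.

(** Tonelli: the mass of the kernel is 1 in either variable. *)
Lemma L1norm_mollify j f : Rintegrable mu f -> (L1norm mu (mollify j f) <= L1norm mu f)%E.
Proof.
move=> fi; have mf := Rintegrable_measurable fi.
have br := moll_bounded_smooth n (j0 j).
have [cr [C HC]] := bounded_smoothP br.
pose rho := @moll R n j.+1%:R.
pose F (p : T * T) : \bar R := (`|f p.2|%:E * (rho (p.1 - p.2))%:E)%E.
have rho0 z : 0 <= rho z by exact: moll_ge0.
have mF : measurable_fun [set: T * T] F.
  apply: emeasurable_funM; apply/measurable_EFinP.
    exact: measurableT_comp (measurableT_comp (@normr_measurable R setT) mf) measurable_snd.
  exact: measurableT_comp (continuous_borel cr) measurable_sub_borel.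
have F0 p : (0 <= F p)%E by rewrite mule_ge0// lee_fin.
(* Exchange the order of integration of |f(y)| rho(x - y). *)
have fub := fubini_tonelli (m1 := mu) (m2 := mu) F mF F0.
have step x : (`|mollify j f x|%:E <= \int[mu]_y F (x, y))%E.
  have iconv := Rintegrable_conv x cr HC fi.
  rewrite /mollify /conv (EFin_normr_Rintegral measurableT iconv).
  apply: le_trans (le_abse_integral _ measurableT _) _.
    by apply/measurable_EFinP; exact: Rintegrable_measurable iconv.
  under eq_integral => y _ do rewrite /= normrM (ger0_norm (rho0 _)) EFinM.
  exact: lexx.
have Fy y : (\int[mu]_x F (x, y) = `|f y|%:E)%E.
  have mr : measurable_fun [set: T] (fun x : T => (rho (x - y))%:E).
    apply/measurable_EFinP; apply: continuous_lmeasurable.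
    have -> : (fun x : T => rho (x - y)) = (fun x : T => rho (y - x)).
      by apply/funext => x; rewrite /rho -moll_even opprB.
    exact: continuous_reflect.
  have r0 (x : T) : [set: T] x -> (0 <= (rho (x - y))%:E)%E by rewrite lee_fin.
  rewrite /F (ge0_integralZl_EFin mu measurableT r0 mr (normr_ge0 (f y))).
  suff -> : (\int[mu]_x (rho (x - y))%:E)%E = 1%E by rewrite mule1.
  rewrite -(integral_moll y (j0 j)).
  by apply: eq_integral => x _; rewrite /rho -moll_even opprB.
have -> : L1norm mu f = (\int[mu]_x \int[mu]_y F (x, y))%E.
  by rewrite fub; apply: eq_integral => y _; rewrite Fy.
apply: ge0_le_integral.
- exact: measurableT.
- by move=> x _; rewrite lee_fin.
- apply/measurable_EFinP; apply: measurableT_comp; first exact: normr_measurable.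
  exact: conv_measurable.
- have h := @measurable_fun_fubini_tonelli_F _ _ _ _ _ mu F mF F0.
  exact: h.
- by move=> x _; exact: step.
Qed.

(** The property that mollification converges to f in L^1, stated with explicit bounds so
that it can be transported by three-epsilon arguments. *)
Definition approximable f : Prop :=
  forall e : R, 0 < e -> exists J, forall j, (J <= j)%N ->
    (L1norm mu (mollify j f \- f) <= e%:E)%E.

(** Mollification being a contraction, the property is closed under L^1 limits. *)
Lemma approximable_close f : Rintegrable mu f ->
  (forall e : R, 0 < e -> exists2 g, Rintegrable mu g /\ approximable g &
    (L1norm mu (f \- g) <= e%:E)%E) -> approximable f.
Proof.
move=> fi H e e0; have e3 : 0 < e / 3 by rewrite divr_gt0.
have [g [gi ag] fg] := H _ e3.
have [J HJ] := ag _ e3.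
exists J => j Jj; have br := moll_bounded_smooth n (j0 j).
have mcf := conv_measurable br fi; have mcg := conv_measurable br gi.
have mf := Rintegrable_measurable fi; have mg := Rintegrable_measurable gi.
have fgi := RintegrableB fi gi.
pose d := f \- g; pose h := mollify j g \- g.
apply: (@le_trans _ _ (L1norm mu (mollify j d) + L1norm mu (h \- d)%R)%E).
  apply: L1norm_le.
  - exact: measurable_funB.
  - exact: conv_measurable.
  - by apply: measurable_funB; exact: measurable_funB.
  - move=> x; rewrite /h /d /mollify /= convB//; apply: le_trans (ler_normD _ _).
    by rewrite le_eqVlt; apply/orP; left; apply/eqP; congr `|_|; ring.
apply: (@le_trans _ _ (L1norm mu d + (L1norm mu h + L1norm mu d))%E).
  apply: leeD; first exact: L1norm_mollify.
  apply: L1norm_le.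
  - by apply: measurable_funB; exact: measurable_funB.
  - exact: measurable_funB.
  - exact: measurable_funB.
  - by move=> x; exact: ler_normB.
have -> : e = e / 3 + (e / 3 + e / 3) by field.
by rewrite !EFinD; apply: leeD => //; apply: leeD => //; exact: HJ.
Qed.

Lemma approximableD f g : Rintegrable mu f -> Rintegrable mu g -> approximable f -> approximable g ->
  approximable (f \+ g).
Proof.
move=> fi gi af ag e e0; have e2 : 0 < e / 2 by rewrite divr_gt0.
have [J HJ] := af _ e2; have [K HK] := ag _ e2.
exists (maxn J K) => j; rewrite geq_max => /andP[Jj Kj].
have br := moll_bounded_smooth n (j0 j).
have mcf := conv_measurable br fi; have mcg := conv_measurable br gi.
have mf := Rintegrable_measurable fi; have mg := Rintegrable_measurable gi.
apply: (@le_trans _ _ (L1norm mu (mollify j f \- f)%R + L1norm mu (mollify j g \- g)%R)%E).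
  apply: L1norm_le.
  - apply: measurable_funB; last exact: measurable_funD.
    by apply: conv_measurable => //; exact: RintegrableD.
  - exact: measurable_funB.
  - exact: measurable_funB.
  - move=> x; rewrite /mollify /= convD//; apply: le_trans (ler_normD _ _).
    by rewrite le_eqVlt; apply/orP; left; apply/eqP; congr `|_|; ring.
by rewrite (splitr e) EFinD; apply: leeD; [exact: HJ|exact: HK].
Qed.

Lemma approximableZ r f : Rintegrable mu f -> approximable f -> approximable (cst r \* f).
Proof.
move=> fi af e e0; have r1 : 0 < `|r| + 1 by rewrite ltr_wpDl.
have [J HJ] := af (e / (`|r| + 1)) (divr_gt0 e0 r1).
exists J => j /HJ {}HJ.
have br := moll_bounded_smooth n (j0 j).
have -> : L1norm mu (mollify j (cst r \* f) \- (cst r \* f)) =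
    L1norm mu (cst r \* (mollify j f \- f)).
  by apply: eq_norm1 => x; rewrite /mollify /= convZ// mulrBr.
rewrite L1normZ; last first.
  by apply: measurable_funB; [exact: conv_measurable br fi|exact: Rintegrable_measurable fi].
apply: (@le_trans _ _ (`|r|%:E * (e / (`|r| + 1))%:E)%E).
  by apply: lee_wpmul2l => //; rewrite lee_fin.
rewrite -EFinM lee_fin mulrA ler_pdivrMr// mulrC ler_wpM2l ?ltW//.
by rewrite ltrDl.
Qed.

(** Extended real bounds make the whole space a box and keep boxes stable under
intersection, as the pi-lambda theorem requires. *)
Definition box (a b : 'I_n -> \bar R) : set T :=
  [set x | forall i, (a i < (x ord0 i)%:E < b i)%E].

Lemma near_lt_ereal (t : R) (c : \bar R) : t%:E != c ->
  \forall s \near t, ((c < s%:E)%E = (c < t%:E)%E) /\ ((s%:E < c)%E = (t%:E < c)%E).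
Proof.
case: c => [c||] tc; last 2 first.
- by near=> s; rewrite !ltry !ltNge !leey.
- by near=> s; rewrite !ltNyr !ltNge !leNye.
have : t != c by apply: contraNneq tc => ->.
rewrite neq_lt => /orP[tc'|tc'].
  near=> s; have sc : s < c by near: s; exact: lt_nbhsl.
  by rewrite !lte_fin sc tc' ltNge (ltW sc) ltNge (ltW tc').
near=> s; have sc : c < s by near: s; exact: lt_nbhsr.
by rewrite !lte_fin sc tc' [s < c]ltNge (ltW sc) [t < c]ltNge (ltW tc').
Unshelve. all: by end_near. Qed.

(** Off the hyperplanes that bound the box, membership is locally constant. *)
Lemma near_box a b (x : T) : (forall i, (x ord0 i)%:E != a i) ->
  (forall i, (x ord0 i)%:E != b i) -> \forall y \near x, box a b y <-> box a b x.
Proof.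
move=> xa xb.
have H : \forall y \near (x : T), forall i : 'I_n,
    (a i < ((y : T) ord0 i)%:E < b i)%E = (a i < (x ord0 i)%:E < b i)%E.
  apply: (@filter_forall T 'I_n (fun i y => (a i < (y ord0 i)%:E < b i)%E =
      (a i < (x ord0 i)%:E < b i)%E) (nbhs x) _) => i.
  have := near_lt_ereal (xa i); have := near_lt_ereal (xb i).
  move=> /(@continuous_coord R n i x) hb /(@continuous_coord R n i x) ha.
  apply: (@filterS2 _ (nbhs x) _ _ _ _ _ ha hb) => y /= [-> _] [_ ->] //.
by apply: filterS H => y Hy; split=> h i; [rewrite -Hy|rewrite Hy].
Qed.

Lemma box_borel a b : measurable (box a b : set B).
Proof.
apply: (@borel_box R n (fun i => [set t | (a i < t%:E < b i)%E])) => i.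
have -> : [set t | (a i < t%:E < b i)%E] =
    EFin @^-1` ([set x | (a i < x)%E] `&` [set x | (x < b i)%E]).
  by apply/seteqP; split=> t /= => [/andP[]|[-> ->]].
rewrite -[X in measurable X]setTI; apply: EFin_measurable => //.
by apply: measurableI; rewrite -set_itvE; exact: emeasurable_itv.
Qed.

Lemma boxI a b a' b' : box a b `&` box a' b' =
  box (fun i => maxe (a i) (a' i)) (fun i => mine (b i) (b' i)).
Proof.
apply/seteqP; split=> x.
  by move=> [h h'] i; have := h i; have := h' i; rewrite gt_max lt_min => /andP[-> ->] /andP[-> ->].
move=> h; split=> i; have := h i; rewrite gt_max lt_min => /andP[/andP[h1 h2] /andP[h3 h4]].
  by rewrite h1 h3.
by rewrite h2 h4.
Qed.

Definition cube (r : R) : set T := box (fun=> (- r)%:E) (fun=> r%:E).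

Lemma cubeP r x : 0 < r -> cube r x <-> `|x| < r.
Proof.
move=> r0; rewrite norm_ltP//; split=> h i; have := h i.
  by rewrite !lte_fin ltr_norml.
by rewrite !lte_fin ltr_norml.
Qed.

Lemma cube_lebesgue r : (mu (cube r) < +oo)%E.
Proof.
rewrite [cube r](_ : _ = [set x : T | forall i, `](- r), r[%classic (x ord0 i)]); last first.
  by apply/seteqP; split=> x h i; have := h i; rewrite /= in_itv /= !lte_fin.
rewrite (@lebesgue_box R n (fun=> `](- r), r[%classic)); last by move=> i; exact: measurable_itv.
rewrite lebesgue_measure_itv /=.
rewrite ltey_eq prode_fin_num// => i _.
by case: ifP => // _; rewrite -EFinB.
Qed.

Lemma hyperplane_null (i : 'I_n) (c : \bar R) :
  {ae mu, forall x : T, (x ord0 i)%:E != c}.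
Proof.
case: c => [c||]; last 2 first.
- by apply: aeW.
- by apply: aeW.
pose A (k : 'I_n) : set R := if k == i then [set c] else setT.
have mA k : measurable (A k) by rewrite /A; case: ifP.
exists [set x : T | forall k, A k (x ord0 k)]; split.
- by apply: borel_measurable_lebesgue; exact: borel_box.
- by rewrite lebesgue_box// (bigD1 i)//= /A eqxx lebesgue_measure_set1 mul0e.
- move=> x /= /negP; rewrite negbK eqe => /eqP xc k; rewrite /A; case: ifP => // /eqP ->.
  by rewrite xc.
Qed.

End mollification.

Section indicators.
Context d (T : measurableType d) (R : realType).
Variable mu : {measure set T -> \bar R}.

Lemma Rintegrable_indic (A : set T) : measurable A -> (mu A < +oo)%E -> Rintegrable mu (\1_A : T -> R).
Proof.
move=> mA Aoo; apply/integrableP; split.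
  by apply/measurable_EFinP; exact: measurable_indic.
rewrite (eq_integral (fun x => (\1_A x)%:E)); last first.
  by move=> x _; rewrite gee0_abs// lee_fin.
by rewrite integral_indic// setIT.
Qed.

Lemma indicB (A B : set T) : B `<=` A ->
  \1_(A `\` B) = (\1_A : T -> R) \- \1_B.
Proof.
move=> BA; apply/funext => x /=; rewrite !indicE.
have [xB|xB] := boolP (x \in B).
  rewrite (_ : x \in A) ?subrr; last by move: xB; rewrite !inE => /BA.
  by rewrite memNset// => -[_]; apply; rewrite -inE.
rewrite subr0; congr (_%:R); congr nat_of_bool.
by rewrite in_setD xB andbT.
Qed.

Lemma L1norm_indic (A : set T) : measurable A -> L1norm mu (\1_A : T -> R) = mu A.
Proof.
move=> mA; rewrite /L1norm.
transitivity (\int[mu]_x (\1_A x)%:E)%E; last by rewrite integral_indic// setIT.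
by apply: eq_integral => x _; rewrite ger0_norm.
Qed.

(** Convergence to 0 in the extended reals, in the form used by [approximable]. *)
Lemma cvge0_le (u : (\bar R)^nat) (e : R) : u j @[j --> \oo] --> 0%E -> 0 < e ->
  exists J, forall j, (J <= j)%N -> (u j <= e%:E)%E.
Proof.
move=> u0 e0.
have : nbhs (0%E : \bar R) [set y | (y < e%:E)%E].
  by apply: open_nbhs_nbhs; split; [exact: open_ereal_lt_ereal|rewrite /= lte_fin].
by move=> /u0 [J _ HJ]; exists J => j Jj; apply: ltW; exact: HJ.
Qed.

End indicators.

Section mollification_converges.
Variables (R : realType) (n : nat).
Local Notation mu := (@lebesgue R n).
Local Notation T := 'rV[R]_n.
Local Notation B := (borel_rV R n).
Implicit Types (f g : T -> R) (j : nat).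

Let j0 j : 0 < j.+1%:R :> R. Proof. by rewrite ltr0n. Qed.

Lemma Rintegrable_moll j (x : T) : Rintegrable mu (fun y => @moll R n j.+1%:R (x - y)).
Proof.
have [cr _] := bounded_smoothP (moll_bounded_smooth n (j0 j)).
apply/integrableP; split.
  by apply/measurable_EFinP; apply: continuous_lmeasurable; exact: continuous_reflect.
rewrite (eq_integral (fun y : T => (@moll R n j.+1%:R (x - y))%:E)).
  by rewrite integral_moll// ltry.
by move=> y _; rewrite gee0_abs// lee_fin moll_ge0.
Qed.

Lemma Rintegral_moll j (x : T) : (\int[mu]_y @moll R n j.+1%:R (x - y))%R = 1.
Proof. by rewrite /Rintegral integral_moll. Qed.

(** The value of the mollification at x sees f only within the radius of the kernel.
This gives pointwise convergence for indicators and makes cutoffs exactly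
constant. *)
Lemma mollify_const j f x (c : R) :
  (forall y, `|x - y| < j.+1%:R^-1 -> f y = c) -> mollify j f x = c.
Proof.
move=> fc; rewrite -[RHS]mulr1 -(Rintegral_moll j x).
rewrite -(RintegralZl _ measurableT (Rintegrable_moll j x)).
apply: eq_Rintegral => y _.
have [->|h] := eqVneq (@moll R n j.+1%:R (x - y)) 0; first by rewrite !mulr0.
by rewrite fc//; exact: moll_supp h.
Qed.

Lemma mollify_ge0 j f x : (forall y, 0 <= f y) -> 0 <= mollify j f x.
Proof. by move=> f0; apply: Rintegral_ge0 => y _; rewrite mulr_ge0// moll_ge0. Qed.

Lemma mollify_le j f x (c : R) : Rintegrable mu f -> (forall y, f y <= c) -> mollify j f x <= c.
Proof.
move=> fi fc; rewrite -[leRHS]mulr1 -(Rintegral_moll j x).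
rewrite -(RintegralZl _ measurableT (Rintegrable_moll j x)).
have [cr [C HC]] := bounded_smoothP (moll_bounded_smooth n (j0 j)).
apply: le_Rintegral.
- exact: measurableT.
- exact: Rintegrable_conv HC fi.
- exact: (RintegrableZ c (Rintegrable_moll j x)).
- by move=> y _; rewrite ler_wpM2r// moll_ge0.
Qed.

Lemma cube_measurable r : measurable (@cube R n r).
Proof. by apply: borel_measurable_lebesgue; exact: box_borel. Qed.

(** By [near_box] and [mollify_const] the mollified indicators are eventually constant at
almost every point, and they are dominated by the indicator of a larger cube. *)
Lemma approximable_indic_box a b r : 0 < r -> @box R n a b `<=` cube r ->
  approximable (\1_(box a b) : T -> R).
Proof.
move=> r0 ab; set A := box a b.
have mA : measurable A by apply: borel_measurable_lebesgue; exact: box_borel.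
have Aoo : (mu A < +oo)%E.
  apply: le_lt_trans (cube_lebesgue n r); apply: le_measure => //; rewrite inE//.
  exact: cube_measurable.
have Ai := Rintegrable_indic mA Aoo.
pose f j (x : T) := (mollify j (\1_A : T -> R) x)%:E.
have cvgf : {ae mu, forall x, [set: T] x -> f ^~ x @ \oo --> (\1_A x)%:E}.
  have Hab : {ae mu, forall x : T, forall i : 'I_n,
      (x ord0 i)%:E != a i /\ (x ord0 i)%:E != b i}.
    apply: (@filter_forall T 'I_n (fun i x => (x ord0 i)%:E != a i /\ (x ord0 i)%:E != b i)) => i.
    have := hyperplane_null i (a i); have := hyperplane_null i (b i).
    by apply: filterS2 => x h1 h2.
  apply: filterS Hab => x Hx _.
  have /nbhs_ballP[e /= e0 He] := near_box (fun i => (Hx i).1) (fun i => (Hx i).2).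
  apply: cvg_near_cst; near=> j; rewrite /f; congr (_%:E).
  apply: mollify_const => y xy; rewrite !indicE.
  have yb : box a b y <-> box a b x.
    apply: He; apply/ball_rVP; apply: lt_trans xy _.
    by near: j; exact: (near_infty_natSinv_lt (PosNum e0)).
  congr (_%:R); congr nat_of_bool.
  by apply/idP/idP; rewrite !inE => /yb.
have bnd : {ae mu, forall x j, [set: T] x -> (`|f j x| <= (\1_(@cube R n (r + 1)) x)%:E)%E}.
  apply: aeW => x j _; rewrite /f abse_EFin lee_fin indicE.
  have [xQ|xQ] := boolP (x \in cube (r + 1)).
    rewrite ger0_norm; last by apply: mollify_ge0 => y; rewrite indicE.
    by apply: mollify_le => // y; rewrite indicE; case: (y \in A).
  rewrite (@mollify_const _ _ _ 0) ?normr0// => y xy.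
  rewrite indicE memNset// => /ab /cubeP yr.
  move/negP: xQ; apply; rewrite inE; apply/cubeP; first by rewrite addr_gt0.
  rewrite -[x](subrK y); apply: le_lt_trans (ler_normD _ _) _.
  rewrite addrC; apply: ltrD; first exact: yr.
  by apply: lt_le_trans xy _; rewrite invf_le1// ler1n.
have [_ lim _] := dominated_convergence measurableT
  (fun j => (measurable_EFinP _ _).2 (conv_measurable (moll_bounded_smooth n (j0 j)) Ai))
  ((measurable_EFinP _ _).2 (measurable_indic mA)) cvgf
  (Rintegrable_indic (cube_measurable (r + 1)) (cube_lebesgue n (r + 1))) bnd.
move=> e e0; have [J HJ] := cvge0_le lim e0.
by exists J => j /HJ.
Unshelve. all: by end_near. Qed.

End mollification_converges.

Import HBSimple.

Section mollification_L1.
Variables (R : realType) (n : nat).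
Local Notation mu := (@lebesgue R n).
Local Notation T := 'rV[R]_n.
Local Notation B := (borel_rV R n).
Implicit Types (f g : T -> R) (j : nat).

Lemma lebesgue_subcube (A : set T) r : measurable A -> A `<=` cube r ->
  (mu A < +oo)%E.
Proof.
move=> mA Ar; apply: le_lt_trans (cube_lebesgue n r); apply: le_measure => //.
  by rewrite inE.
by rewrite inE; exact: cube_measurable.
Qed.

(** Proper differences follow from linearity, increasing unions from continuity of
the measure. *)
Let lambdaH (r : R) : 0 < r -> lambda_system [set: T]
  [set A : set T | measurable (A : set B) /\ approximable (\1_(A `&` cube r) : T -> R)].
Proof.
move=> r0; have Qb : measurable (@cube R n r : set B) by exact: box_borel.
have RintegrableI (A : set T) : measurable (A : set B) -> Rintegrable mu (\1_(A `&` cube r) : T -> R).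
  move=> mA; have mAr : measurable (A `&` cube r).
    by apply: borel_measurable_lebesgue; exact: (measurableI (A : set B) _ mA Qb).
  by apply: Rintegrable_indic => //; apply: (lebesgue_subcube (r := r) mAr) => x [].
split => //.
- split; first exact: (@measurableT _ B).
  by rewrite setTI; apply: (approximable_indic_box r0).
- move=> A C CA [mA aA] [mC aC]; split; first exact: (measurableD mA mC).
  have -> : (A `\` C) `&` cube r = (A `&` cube r) `\` (C `&` cube r).
    apply/seteqP; split=> x /=; first by move=> [[Ax Cx] Qx]; split=> // -[].
    by move=> [[Ax Qx] h]; split=> //; split=> // Cx; exact: h.
  rewrite indicB; last by apply: setSI.
  have -> : (\1_(A `&` cube r) : T -> R) \- \1_(C `&` cube r) =
     \1_(A `&` cube r) \+ (cst (-1) \* \1_(C `&` cube r)).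
    by apply/funext => x /=; rewrite mulN1r.
  apply: approximableD.
  + exact: RintegrableI.
  + by apply: RintegrableZ; exact: RintegrableI.
  + exact: aA.
  + by apply: approximableZ => //; exact: RintegrableI.
- move=> F ndF HF.
  have mU : measurable (\bigcup_i F i : set B).
    by apply: bigcupT_measurable => i; exact: (HF i).1.
  split => //; apply: approximable_close; first exact: RintegrableI.
  move=> e e0.
  have mF i : measurable (F i `&` cube r).
    by apply: borel_measurable_lebesgue; apply: (measurableI (F i : set B)) => //; exact: (HF i).1.
  have mUr : measurable (\bigcup_i (F i `&` cube r)) by exact: bigcupT_measurable.
  have ndFr : nondecreasing_seq (fun i => F i `&` cube r).
    by move=> i k ik; apply/subsetPset; apply: setSI; exact/subsetPset/ndF.
  have lim := @nondecreasing_cvg_mu _ _ _ mu _ mF mUr ndFr.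
  have Uoo : (mu (\bigcup_i (F i `&` cube r)) < +oo)%E.
    by apply: (lebesgue_subcube (r := r) mUr) => x [i _ []].
  have Ufin : mu (\bigcup_i (F i `&` cube r)) \is a fin_num by rewrite ge0_fin_numE.
  have [J HJ] : exists J, (mu (\bigcup_i (F i `&` cube r)) - mu (F J `&` cube r) <= e%:E)%E.
    have lim2 : (fun j => mu (\bigcup_i (F i `&` cube r)) - mu (F j `&` cube r))%E @ \oo --> 0%E.
      rewrite -(subee Ufin); apply: cvgeB => //; last exact: cvg_cst.
      by rewrite fin_num_adde_defr.
    by have [J HJ] := cvge0_le lim2 e0; exists J; exact: HJ.
  exists (\1_(F J `&` cube r)).
    by split; [apply: RintegrableI; exact: (HF J).1|exact: (HF J).2].
  have FJ : F J `&` cube r `<=` \bigcup_i (F i `&` cube r) by move=> x Fx; exists J.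
  rewrite setI_bigcupl -indicB// L1norm_indic; last exact: measurableD.
  by rewrite measureD// setIidr.
Qed.

(** The pi-lambda theorem, the boxes being a pi-system that generates the Borel sets.
Intersecting with a cube keeps all measures finite. *)
Lemma approximable_indic_borel (A : set T) r : 0 < r -> measurable (A : set B) ->
  approximable (\1_(A `&` cube r) : T -> R).
Proof.
move=> r0 mA.
pose G := [set A : set T | exists a b, A = box a b].
have GI : setI_closed G.
  by move=> _ _ [a [b ->]] [a' [b' ->]]; rewrite boxI; eexists; eexists; reflexivity.
have GH : G `<=` [set A : set T | measurable (A : set B) /\
    approximable (\1_(A `&` cube r) : T -> R)].
  move=> _ [a [b ->]]; split; first exact: box_borel.
  rewrite boxI; apply: (approximable_indic_box r0).
  by rewrite -boxI; exact: subIsetr.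
suff : <<s G >> A.
  by move/(lambda_system_subset GI (lambdaH r0) GH (fun _ _ _ _ => I)) => -[].
(* The coordinates are measurable for the sigma-algebra generated by boxes, and they generate the Borel sets. *)
have sub : @measurable _ B `<=` <<s G >>.
  apply: smallest_sub; first exact: smallest_sigma_algebra.
  rewrite -bigcup_seq => C [i _ [D mD <-]]; rewrite setTI.
  pose coord := (fun x : T => x ord0 i) : g_sigma_algebraType G -> R.
  have mc : measurable_fun setT coord.
    apply: (measurability _ (RGenOInfty.measurableE R)).
    move=> _ [_ [t ->] <-]; rewrite setTI; apply: sub_sigma_algebra.
    exists (fun k => if k == i then t%:E else -oo%E), (fun=> +oo%E).
    apply/seteqP; split=> x /=; rewrite in_itv /= andbT.
      by move=> tx k; rewrite ltry andbT; case: ifP => [/eqP ->|_]; rewrite ?lte_fin ?ltNyr.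
    by move=> /(_ i); rewrite eqxx lte_fin => /andP[].
  by have := mc measurableT D mD; rewrite setTI.
exact: sub.
Qed.

(** Lebesgue measure is the outer measure of the Borel measure. *)
Lemma lebesgue_borel_cover (A : set T) (e : R) : 0 < e -> (mu A < +oo)%E ->
  exists C : set T, [/\ measurable (C : set B), A `<=` C & (mu C <= mu A + e%:E)%E].
Proof.
move=> e0 Aoo.
have Afin : mu A \is a fin_num by rewrite ge0_fin_numE// outer_measure_ge0.
have [_ [F [mF AF] <-] Fe] := lb_ereal_inf_adherent e0 Afin.
exists (\bigcup_k F k); split => //.
  by apply: bigcupT_measurable => k; exact: mF.
rewrite lebesgue_borel; last by apply: bigcupT_measurable => k; exact: mF.
apply: le_trans (ltW Fe).
by apply: measure_sigma_subadditive => //; apply: bigcupT_measurable => k; exact: mF.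
Qed.

Lemma approximable_indic (A : set T) r : 0 < r -> measurable A -> A `<=` cube r ->
  approximable (\1_A : T -> R).
Proof.
move=> r0 mA Ar; have Aoo := lebesgue_subcube mA Ar.
apply: approximable_close; first exact: Rintegrable_indic.
move=> e e0; have [C [mC AC Ce]] := lebesgue_borel_cover e0 Aoo.
have mCr : measurable (C `&` cube r).
  by apply: borel_measurable_lebesgue; exact: (measurableI (C : set B) _ mC (box_borel _ _)).
have ACr : A `<=` C `&` cube r by move=> x Ax; split; [exact: AC|exact: Ar].
exists (\1_(C `&` cube r)).
  split; last exact: approximable_indic_borel.
  by apply: Rintegrable_indic => //; apply: (lebesgue_subcube (r := r) mCr) => x [].
rewrite L1norm_distC -indicB// L1norm_indic; last exact: measurableD.
rewrite measureD//; last by apply: (lebesgue_subcube (r := r) mCr) => x [].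
rewrite (setIidr ACr) leeBlDr; last by rewrite ge0_fin_numE.
rewrite addeC; apply: le_trans Ce; apply: le_measure; rewrite ?inE//.
exact: borel_measurable_lebesgue.
Qed.

Lemma approximable_step (m : nat) (c : 'I_m -> R) (A : 'I_m -> set T) r : 0 < r ->
  (forall i, measurable (A i)) -> (forall i, A i `<=` cube r) ->
  let s : T -> R := fun x => \sum_(i < m) c i * \1_(A i) x in
  Rintegrable mu s /\ approximable s.
Proof.
move=> r0; elim: m c A => [|m IH] c A mA Ar /=.
  have -> : (fun x : T => \sum_(i < 0) c i * \1_(A i) x) = \1_set0.
    by apply/funext => x; rewrite big_ord0 indicE in_set0.
  split; last exact: (approximable_indic r0).
  by apply: Rintegrable_indic => //; rewrite measure0.
have [si sa] := IH (c \o widen_ord (leqnSn m)) (A \o widen_ord (leqnSn m))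
  (fun=> mA _) (fun=> @Ar _).
have Ai : Rintegrable mu (\1_(A ord_max) : T -> R).
  by apply: Rintegrable_indic => //; exact: lebesgue_subcube (mA _) (@Ar _).
have -> : (fun x : T => \sum_(i < m.+1) c i * \1_(A i) x) =
    (fun x => \sum_(i < m) (c \o widen_ord (leqnSn m)) i *
      \1_((A \o widen_ord (leqnSn m)) i) x) \+ (cst (c ord_max) \* \1_(A ord_max)).
  by apply/funext => x; rewrite big_ord_recr.
split; first by apply: RintegrableD => //; exact: RintegrableZ.
apply: approximableD => //; first exact: RintegrableZ.
by apply: approximableZ => //; exact: approximable_indic (@Ar _).
Qed.

(** Simple functions are dense in L^1. *)
Lemma approximable_intg f r : 0 < r -> Rintegrable mu f -> (forall x, f x != 0 -> cube r x) ->
  approximable f.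
Proof.
move=> r0 fi fr; have mQ := @cube_measurable R n r.
apply: approximable_close => // e e0.
have fiQ : mu.-integrable (cube r) (EFin \o f) by apply: integrableS fi.
have [s [si _ lim]] := approximation_sfun_integrable mQ fiQ.
have [J /(_ J (leqnn J)) HJ] := cvge0_le lim e0.
exists (fun x => s J x * \1_(cube r) x); last first.
  apply: le_trans HJ; rewrite /L1norm [leRHS]integral_mkcond le_eqVlt; apply/orP; left.
  apply/eqP/eq_integral => x _; rewrite [RHS]patchE /= indicE.
  have [xQ|xQ] := boolP (x \in cube r); first by rewrite mulr1.
  rewrite mulr0 subr0.
  have [->|/fr] := eqVneq (f x) 0; first by rewrite normr0.
  by move: xQ => /negP; rewrite inE.
(* The finitely many values of the simple function. *)
pose v : seq R := finmap.enum_fset (fset_set (s J @` setT)).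
have -> : (fun x => s J x * \1_(cube r) x) = (fun x => \sum_(i < size v)
    v`_i * \1_(s J @^-1` [set v`_i] `&` cube r) x).
  apply/funext => x; rewrite {1}fimfunEord mulr_suml; apply: eq_bigr => i _.
  by rewrite -mulrA indicI.
apply: (approximable_step (fun i => v`_i) r0) => i; last exact: subIsetr.
by apply: measurableI => //; rewrite -[X in measurable X]setTI; exact: measurable_funP.
Qed.

End mollification_L1.

(** * Test functions and cutoffs *)

Section test_functions.
Variables (R : realType) (n : nat).
Local Notation mu := (@lebesgue R n).
Local Notation T := 'rV[R]_n.
Implicit Types (U K S : set T) (f g psi : T -> R).

(** Compactness in its covering form: each point of K has a neighbourhood with a uniform
margin inside U. *)
Lemma compact_margin K U : compact K -> open U -> K `<=` U ->
  exists2 d : R, 0 < d & forall x y, K x -> `|x - y| < d -> U y.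
Proof.
move=> cK oU KU.
have H : \forall d \near (0 : R)^'+, K `<=` (fun x => forall y, `|x - y| < d -> U y).
  move/compact_near_coveringP : cK; apply => x Kx.
  have /nbhs_ballP[e /= e0 He] : nbhs x U by apply: open_nbhs_nbhs; split => //; exact: KU.
  have e2 : 0 < e / 2 by rewrite divr_gt0.
  exists (ball x (e / 2), [set d | d < e / 2]).
    by split; [exact: nbhsx_ballx|exact: nbhs_right_lt].
  move=> [x' d] /= [xx' de] y x'y; apply: He; apply/ball_rVP.
  apply: le_lt_trans (ler_distD x' x y) _; rewrite (splitr e); apply: ltrD.
    exact/ball_rVP.
  exact: lt_trans x'y de.
near (0 : R)^'+ => d; exists d; first by near: d; exact: nbhs_right_gt.
have := near H d; move=> Hd x y Kx xy.
by apply: (Hd _ x Kx).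
Unshelve. all: by end_near. Qed.

(** Neighbourhoods of a set are taken open and without distance functions. *)
Definition thicken S (d : R) : set T := [set x | exists2 y, S y & `|x - y| < d].

Lemma open_thicken S d : open (thicken S d).
Proof.
have -> : thicken S d = \bigcup_(y in S) ball y d.
  by apply/seteqP; split=> x [y Sy h]; exists y => //; apply/ball_rVP; move: h; rewrite ?ball_rVP distrC.
by apply: bigcup_open => y _; exact: ball_open.
Qed.

Lemma sub_thicken S d : 0 < d -> S `<=` thicken S d.
Proof. by move=> d0 x Sx; exists x => //; rewrite subrr normr0. Qed.

Lemma compact_cube K : compact K -> exists2 r : R, 0 < r & K `<=` cube r.
Proof.
move=> /compact_bounded[M [_ HM]]; exists (`|M| + 2); first by rewrite ltr_wpDl.
move=> x Kx; apply/cubeP; first by rewrite ltr_wpDl.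
apply: (@le_lt_trans _ _ (`|M| + 1)); last by rewrite ltrD2l ltr1n.
by apply: HM => //; apply: le_lt_trans (ler_norm M) _; rewrite ltrDl.
Qed.

(** The closure of a d-neighbourhood lies in every larger neighbourhood. *)
Lemma thicken_support S U f (r d : R) : 0 < r -> 0 < d -> S `<=` cube r ->
  thicken S (d + d) `<=` U -> (forall x, f x != 0 -> thicken S d x) ->
  compact (Defs.support f) /\ Defs.support f `<=` U.
Proof.
move=> r0 d0 Sr SU fS; split; last first.
  move=> x fx; apply: SU.
  have [w [/fS[y Sy wy] /ball_rVP xw]] := fx _ (nbhsx_ballx x d d0).
  by exists y => //; apply: le_lt_trans (ler_distD w x y) _; exact: ltrD.
apply: bounded_closed_compact; last exact: closed_closure.
exists (r + d + d); split; first exact: num_real.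
move=> M HM x fx; apply: le_trans (ltW HM).
have [w [/fS[y Sy wy] /ball_rVP xw]] := fx _ (nbhsx_ballx x d d0).
have yr : `|y| < r by apply/(cubeP _ r0); exact: Sr.
have -> : x = (x - w) + (w - y) + y by rewrite subrKA subrK.
have -> : r + d + d = d + d + r by ring.
apply: le_trans (ler_normD _ _) _; apply: lerD; last exact: ltW.
by apply: le_trans (ler_normD _ _) _; apply: lerD; exact: ltW.
Qed.

Lemma support0 f x : ~ Defs.support f x -> f x = 0.
Proof. by move=> h; apply/eqP; apply: contra_notT h => h; exact: subset_closure. Qed.

Lemma test_fun_partials U s psi : test_fun U psi -> test_fun U (partials s psi).
Proof.
move=> [sp cp pU]; split; first exact: smooth_partials.
  exact: subclosed_compact (@closed_closure _ _) cp (@support_partials _ _ s psi).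
by apply: subset_trans pU; exact: support_partials.
Qed.

Lemma test_fun_partial U i psi : test_fun U psi -> test_fun U (partial i psi).
Proof. exact: (@test_fun_partials U [:: i] psi). Qed.

Lemma test_funM U zeta psi : smooth zeta -> test_fun U psi ->
  test_fun U (zeta \* psi).
Proof.
move=> sz [sp cp pU].
have sub : Defs.support (zeta \* psi) `<=` Defs.support psi.
  apply: closure_subset => x /=; apply: contra_neq => ->; exact: mulr0.
split; first exact: smoothM.
  exact: subclosed_compact (@closed_closure _ _) cp sub.
exact: subset_trans pU.
Qed.

Lemma moll_test U j (x : T) : (forall y, `|x - y| <= j.+1%:R^-1 -> U y) ->
  test_fun U (fun y => @moll R n j.+1%:R (x - y)).
Proof.
move=> xU; have j0 : 0 < j.+1%:R :> R by rewrite ltr0n.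
have d0 : 0 < j.+1%:R^-1 :> R by rewrite invr_gt0.
have sub : Defs.support (fun y => @moll R n j.+1%:R (x - y)) `<=`
    [set y | `|x - y| <= j.+1%:R^-1].
  move=> y; rewrite /Defs.support closureE; apply; split.
    have -> : [set y | `|x - y| <= j.+1%:R^-1] = closed_ball x (j.+1%:R^-1 : R).
      by rewrite closed_ballE.
    exact: closed_ball_closed.
  by move=> z /= /(moll_supp j0) /ltW.
split; first by apply: smooth_reflect; exact: smooth_moll.
  apply: (subclosed_compact _ _ sub); first exact: closed_closure.
  apply: bounded_closed_compact; last first.
    have -> : [set y | `|x - y| <= j.+1%:R^-1] = closed_ball x (j.+1%:R^-1 : R).
      by rewrite closed_ballE.
    exact: closed_ball_closed.
  exists (`|x| + j.+1%:R^-1); split; first exact: num_real.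
  move=> M HM y /= xy; apply: le_trans (ltW HM).
  rewrite -[y](subKr x); apply: le_trans (ler_normB _ _) _.
  by rewrite lerD2l.
by move=> y /sub; exact: xU.
Qed.

Lemma moll_partials_supp j s (z : T) : j.+1%:R^-1 < `|z| ->
  partials s (@moll R n j.+1%:R) z = 0.
Proof.
move=> jz; have j0 : 0 < j.+1%:R :> R by rewrite ltr0n.
apply: partials_support => /(_ _ (nbhsx_ballx z (`|z| - j.+1%:R^-1) _)).
rewrite subr_gt0 => /(_ jz)[w [/= /(moll_supp j0) wj /ball_rVP zw]].
have : `|z| < `|z|.
  rewrite -{1}[z](subrK w); apply: le_lt_trans (ler_normD _ _) _.
  by rewrite -[ltRHS](subrK j.+1%:R^-1); exact: ltrD.
by rewrite ltxx.
Qed.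

(** Mollify the indicator of a neighbourhood of K.  With a margin d, the indicator lives
within d/4 of K and the kernel has radius less than d/4. *)
Lemma cutoff K U : compact K -> open U -> K `<=` U ->
  exists zeta A, [/\ test_fun U zeta, open A, K `<=` A,
    forall x, A x -> zeta x = 1 & forall x, 0 <= zeta x <= 1].
Proof.
move=> cK oU KU; have [d d0 Hd] := compact_margin cK oU KU.
have [r r0 Kr] := compact_cube cK.
have d4 : 0 < d / 4 by rewrite divr_gt0.
pose K' := thicken K (d / 4).
have mK' : measurable K' by apply: open_lebesgue; exact: open_thicken.
have K'r : K' `<=` cube (r + d / 4).
  move=> x [y /Kr /(cubeP _ r0) yr xy]; apply/cubeP; first by rewrite addr_gt0.
  by rewrite -[x](subrK y) addrC; apply: le_lt_trans (ler_normD _ _) _; exact: ltrD.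
have K'i : Rintegrable mu (\1_K' : T -> R).
  by apply: Rintegrable_indic => //; exact: lebesgue_subcube K'r.
have [j Hj] : exists j : nat, j.+1%:R^-1 < d / 4.
  have [j _ Hj] := near_infty_natSinv_lt (PosNum d4).
  by exists j; apply: Hj => /=.
have j0 : 0 < j.+1%:R :> R by rewrite ltr0n.
exists (mollify j \1_K'), (thicken K (d / 4 - j.+1%:R^-1)).
have sm : forall x, mollify j (\1_K' : T -> R) x != 0 -> thicken K (d / 4 + d / 4) x.
  move=> x hx; apply: contrapT => xK; move: hx; rewrite (@mollify_const _ _ _ _ _ 0) ?eqxx//.
  move=> y xy; rewrite indicE memNset// => -[z Kz yz]; apply: xK; exists z => //.
  by apply: le_lt_trans (ler_distD y x z) _; apply: ltrD => //; exact: lt_trans xy Hj.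
have dd : 0 < d / 4 + d / 4 by rewrite addr_gt0.
have [] := @thicken_support K U _ r (d / 4 + d / 4) r0 dd Kr _ sm.
  move=> x [y Ky xy]; apply: (Hd y) => //; rewrite distrC; apply: lt_le_trans xy _.
  by rewrite le_eqVlt; apply/orP; left; apply/eqP; field.
move=> cs sU; split.
- by split=> //; apply: smooth_conv K'i; exact: moll_bounded_smooth.
- exact: open_thicken.
- by apply: sub_thicken; rewrite subr_gt0.
- move=> x [y Ky xy]; apply: mollify_const => z xz; rewrite indicE mem_set//.
  exists y => //; rewrite distrC; apply: le_lt_trans (ler_distD x y z) _.
  by rewrite -[ltRHS](subrK j.+1%:R^-1) distrC; exact: ltrD.
- move=> x; apply/andP; split; first by apply: mollify_ge0 => y; rewrite indicE.
  by apply: mollify_le => // y; rewrite indicE; case: (y \in K').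
Qed.

End test_functions.

(** * The fundamental lemma of the calculus of variations *)

Section locally_integrable.
Variables (R : realType) (n : nat).
Local Notation mu := (@lebesgue R n).
Local Notation T := 'rV[R]_n.
Implicit Types (U K S : set T) (f g psi : T -> R).

Lemma ae_forall_countable (I : countType) (P : I -> T -> Prop) :
  (forall i, {ae mu, forall x, P i x}) -> {ae mu, forall x, forall i, P i x}.
Proof.
move=> HP.
(* Countable types are enumerated by their pickling, so that countable intersections apply. *)
pose Q (k : nat) (x : T) := if unpickle k is Some i then P i x else True.
have HQ : {ae mu, forall x, forall k, Q k x}.
  by apply: ae_foralln => k; rewrite /Q; case: unpickle => [i|]; [exact: HP|exact: aeW].
by apply: filterS HQ => x Hx i; have := Hx (pickle i); rewrite /Q pickleK.
Qed.

(** Lindelof: countably many rational balls suffice to cover U.  A property that holds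
almost everywhere near each point of U holds almost everywhere on U. *)
Lemma ae_local U (P : T -> Prop) :
  (forall x, U x -> exists2 e : R, 0 < e & {ae mu, forall y, `|x - y| < e -> P y}) ->
  {ae mu, forall y, U y -> P y}.
Proof.
move=> HU.
pose ctr (qm : 'rV[rat]_n * nat) : T := map_mx ratr qm.1.
pose good qm := {ae mu, forall y, `|ctr qm - y| < qm.2.+1%:R^-1 -> P y}.
have H : {ae mu, forall y, forall qm, good qm -> `|ctr qm - y| < qm.2.+1%:R^-1 -> P y}.
  apply: ae_forall_countable => qm.
  have [g|ng] := pselect (good qm); last by apply: aeW => y /ng.
  by apply: filterS g => y h _.
apply: filterS H => y Hy Uy; have [e e0 He] := HU y Uy.
have [m Hm] : exists m : nat, m.+1%:R^-1 < e / 2.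
  have [m _ Hm] := near_infty_natSinv_lt (PosNum (divr_gt0 e0 (@ltr0Sn R 1))).
  by exists m; apply: Hm => /=.
have m0 : 0 < m.+1%:R^-1 :> R by rewrite invr_gt0.
have [q qy] := dense_rat_rV y m0.
apply: (Hy (q, m)) => //; apply: filterS He => z Hz qz; apply: Hz.
apply: le_lt_trans (ler_distD (ctr (q, m)) y z) _; rewrite (splitr e) distrC.
by apply: ltrD; [exact: lt_trans qy Hm|exact: lt_trans qz Hm].
Qed.

(** The distributional pairing.  Since psi is supported in U, the integral may be taken
over the whole space, which removes U from most computations. *)
Definition pairing f psi : R := (\int[mu]_x (f x * psi x))%R.

Lemma test_fun_out U psi x : test_fun U psi -> ~ U x -> psi x = 0.
Proof. by move=> [_ _ pU] Ux; apply: support0 => /pU. Qed.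

Lemma pairingE U f psi : test_fun U psi ->
  (\int[mu]_(x in U) (f x * psi x))%R = pairing f psi.
Proof.
move=> tp; rewrite Rintegral_mkcond; apply: eq_Rintegral => x _.
rewrite patchE; case: ifPn => // /negP; rewrite inE => Ux.
by rewrite (test_fun_out tp Ux) mulr0.
Qed.

Lemma loc_integrableP U f : open U -> loc_integrable U f <->
  measurable_fun U f /\
  forall K, compact K -> K `<=` U -> mu.-integrable K (EFin \o f).
Proof.
move=> oU; have mU := open_lebesgue oU; split=> -[mf HK]; split=> // K cK KU.
  apply/integrableP; split; last by have := HK K cK KU; under eq_integral do rewrite -abse_EFin.
  by apply/measurable_EFinP; exact: measurable_funS mf.
by have /integrableP[_ h] := HK K cK KU; exact: h.
Qed.

Lemma test_fun_continuous U psi : test_fun U psi -> continuous psi.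
Proof. by move=> [/smooth_cont_diff[]]. Qed.

Lemma test_fun_bounded U psi : test_fun U psi -> exists C : R, forall x, `|psi x| <= C.
Proof.
by move=> tp; have [_ cp _] := tp; apply: compact_support_bounded => //;
  exact: test_fun_continuous tp.
Qed.

(** A function that vanishes off K is its own extension by zero. *)
Lemma Rintegrable_extend K f : measurable K -> mu.-integrable K (EFin \o f) ->
  (forall x, ~ K x -> f x = 0) -> Rintegrable mu f.
Proof.
move=> mK /(integrable_mkcond _ mK) h f0; rewrite /Rintegrable.
rewrite (_ : EFin \o f = (EFin \o f) \_ K)//.
apply/funext => x; rewrite patchE; case: ifPn => // /negP; rewrite inE => Kx.
by rewrite /= f0.
Qed.

Lemma Rintegrable_test U f psi : open U -> loc_integrable U f -> test_fun U psi ->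
  Rintegrable mu (f \* psi).
Proof.
move=> oU /(loc_integrableP _ oU)[mf lf] tp; have [_ cp pU] := tp.
have mK := compact_lebesgue cp; have [C HC] := test_fun_bounded tp.
apply: (Rintegrable_extend mK) => [|x /support0 /= ->]; last by rewrite mulr0.
have fK := lf _ cp pU.
rewrite (_ : EFin \o _ = (EFin \o f) \* (EFin \o psi))%E; last exact/funext.
apply: integrableMl => //.
  by apply: measurable_funTS; apply: continuous_lmeasurable; exact: test_fun_continuous tp.
exists C; split; first exact: num_real.
by move=> M CM x _; apply: le_trans (HC x) (ltW CM).
Qed.

Lemma loc_integrableD U f g : open U -> loc_integrable U f -> loc_integrable U g ->
  loc_integrable U (f \+ g).
Proof.
move=> oU /(loc_integrableP _ oU)[mf lf] /(loc_integrableP _ oU)[mg lg].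
apply/(loc_integrableP _ oU); split; first exact: measurable_funD.
move=> K cK KU; have mK := compact_lebesgue cK.
rewrite (_ : EFin \o _ = (EFin \o f) \+ (EFin \o g))%E; last exact/funext.
by apply: integrableD => //; [exact: lf|exact: lg].
Qed.

Lemma loc_integrableM U (zeta : T -> R) f : open U -> continuous zeta ->
  loc_integrable U f -> loc_integrable U (zeta \* f).
Proof.
move=> oU cz /(loc_integrableP _ oU)[mf lf].
have mz : measurable_fun U zeta.
  by apply: measurable_funTS; exact: continuous_lmeasurable.
apply/(loc_integrableP _ oU); split; first exact: measurable_funM.
move=> K cK KU; have mK := compact_lebesgue cK.
rewrite (_ : EFin \o _ = (EFin \o zeta) \* (EFin \o f))%E; last exact/funext.
apply: integrableMr => //; last exact: lf.
  by apply: measurable_funTS; exact: continuous_lmeasurable.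
have : compact (zeta @` K).
  by apply: continuous_compact => //; exact: continuous_subspaceT.
move=> /compact_bounded [M [Mr HM]]; exists M; split=> // M' MM' x Kx.
by apply: HM => //; exists x.
Qed.

Lemma loc_integrableZ U (c : R) f : open U -> loc_integrable U f ->
  loc_integrable U (cst c \* f).
Proof. by move=> oU; apply: loc_integrableM => //; exact: cst_continuous. Qed.

Lemma compact_closed_ball (x : T) (e : R) : compact [set y : T | `|x - y| <= e].
Proof.
apply: bounded_closed_compact.
  exists (`|x| + e); split; first exact: num_real.
  move=> M HM y /= xy; apply: le_trans (ltW HM).
  by rewrite -[y](subKr x); apply: le_trans (ler_normB _ _) _; rewrite lerD2l.
have cf : continuous (fun y : T => `|x - y|).
  move=> y; apply: (@continuous_comp T T R (fun y => x - y) (@normr R T)).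
    by apply: (@continuousB R T); [exact: cst_continuous|exact: cvg_id].
  exact: norm_continuous.
rewrite (_ : [set y | _] = (fun y : T => `|x - y|) @^-1` [set t | t <= e])//.
by apply: closed_comp => [y _|]; [exact: cf|exact: closed_le].
Qed.

(** Near x in U let g be f restricted to a compact ball.  Mollifying g at a point y close to x
is pairing f with the test function z |-> moll (y - z), hence gives 0, while
the mollifications converge to g in L^1. *)
Lemma pairing_eq0_ae U f : open U -> loc_integrable U f ->
  (forall psi, test_fun U psi -> pairing f psi = 0) ->
  {ae mu, forall x, U x -> f x = 0}.
Proof.
move=> oU lf Hf; apply: ae_local => x Ux.
have /nbhs_ballP[d /= d0 Hd] : nbhs x U by apply: open_nbhs_nbhs.
(* The kernel at a point within e of x only sees points within 2 e, which is less than d. *)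
pose e := d / 4; have e0 : 0 < e by rewrite divr_gt0.
have ed : 3 * e < d by rewrite /e; lra.
exists e => //.
pose K := [set y : T | `|x - y| <= 2 * e].
have cK : compact K by exact: compact_closed_ball.
have mK := compact_lebesgue cK.
have KU : K `<=` U.
  by move=> y Ky; apply: Hd; apply/ball_rVP; apply: le_lt_trans Ky _; lra.
pose g := f \_ K.
have gi : Rintegrable mu g.
  apply: (Rintegrable_extend mK); last first.
    by move=> y Ky; rewrite /g patchE ifF//; apply/negP; rewrite inE.
  have [_ /(_ K cK KU) fi] := (loc_integrableP f oU).1 lf.
  by apply: eq_integrable fi => // y yK; rewrite /= /g patchE yK.
have [r r0 Kr] := compact_cube cK.
have ag : approximable g.
  apply: (approximable_intg r0 gi) => y; rewrite /g patchE.
  by case: ifPn => [|_ /eqP//]; rewrite inE => Ky _; exact: Kr.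
pose A := ball x e.
have mA : measurable A by apply: open_lebesgue; exact: ball_open.
have AK : A `<=` K by move=> y /ball_rVP xy; rewrite /K /=; lra.
have small (t : R) : 0 < t -> (\int[mu]_(y in A) `|(g y)%:E| <= t%:E)%E.
  move=> t0; have [J HJ] := ag _ t0.
  have [J' Hj] : exists j : nat, forall k, (j <= k)%N -> k.+1%:R^-1 < e.
    have [j _ Hj] := near_infty_natSinv_lt (PosNum e0).
    by exists j => k jk; apply: Hj.
  pose j := maxn J J'; have je : j.+1%:R^-1 < e by apply: Hj; exact: leq_maxr.
  apply: le_trans (HJ j (leq_maxl _ _)).
  have m0 y : A y -> mollify j g y = 0.
    move=> /ball_rVP xy.
    have sub z : `|y - z| <= j.+1%:R^-1 -> K z.
      move=> yz; rewrite /K /= mulr_natl mulr2n.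
      apply: le_trans (ler_distD y x z) _.
      by apply: lerD; [exact: ltW xy|exact: le_trans yz (ltW je)].
    have tp : test_fun U (fun z => @moll R n j.+1%:R (y - z)).
      by apply: moll_test => z /sub; exact: KU.
    rewrite -[RHS](Hf _ tp); apply: eq_Rintegral => z _.
    have [->|h] := eqVneq (@moll R n j.+1%:R (y - z)) 0; first by rewrite !mulr0.
    rewrite /g patchE ifT// inE; apply: sub; apply: ltW.
    by apply: moll_supp h; rewrite ltr0n.
  rewrite /L1norm.
  have mmg : measurable_fun [set: T] (mollify j g \- g).
    apply: measurable_funB; last exact: Rintegrable_measurable gi.
    by apply: conv_measurable gi; apply: moll_bounded_smooth; rewrite ltr0n.
  apply: (@le_trans _ _ (\int[mu]_(y in A) `|(mollify j g \- g)%R y|%:E)%E).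
    rewrite le_eqVlt; apply/orP; left; apply/eqP/eq_integral => y.
    by rewrite inE => Ay; rewrite /= m0// sub0r normrN.
  apply: ge0_subset_integral => //; first by apply/measurable_EFinP; apply: measurableT_comp.
have : (\int[mu]_(y in A) `|(g y)%:E|)%E = 0%E.
  apply/eqP; rewrite eq_le integral_ge0// andbT.
  by apply/lee_addgt0Pr => t t0; rewrite add0e; exact: small.
have mg : measurable_fun A (EFin \o g).
  by apply/measurable_EFinP; apply: measurable_funTS; exact: Rintegrable_measurable gi.
move/(ae_eq_integral_abs mu mA mg); apply: filterS => y H xy.
have Ay : A y by apply/ball_rVP.
have := H Ay; rewrite /= /g patchE ifT; last by rewrite inE; exact: AK.
by move=> [].
Qed.

End locally_integrable.

(** * Weak derivatives *)

Section open_positive.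
Variables (R : realType) (n : nat).
Local Notation T := 'rV[R]_n.

(** An open set contains a box with nonempty sides. *)
Lemma open_lebesgue_gt0 (A : set T) x : open A -> A x -> (0 < @lebesgue R n A)%E.
Proof.
move=> oA Ax; have /nbhs_ballP[e /= e0 He] : nbhs x A by apply: open_nbhs_nbhs.
pose I (i : 'I_n) : set R := `](x ord0 i - e), (x ord0 i + e)[%classic.
have mI i : measurable (I i) by exact: measurable_itv.
apply: (@lt_le_trans _ _ (@lebesgue R n [set y : T | forall i, I i (y ord0 i)])).
  rewrite lebesgue_box//; elim/big_ind: _ => // [a b a0 b0|i _]; first exact: mule_gt0.
  rewrite [ltRHS](lebesgue_measure_itv `](x ord0 i - e), (x ord0 i + e)[) /= lte_fin.
  have h : x ord0 i - e < x ord0 i + e by rewrite ltrBlDr -addrA ltrDl addr_gt0.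
  by rewrite h -EFinB lte_fin subr_gt0.
apply: le_measure; rewrite ?inE.
- by apply: borel_measurable_lebesgue; exact: borel_box.
- exact: open_lebesgue.
- move=> y Hy; apply: He; apply/ball_rVP; apply/(norm_ltP _ e0) => i; have := Hy i.
  by rewrite /I /= in_itv /= !mxE distrC ltr_distl.
Qed.

Lemma lebesgueT_gt0 : (0 < @lebesgue R n [set: T])%E.
Proof. exact: (@open_lebesgue_gt0 setT 0 openT I). Qed.

End open_positive.

Section weak_derivatives.
Variables (R : realType) (n : nat) (U : set 'rV[R]_n).
Hypothesis oU : open U.
Local Notation mu := (@lebesgue R n).
Local Notation T := 'rV[R]_n.
Local Notation ploc := (loc_integrable U).
Implicit Types (f g psi : T -> R) (s t : seq 'I_n).

Let mU : measurable U := open_lebesgue oU.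

Lemma pairingD f g psi : ploc f -> ploc g -> test_fun U psi ->
  pairing (f \+ g) psi = pairing f psi + pairing g psi.
Proof.
move=> lf lg tp; have fi := Rintegrable_test oU lf tp; have gi := Rintegrable_test oU lg tp.
rewrite /pairing -(RintegralD measurableT fi gi).
by apply: eq_Rintegral => x _; rewrite mulrDl.
Qed.

Lemma pairingDr f psi psi' : ploc f -> test_fun U psi -> test_fun U psi' ->
  pairing f (psi \+ psi') = pairing f psi + pairing f psi'.
Proof.
move=> lf tp tp'; have fi := Rintegrable_test oU lf tp; have gi := Rintegrable_test oU lf tp'.
rewrite /pairing -(RintegralD measurableT fi gi).
by apply: eq_Rintegral => x _; rewrite mulrDr.
Qed.

Lemma pairingZ c f psi : ploc f -> test_fun U psi ->
  pairing (cst c \* f) psi = c * pairing f psi.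
Proof.
move=> lf tp; have fi := Rintegrable_test oU lf tp.
rewrite /pairing -(RintegralZl c measurableT fi).
by apply: eq_Rintegral => x _; rewrite mulrA.
Qed.

Lemma pairing_mul (zeta : T -> R) f psi : pairing (zeta \* f) psi = pairing f (zeta \* psi).
Proof. by apply: eq_Rintegral => x _; rewrite /= mulrA [f x * _]mulrC. Qed.

Lemma is_weak_derivP s f g : is_weak_deriv U s f g <->
  [/\ ploc f, ploc g & forall psi, test_fun U psi ->
    pairing f (partials s psi) = (-1) ^+ size s * pairing g psi].
Proof.
by split=> -[lf lg H]; split=> // psi tp; have := H psi tp;
  rewrite (pairingE _ (test_fun_partials s tp)) (pairingE _ tp).
Qed.

Lemma is_weak_derivD s f f' g g' : is_weak_deriv U s f g -> is_weak_deriv U s f' g' ->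
  is_weak_deriv U s (f \+ f') (g \+ g').
Proof.
move=> /is_weak_derivP[lf lg H] /is_weak_derivP[lf' lg' H'].
apply/is_weak_derivP; split; [exact: loc_integrableD|exact: loc_integrableD|].
move=> psi tp; rewrite !pairingD//; last exact: test_fun_partials.
by rewrite H// H'// mulrDr.
Qed.

Lemma is_weak_derivZ s c f g : is_weak_deriv U s f g ->
  is_weak_deriv U s (cst c \* f) (cst c \* g).
Proof.
move=> /is_weak_derivP[lf lg H].
apply/is_weak_derivP; split; [exact: loc_integrableZ|exact: loc_integrableZ|].
move=> psi tp; rewrite !pairingZ//; last exact: test_fun_partials.
by rewrite H// mulrCA.
Qed.

(** Both derivatives have the same pairings, so [pairing_eq0_ae] applies to their
difference. *)
Lemma weak_deriv_unique s f g g' : is_weak_deriv U s f g -> is_weak_deriv U s f g' ->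
  {ae mu, forall x, U x -> g x = g' x}.
Proof.
move=> /is_weak_derivP[lf lg H] /is_weak_derivP[lf' lg' H'].
have lg'N := loc_integrableZ (-1) oU lg'.
have := @pairing_eq0_ae _ _ U (g \+ (cst (-1) \* g')) oU (loc_integrableD oU lg lg'N).
have h psi : test_fun U psi -> pairing (g \+ (cst (-1) \* g')) psi = 0.
  move=> tp; rewrite pairingD// pairingZ// mulN1r.
  apply/eqP; rewrite subr_eq0; apply/eqP.
  apply: (@mulrI _ ((-1) ^+ size s)); first by rewrite unitrX// unitrN1.
  by rewrite -H// -H'.
move=> /(_ h); apply: filterS => x h' Ux; have := h' Ux.
by rewrite /= mulN1r => /eqP; rewrite subr_eq0 => /eqP.
Qed.

Lemma weak_deriv_spec s f g : is_weak_deriv U s f g ->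
  is_weak_deriv U s f (weak_deriv U s f).
Proof. by move=> fg; apply: (@xgetPex _ (cst 0) [set g | is_weak_deriv U s f g]); exists g. Qed.

Lemma weak_deriv_ae s f g : is_weak_deriv U s f g ->
  {ae mu, forall x, U x -> weak_deriv U s f x = g x}.
Proof. by move=> fg; apply: weak_deriv_unique (weak_deriv_spec fg) fg. Qed.

Definition ae_bounded f : Prop := exists C : R, {ae mu, forall x, U x -> `|f x| <= C}.

Lemma in_Lp_bounded f : in_Lp +oo%E U f -> ae_bounded f.
Proof.
move=> [mf]; have T0 := lebesgueT_gt0 R n; rewrite /Lp_norm unlock /Lnorm T0 => fin.
set N := ess_sup _ _ in fin.
have N0 : {ae mu, forall x, (abse \o (EFin \o (f \_ U))) x <= N}%E by exact: ess_sup_ge.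
exists (fine (maxe N 0)); apply: filterS N0 => x + Ux.
rewrite /= patchE mem_set// => h.
rewrite -lee_fin; apply: le_trans h _.
case: N fin => [r| |] //= _.
  by rewrite -EFin_max /= lee_fin le_max lexx.
by rewrite leNye.
Qed.

Lemma bounded_in_Lp f : measurable_fun U f -> ae_bounded f ->
  in_Lp +oo%E U f.
Proof.
move=> mf [C HC]; have T0 := lebesgueT_gt0 R n; split=> //; rewrite /Lp_norm unlock /Lnorm T0.
apply: (@le_lt_trans _ _ (maxr C 0)%:E); last by rewrite ltry.
apply/ess_supP; apply: filterS HC => x HC; rewrite /= patchE.
case: ifPn => [|_]; last by rewrite /point /= normr0 lee_fin le_max lexx orbT.
by rewrite inE => /HC h; rewrite lee_fin le_max h.
Qed.

Section leibniz.
Variables (k : nat) (u : T -> R) (G : seq 'I_n -> T -> R).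
Hypothesis HG : forall s, (size s <= k)%N -> is_weak_deriv U s u (G s).

(** Appending a letter to the word puts the new derivative innermost on the test function,
where it can be moved without commuting partial derivatives. *)
Lemma weak_deriv_step s i psi : (size s < k)%N -> test_fun U psi ->
  pairing (G s) (partial i psi) = - pairing (G (rcons s i)) psi.
Proof.
move=> sk tp; have /is_weak_derivP[_ _ H] := HG (ltnW sk).
have sk' : (size (rcons s i) <= k)%N by rewrite size_rcons.
have /is_weak_derivP[_ _ H'] := HG sk'.
apply: (@mulrI _ ((-1) ^+ size s)); first by rewrite unitrX// unitrN1.
rewrite -H; last exact: test_fun_partial.
by rewrite -partials_rcons H'// size_rcons exprS mulN1r mulrN mulNr.
Qed.

(** The Leibniz expansion of the derivative along s of zeta times the derivative of u
along t, unfolded one letter at a time. *)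
Fixpoint leibniz s (zeta : T -> R) t : T -> R :=
  if s is i :: s' then leibniz s' zeta (rcons t i) \+ leibniz s' (partial i zeta) t
  else zeta \* G t.

Lemma leibniz_loc s zeta t : smooth zeta -> (size s + size t <= k)%N ->
  ploc (leibniz s zeta t).
Proof.
elim: s zeta t => [|i s IH] zeta t sz st /=.
  apply: loc_integrableM => //; first by have [] := smooth_cont_diff sz.
  by have /is_weak_derivP[] := HG st.
apply: (loc_integrableD oU); apply: IH.
- exact: sz.
- by rewrite size_rcons addnS.
- exact: smooth_partial.
- exact: ltnW.
Qed.

(** One step moves a derivative off the test function chi: zeta d_i chi is
d_i (zeta chi) - (d_i zeta) chi, and zeta chi is again a test function. *)
Lemma leibnizP s zeta t psi : smooth zeta -> (size s + size t <= k)%N ->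
  test_fun U psi ->
  pairing (zeta \* G t) (partials s psi) = (-1) ^+ size s * pairing (leibniz s zeta t) psi.
Proof.
elim: s zeta t => [|i s IH] zeta t sz st tp; first by rewrite mul1r.
have st1 : (size s + size (rcons t i) <= k)%N by rewrite size_rcons addnS.
have st2 : (size s + size t <= k)%N by exact: ltnW.
have tk : (size t < k)%N by apply: leq_ltn_trans st; exact: leq_addl.
have sz' := smooth_partial i sz.
have lt : ploc (G t) by have /is_weak_derivP[] := HG (ltnW tk).
pose chi := partials s psi.
have tchi : test_fun U chi by exact: test_fun_partials.
have cz := smooth_cont_diff sz; have cchi : cont_diff chi by have [/smooth_cont_diff] := tchi.
rewrite -[partials _ psi]/(partial i chi) [leibniz _ _ _]/=.
rewrite pairingD//; [|exact: leibniz_loc..].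
rewrite exprS -mulrA mulrDr -IH// -IH// -/chi !pairing_mul.
have E : pairing (G t) (partial i (zeta \* chi)) =
    pairing (G t) (partial i zeta \* chi) + pairing (G t) (zeta \* partial i chi).
  rewrite (partialM i cz cchi).
  exact: (pairingDr lt (test_funM sz' tchi) (test_funM sz (test_fun_partial i tchi))).
have := weak_deriv_step i tk (test_funM sz tchi); rewrite E.
by rewrite mulN1r opprD => <-; rewrite addrC addKr.
Qed.

Lemma leibniz_weak_deriv s zeta : smooth zeta -> (size s <= k)%N ->
  is_weak_deriv U s (zeta \* G [::]) (leibniz s zeta [::]).
Proof.
move=> sz sk; apply/is_weak_derivP; split.
- exact: (@leibniz_loc [::] zeta [::]).
- by apply: leibniz_loc => //; rewrite addn0.
- by move=> psi tp; apply: leibnizP => //; rewrite addn0.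
Qed.

Lemma leibniz_bounded s zeta t : bounded_smooth zeta -> (size s + size t <= k)%N ->
  (forall s, (size s <= k)%N -> ae_bounded (G s)) ->
  ae_bounded (leibniz s zeta t).
Proof.
move=> + + bG; elim: s zeta t => [|i s IH] zeta t bz st /=.
  have [_ [C HC]] := bounded_smoothP bz; have [D HD] := bG t st.
  exists (C * D); apply: filterS HD => x HD Ux; rewrite normrM.
  by apply: ler_pM => //; exact: HD.
have st1 : (size s + size (rcons t i) <= k)%N by rewrite size_rcons addnS.
have st2 : (size s + size t <= k)%N by exact: ltnW.
have [C HC] := IH zeta (rcons t i) bz st1.
have [D HD] := IH (partial i zeta) t (bounded_smooth_partial i bz) st2.
exists (C + D); apply: filterS2 HC HD => x HC HD Ux.
by apply: le_trans (ler_normD _ _) _; apply: lerD; [exact: HC|exact: HD].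
Qed.

Lemma partial_const (A : set T) i zeta c : open A -> (forall x, A x -> zeta x = c) ->
  forall x, A x -> partial i zeta x = 0.
Proof.
move=> oA zc x Ax; have := @partials_local _ _ [:: i] zeta (cst c) A oA zc x Ax.
by rewrite /= partial_cst.
Qed.

(** Where zeta is constant its derivatives vanish, and only the term with all
derivatives on u survives. *)
Lemma leibniz_const (A : set T) s zeta t c : open A -> (forall x, A x -> zeta x = c) ->
  forall x, A x -> leibniz s zeta t x = c * G (t ++ s) x.
Proof.
move=> oA; elim: s zeta t c => [|i s IH] zeta t c zc x Ax /=.
  by rewrite cats0 zc.
rewrite (IH _ _ _ zc _ Ax) (IH _ _ _ (partial_const i oA zc) _ Ax).
by rewrite mul0r addr0 cat_rcons.
Qed.

Lemma leibniz_support s zeta t x : ~ Defs.support zeta x -> leibniz s zeta t x = 0.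
Proof.
move=> zx; rewrite (@leibniz_const (~` Defs.support zeta) s zeta t 0)// ?mul0r//.
  by apply: closed_openC; exact: closed_closure.
by move=> y /support0.
Qed.

End leibniz.

(** Near S the derivatives of the kernel at x are, up to sign, derivatives of a test
function in U, and the weak derivative applies.  Far from S both sides vanish
because the kernel does not reach S. *)
Lemma partials_mollify (v w : T -> R) j s (S : set T) (d : R) :
  j.+1%:R^-1 < d -> thicken S (d + d) `<=` U ->
  Rintegrable mu v -> (forall x, ~ S x -> v x = 0) -> (forall x, ~ S x -> w x = 0) ->
  is_weak_deriv U s v (w) ->
  partials s (mollify j v) = mollify j (w).
Proof.
move=> jd SU vi vS wS /is_weak_derivP[_ _ H].
have j0 : 0 < j.+1%:R :> R by rewrite ltr0n.
have sm := @smooth_moll R n _ j0.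
rewrite /mollify partials_conv//; last exact: moll_bounded_smooth.
apply/funext => x.
have [[y Sy xy]|far] := pselect (thicken S d x).
  have tp : test_fun U (fun z => @moll R n j.+1%:R (x - z)).
    apply: moll_test => z xz; apply: SU; exists y => //.
    apply: le_lt_trans (ler_distD x z y) _; apply: ltrD => //.
    by rewrite distrC; exact: le_lt_trans xz jd.
  have := H _ tp; rewrite partials_reflect// /pairing => h.
  apply: (@mulrI _ ((-1) ^+ size s)); first by rewrite unitrX// unitrN1.
  rewrite -[RHS]h /conv.
  have br := moll_bounded_smooth n j0.
  have [cr [C HC]] : continuous (partials s (@moll R n j.+1%:R)) /\
      exists C : R, forall x, `|partials s (@moll R n j.+1%:R) x| <= C.
    by split; [have [] := smooth_cont_diff (smooth_partials s sm)|exact: br.2].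
  rewrite -(RintegralZl _ measurableT (Rintegrable_conv x cr HC vi)).
  by apply: eq_Rintegral => z _; rewrite mulrCA.
have out y : S y -> d <= `|x - y|.
  by move=> Sy; rewrite leNgt; apply/negP => xy; apply: far; exists y.
rewrite !conv_eq0// => y; have [Sy|nSy] := pselect (S y).
- have [->|h] := eqVneq (@moll R n j.+1%:R (x - y)) 0; first by rewrite mulr0.
  have := moll_supp j0 h; rewrite ltNge => /negP; case.
  by apply: le_trans (ltW jd) (out y Sy).
- by rewrite wS// mul0r.
- by rewrite moll_partials_supp ?mulr0//; exact: lt_le_trans jd (out y Sy).
- by rewrite vS// mul0r.
Qed.

End weak_derivatives.

(** * Maps of compact support have zero boundary values *)

Section sobolev_maps.
Variables (R : realType) (n N k : nat) (U : set 'rV[R]_n).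
Hypothesis oU : open U.
Local Notation mu := (@lebesgue R n).
Local Notation T := 'rV[R]_n.
Local Notation word i := (tval (tagged (i : jet_index n N k).2)).

Let mU : measurable U := open_lebesgue oU.

Lemma size_word (i : jet_index n N k) : (size (word i) <= k)%N.
Proof. by rewrite size_tuple -ltnS ltn_ord. Qed.

Lemma jetE (u : T -> 'rV[R]_N) x l :
  jet k U u x ord0 l = weak_deriv U (word (enum_val l)) (component u (enum_val l).1) x.
Proof. by rewrite mxE. Qed.

Lemma patch_measurable (f : T -> R) : measurable_fun U f -> measurable_fun [set: T] (f \_ U).
Proof. by move=> mf; apply/(measurable_restrictT _ mU). Qed.

Lemma Lp_norm1E (f : T -> R) : Lp_norm 1%E U f = (\int[mu]_x `|(f \_ U) x|%:E)%E.
Proof. by rewrite /Lp_norm Lnorm1. Qed.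

Lemma Lp_norm1_le (f g : T -> R) : measurable_fun U f -> measurable_fun [set: T] g ->
  {ae mu, forall x, U x -> f x = g x} -> (Lp_norm 1%E U f <= L1norm mu g)%E.
Proof.
move=> mf mg fg; rewrite Lp_norm1E; apply: ae_ge0_le_integral.
- exact: measurableT.
- by move=> x _; rewrite lee_fin.
- apply/measurable_EFinP; apply: measurableT_comp; first exact: normr_measurable.
  exact: patch_measurable.
- by move=> x _; rewrite lee_fin.
- by apply/measurable_EFinP; apply: measurableT_comp; first exact: normr_measurable.
apply: filterS fg => x fg _; rewrite lee_fin patchE; case: ifPn => [|_].
  by rewrite inE => /fg ->.
by rewrite /point /= normr0.
Qed.

(** Mollify each component.  By [partials_mollify] the jet of the mollified map is the
mollified jet, which converges in L^1, and finitely many entries are handled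
at once. *)
Lemma sobolev0_infty_compact (S : set T) (phi : T -> 'rV[R]_N)
    (V : 'I_N -> seq 'I_n -> T -> R) :
  compact S -> S `<=` U ->
  (forall a s, (size s <= k)%N -> is_weak_deriv U s (component phi a) (V a s)) ->
  (forall a s, (size s <= k)%N -> ae_bounded U (V a s)) ->
  (forall a s x, ~ S x -> V a s x = 0) ->
  (forall a x, ~ S x -> component phi a x = 0) ->
  sobolev0_infty k U phi.
Proof.
move=> cS SU wV bV V0 phi0; have mS := compact_lebesgue cS.
have locV a s : (size s <= k)%N -> loc_integrable U (V a s).
  by move=> /(wV a)[].
have iV a s : (size s <= k)%N -> Rintegrable mu (V a s).
  move=> sk; apply: (Rintegrable_extend mS); last exact: V0.
  by have [_ H] := (loc_integrableP _ oU).1 (locV a s sk); exact: H.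
have iphi a : Rintegrable mu (component phi a).
  have [lp _ _] := wV a [::] isT.
  apply: (Rintegrable_extend mS); last exact: phi0.
  by have [_ H] := (loc_integrableP _ oU).1 lp; exact: H.
split; [|split].
- move=> i; exists (V i.1 (word i)); first exact: wV (size_word i).
  by apply: bounded_in_Lp; [exact: (locV _ _ (size_word i)).1|exact: bV (size_word i)].
- move=> i; exists (V i.1 (word i)); first exact: wV (size_word i).
  have ivi := iV i.1 (word i) (size_word i).
  split; first exact: (locV _ _ (size_word i)).1.
  apply: le_lt_trans (L1norm_fin ivi); apply: Lp_norm1_le.
  + exact: (locV _ _ (size_word i)).1.
  + exact: Rintegrable_measurable ivi.
  + by apply: aeW.
move=> e e0.
have [d d0 Hd] := compact_margin cS oU SU.
have [r r0 Sr] := compact_cube cS.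
pose d' := d / 2; have d'0 : 0 < d' by rewrite divr_gt0.
have SdU : thicken S (d' + d') `<=` U.
  by rewrite /d' -splitr => x [y Sy xy]; apply: (Hd y) => //; rewrite distrC.
(* The error is shared between the entries of the jet; the successor avoids a division by 0. *)
pose e' := e / (jet_dim n N k).+1%:R.
have e'0 : 0 < e' by rewrite divr_gt0.
have near_j : \forall j \near \oo, forall l : 'I_(jet_dim n N k),
    let i := enum_val l in
    (L1norm mu (mollify j (V i.1 (word i)) \- V i.1 (word i)) <= e'%:E)%E.
  apply: (@filter_forall nat 'I_(jet_dim n N k) (fun l j => let i := enum_val l in
    (L1norm mu (mollify j (V i.1 (word i)) \- V i.1 (word i)) <= e'%:E)%E) \oo _) => l.
  set i := enum_val l.
  have aV : approximable (V i.1 (word i)).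
    apply: (approximable_intg r0 (iV _ _ (size_word i))) => x Vx; apply: Sr.
    by apply: contrapT => /(V0 i.1 (word i)) /eqP; rewrite (negbTE Vx).
  by have [J HJ] := aV _ e'0; exists J => // j /HJ.
have [j [jd Hj]] : exists j : nat, j.+1%:R^-1 < d' /\ forall l : 'I_(jet_dim n N k),
    let i := enum_val l in
    (L1norm mu (mollify j (V i.1 (word i)) \- V i.1 (word i)) <= e'%:E)%E.
  near (\oo : set_system nat) => j; exists j; split; last by near: j.
  by near: j; exact: (near_infty_natSinv_lt (PosNum d'0)).
have j0 : 0 < j.+1%:R :> R by rewrite ltr0n.
have br := moll_bounded_smooth n j0.
pose psi (x : T) : 'rV[R]_N := \row_a mollify j (component phi a) x.
have psiE a : component psi a = mollify j (component phi a).
  by apply/funext => x; rewrite /component mxE.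
have spsi a : smooth (component psi a) by rewrite psiE; exact: smooth_conv.
exists psi => [a|].
  have sup x : component psi a x != 0 -> thicken S d' x.
    rewrite psiE => hx; apply: contrapT => far; move: hx; rewrite /mollify conv_eq0 ?eqxx// => y.
    have [Sy|/(phi0 a) ->] := pselect (S y); last by rewrite mul0r.
    have [->|h] := eqVneq (@moll R n j.+1%:R (x - y)) 0; first by rewrite mulr0.
    by case: far; exists y => //; exact: lt_trans (moll_supp j0 h) jd.
  have [cs sU] := thicken_support r0 d'0 Sr SdU sup.
  by split; [exact: spsi| |].
apply: (@le_lt_trans _ _ (\sum_(l < jet_dim n N k) e'%:E)%E); last first.
  rewrite sumEFin lte_fin.
  have -> : \sum_(l < jet_dim n N k) e' = e' * (jet_dim n N k)%:R.
    by rewrite sumr_const card_ord mulr_natr.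
  by rewrite /e' -mulrA gtr_pMr// mulrC ltr_pdivrMr// mul1r ltr_nat ltnSn.
apply: lee_sum => l _; set i := enum_val l.
have wd := weak_deriv_spec (wV i.1 _ (size_word i)).
have aed := weak_deriv_ae oU (wV i.1 _ (size_word i)).
have pm := partials_mollify jd SdU (iphi i.1) (phi0 i.1) (V0 i.1 (word i)) (wV i.1 _ (size_word i)).
have E : component (fun x => jet k U phi x - classical_jet k psi x)%R l =
    weak_deriv U (word i) (component phi i.1) \- partials (word i) (component psi i.1).
  by apply/funext => x; rewrite /component !mxE.
rewrite E psiE pm.
have mm := conv_measurable br (iV i.1 (word i) (size_word i)).
have mV := Rintegrable_measurable (iV i.1 (word i) (size_word i)).
apply: le_trans (Hj l); rewrite L1norm_distC; apply: Lp_norm1_le.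
- apply: measurable_funB; last exact: measurable_funTS mm.
  by have [_ []] := wd.
- exact: measurable_funB.
- by apply: filterS aed => x h Ux; rewrite /= h.
Unshelve. all: by end_near. Qed.

End sobolev_maps.

(** * The Euclidean norm *)

Section euclidean_norm.
Variables (R : realType) (m : nat).
Implicit Types (x y : 'rV[R]_m).

Lemma enorm_ge0 x : 0 <= enorm x.
Proof. exact: sqrtr_ge0. Qed.

Lemma enorm0 : enorm (0 : 'rV[R]_m) = 0.
Proof. by rewrite /enorm big1 ?sqrtr0// => i _; rewrite mxE expr0n. Qed.

Lemma enormZ (a : R) x : enorm (a *: x) = `|a| * enorm x.
Proof.
rewrite /enorm -sqrtr_sqr -sqrtrM ?sqr_ge0// mulr_sumr; congr Num.sqrt.
by apply: eq_bigr => i _; rewrite mxE exprMn.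
Qed.

Lemma coord_le_enorm x i : `|x ord0 i| <= enorm x.
Proof.
rewrite -sqrtr_sqr ler_wsqrtr// (bigD1 i)//= lerDl.
by apply: sumr_ge0 => j _; exact: sqr_ge0.
Qed.

Lemma enorm_eq0 x : enorm x = 0 -> x = 0.
Proof.
move=> x0; apply/rowP => i; rewrite mxE; apply/normr0_eq0/eqP.
by rewrite -normr_le0 normr_id -x0; exact: coord_le_enorm.
Qed.

(** By induction on the coordinates: the square of a sum of nonnegative numbers dominates
the sum of the squares. *)
Lemma enorm_le_sum x : enorm x <= \sum_i `|x ord0 i|.
Proof.
have s0 : 0 <= \sum_i `|x ord0 i| by exact: sumr_ge0.
rewrite /enorm -[leRHS]ger0_norm// -sqrtr_sqr ler_wsqrtr//.
elim: (index_enum _) => [|i s IH]; first by rewrite !big_nil expr0n.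
rewrite !big_cons sqrrD real_normK ?num_real// -addrA lerD2l.
by apply: le_trans IH _; rewrite lerDr mulrn_wge0// mulr_ge0// sumr_ge0.
Qed.

Lemma enorm_le x (C : R) : (forall i, `|x ord0 i| <= C) -> enorm x <= m%:R * C.
Proof.
move=> xC; apply: le_trans (enorm_le_sum x) _.
apply: le_trans (ler_sum _ (fun i _ => xC i)) _.
by rewrite sumr_const card_ord mulr_natl.
Qed.

Lemma enormN x : enorm (- x) = enorm x.
Proof. by rewrite -scaleN1r enormZ normrN1 mul1r. Qed.

Lemma continuous_enorm : continuous (@enorm R m).
Proof.
have cs : continuous (fun x : 'rV[R]_m => \sum_i x ord0 i ^+ 2).
  elim: (index_enum _) => [|i s IH].
    under eq_fun do rewrite big_nil; exact: cst_continuous.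
  under eq_fun do rewrite big_cons.
  move=> x; apply: (@continuousD R R 'rV[R]_m (fun x => x ord0 i ^+ 2)); last exact: IH.
  apply: (@continuous_comp 'rV[R]_m R R (fun x => x ord0 i) (fun t => t ^+ 2)).
    exact: continuous_coord.
  exact: exprn_continuous.
move=> x; apply: (@continuous_comp 'rV[R]_m R R _ Num.sqrt); first exact: cs.
exact: sqrt_continuous.
Qed.

Lemma open_eball x (e : R) : open (eball x e).
Proof.
rewrite (_ : eball x e = (fun y => enorm (y - x)) @^-1` [set t | t < e])//.
apply: open_comp => [y _|]; last exact: open_lt.
apply: (@continuous_comp 'rV[R]_m 'rV[R]_m R (fun y => y - x)); last exact: continuous_enorm.
by apply: (@continuousB R 'rV[R]_m); [exact: cvg_id|exact: cst_continuous].
Qed.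

Lemma eball_center x (e : R) : 0 < e -> eball x e x.
Proof. by move=> e0; rewrite /eball /= subrr enorm0. Qed.

End euclidean_norm.

(** * Essential suprema and the boundary *)

Section essential_supremum.
Variables (R : realType) (n : nat).
Local Notation mu := (@lebesgue R n).
Local Notation T := 'rV[R]_n.
Implicit Types (A B U : set T) (f : T -> R).

Lemma ess_sup_onP A f (y : \bar R) :
  (ess_sup_on A f <= y)%E <-> {ae mu, forall x, A x -> ((f x)%:E <= y)%E}.
Proof.
rewrite /ess_sup_on; split=> [/ess_supP|H]; last apply/ess_supP.
  by apply: filterS => x + Ax; rewrite /patch mem_set.
by apply: filterS H => x Hx; rewrite /patch; case: ifPn => [/set_mem/Hx//|_]; rewrite leNye.
Qed.

Lemma le_ess_sup_on A B f : A `<=` B -> (ess_sup_on A f <= ess_sup_on B f)%E.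
Proof.
move=> AB; apply/ess_sup_onP.
have /ess_sup_onP := lexx (ess_sup_on B f).
by apply: filterS => x H /AB.
Qed.

(** The essential supremum over a ball is monotone in the radius. *)
Lemma ess_limsupE U f (x : T) : ess_limsup U f x =
  ereal_inf [set ess_sup_on (eball x e `&` U) f | e in [set e | 0 < e]].
Proof.
rewrite /ess_limsup; apply/cvg_lim => //.
have h := @nondecreasing_at_right_cvge R
  (fun e => ess_sup_on (eball x e `&` U) f) 0 +oo%O isT.
have -> : [set e : R | 0 < e] = [set` `]0, +oo[].
  by apply/seteqP; split=> e /=; rewrite in_itv/= andbT.
apply: h => e e' _ _ ee'; apply: le_ess_sup_on; apply: setSI => y /= h.
exact: lt_le_trans h ee'.
Qed.

Lemma ess_limsup_le U f x : (ess_limsup U f x <= ess_sup_on U f)%E.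
Proof.
rewrite ess_limsupE; apply: (@le_trans _ _ (ess_sup_on (eball x 1 `&` U) f)).
  by apply: ereal_inf_lbound; exists 1 => //=.
by apply: le_ess_sup_on; exact: subIsetr.
Qed.

Lemma ess_limsup_lt U f x (y : \bar R) : (ess_limsup U f x < y)%E ->
  exists2 e : R, 0 < e & (ess_sup_on (eball x e `&` U) f < y)%E.
Proof.
rewrite ess_limsupE => /ereal_inf_lt [_ [e e0 <-] h]; by exists e.
Qed.

(** Each ball around a point of the closure meets U in a nonempty open set, which is not
negligible; a negative essential supremum is impossible there. *)
Lemma ess_limsup_ge0 U f x : open U -> closure U x -> (forall y, U y -> 0 <= f y) ->
  (0 <= ess_limsup U f x)%E.
Proof.
move=> oU Ux f0; rewrite ess_limsupE; apply: le_ereal_inf_tmp => _ [e /= e0 <-].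
rewrite leNgt; apply/negP => neg.
have nb : nbhs x (eball x e).
  by apply: open_nbhs_nbhs; split; [exact: open_eball|exact: eball_center].
have [y [Uy xy]] := Ux _ nb.
have oI : open (eball x e `&` U) by apply: openI => //; exact: open_eball.
have pos := open_lebesgue_gt0 oI (conj xy Uy).
have /ess_sup_onP [N [mN N0 sub]] := lexx (ess_sup_on (eball x e `&` U) f).
move: pos; rewrite -N0 ltNge => /negP; apply; apply: le_measure; rewrite ?inE//.
  exact: open_lebesgue.
move=> z Az; apply: sub => /= h; have := h Az.
by rewrite leNgt => /negP; apply; apply: lt_le_trans neg _; rewrite lee_fin f0//; case: Az.
Qed.

Lemma boundary_openE U : open U -> boundary U = closure U `\` U.
Proof. by move=> oU; rewrite /boundary (interior_id _).1. Qed.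

(** Follow a ray from a point of U: as U is bounded the ray leaves it, and it does so at a
boundary point. *)
Lemma boundary_nonempty U : (0 < n)%N -> open U -> bounded_set U -> U !=set0 ->
  boundary U !=set0.
Proof.
move=> n0 oU [M [_ HM]] [x0 Ux0].
pose v : T := delta_mx ord0 (Ordinal n0).
pose S := [set t : R | U (t *: v + x0)].
have S0 : S 0 by rewrite /S /= scale0r add0r.
have Sub : has_sup S.
  split; first by exists 0.
  exists (`|M| + 1 + `|x0|) => t St.
  have := HM (`|M| + 1) _ _ St; rewrite (le_lt_trans (ler_norm M)) ?ltrDl// => /(_ isT) h.
  have := coord_le_norm (t *: v + x0) (Ordinal n0); rewrite !mxE !eqxx mulr1 => h'.
  have h'' := coord_le_norm x0 (Ordinal n0).
  have h3 := le_trans h' h.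
  have : t <= `|t + x0 ord0 (Ordinal n0)| + `|x0 ord0 (Ordinal n0)|.
    apply: le_trans (ler_norm t) _.
    by rewrite -{1}[t](addrK (x0 ord0 (Ordinal n0))); exact: ler_normB.
  by move=> h4; apply: le_trans h4 _; apply: lerD.
pose t := sup S; exists (t *: v + x0); rewrite boundary_openE//.
have vn a : `|a *: v| <= `|a|.
  apply/norm_leP => // i; rewrite !mxE normrM ler_piMr//.
  by case: (_ && _); rewrite ?normr1 ?normr0.
split.
  move=> B /nbhs_ballP [e /= e0 He].
  have [s Ss st] := sup_adherent e0 Sub.
  exists (s *: v + x0); split => //; apply: He; apply/ball_rVP.
  rewrite opprD addrACA subrr addr0 -scalerBl.
  apply: le_lt_trans (vn _) _; rewrite ger0_norm; first by rewrite ltrBlDr addrC -ltrBlDr.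
  by rewrite subr_ge0; exact: sup_upper_bound.
move=> Ut; have /nbhs_ballP [e /= e0 He] : nbhs (t *: v + x0) U by apply: open_nbhs_nbhs.
have : S (t + e / 2).
  apply: He; apply/ball_rVP; rewrite opprD addrACA subrr addr0 -scalerBl.
  apply: le_lt_trans (vn _) _; rewrite opprD addNKr normrN gtr0_norm ?divr_gt0//.
  by rewrite gtr_pMr// invf_lt1// ltr1n.
move/(sup_upper_bound Sub); rewrite -/t leNgt => /negP; apply.
by rewrite ltrDl divr_gt0.
Qed.

End essential_supremum.

(** * The variation of a Sobolev map by a cutoff *)

Section cutoff_variation.
Variables (R : realType) (n N k : nat) (U : set 'rV[R]_n).
Hypothesis oU : open U.
Local Notation mu := (@lebesgue R n).
Local Notation T := 'rV[R]_n.
Local Notation word i := (tval (tagged (i : jet_index n N k).2)).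
Variable u : T -> 'rV[R]_N.
Hypothesis u_sobolev : sobolev k +oo%E U u.

Let G (a : 'I_N) (s : seq 'I_n) : T -> R := weak_deriv U s (component u a).

Lemma sobolev_weak_deriv a s : (size s <= k)%N ->
  is_weak_deriv U s (component u a) (G a s) /\ ae_bounded U (G a s).
Proof.
rewrite -ltnS => sk.
pose i : jet_index n N k := (a, existT (fun j : 'I_k.+1 => j.-tuple 'I_n) (Ordinal sk) (in_tuple s)).
have [g wg bg] := u_sobolev i.
have {}wg : is_weak_deriv U s (component u a) g by exact: wg.
split; first exact: weak_deriv_spec wg.
have [C HC] := in_Lp_bounded bg.
exists C; apply: filterS2 HC (weak_deriv_ae oU wg) => x HC E Ux.
by rewrite /G E//; exact: HC.
Qed.

Lemma ae_bounded_row m (f : T -> 'rV[R]_m) :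
  (forall l, ae_bounded U (component f l)) ->
  exists2 C : R, 0 < C & {ae mu, forall x, U x -> enorm (f x) <= C}.
Proof.
move=> bf; pose C l := sval (cid (bf l)).
have C0 : 0 <= \sum_l `|C l| by exact: sumr_ge0.
exists (m%:R * \sum_l `|C l| + 1); first by rewrite ltr_wpDl// mulr_ge0.
have H : {ae mu, forall x, forall l, U x -> `|f x ord0 l| <= C l}.
  apply: (@filter_forall T 'I_m (fun l x => U x -> `|f x ord0 l| <= C l)) => l.
  exact: svalP (cid (bf l)).
apply: filterS H => x Hx Ux; apply: (@le_trans _ _ (m%:R * \sum_l `|C l|)).
  apply: enorm_le => l; apply: le_trans (Hx l Ux) _; apply: le_trans (ler_norm _) _.
  by rewrite (bigD1 l)//= lerDl; exact: sumr_ge0.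
by rewrite lerDl.
Qed.

Lemma jet_bounded : exists2 C : R, 0 < C & {ae mu, forall x, U x -> enorm (jet k U u x) <= C}.
Proof.
apply: ae_bounded_row => l.
have [_ [C HC]] := sobolev_weak_deriv (enum_val l).1 (@size_word n N k (enum_val l)).
by exists C; apply: filterS HC => x; rewrite /component jetE.
Qed.

(** The variation is - e zeta u, and Y is the Leibniz expansion of the jet of zeta u.  A
single Y serves all e, so that its bound does not depend on e. *)
Lemma cutoff_variation (zeta : T -> R) (A : set T) : test_fun U zeta -> open A ->
  (forall x, A x -> zeta x = 1) ->
  exists (Y : T -> 'rV[R]_(jet_dim n N k)) (C : R), [/\ 0 < C,
    {ae mu, forall x, U x -> enorm (Y x) <= C},
    forall x, A x -> Y x = jet k U u x &
    forall e : R, exists2 phi, sobolev0_infty k U phi &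
      {ae mu, forall x, U x -> jet k U (u \+ phi) x = jet k U u x - e *: Y x}].
Proof.
move=> tz oA zA; have [sz cz zU] := tz.
have bz := compact_support_bounded_smooth sz cz.
have HG a s : (size s <= k)%N -> is_weak_deriv U s (component u a) (G a s).
  by move=> sk; have [] := sobolev_weak_deriv a sk.
have bG a s : (size s <= k)%N -> ae_bounded U (G a s).
  by move=> sk; have [] := sobolev_weak_deriv a sk.
pose L a s := leibniz (G a) s zeta [::].
have wL a s (sk : (size s <= k)%N) : is_weak_deriv U s (zeta \* G a [::]) (L a s).
  exact: (leibniz_weak_deriv oU (HG a) sz sk).
have bL a s (sk : (size s <= k)%N) : ae_bounded U (L a s).
  by apply: (leibniz_bounded bz _ (bG a)); rewrite addn0.
have L0 a s x : ~ Defs.support zeta x -> L a s x = 0 by exact: leibniz_support.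
pose Y (x : T) : 'rV[R]_(jet_dim n N k) :=
  \row_l L (enum_val l).1 (word (enum_val l)) x.
have [C C0 HC] : exists2 C : R, 0 < C & {ae mu, forall x, U x -> enorm (Y x) <= C}.
  apply: ae_bounded_row => l.
  have [C HC] := bL (enum_val l).1 _ (@size_word n N k (enum_val l)).
  by exists C; apply: filterS HC => x; rewrite /component mxE.
exists Y, C; split => //.
  move=> x Ax; apply/rowP => l; rewrite mxE jetE /L.
  by rewrite (leibniz_const (G (enum_val l).1) (word (enum_val l)) [::] oA zA Ax) mul1r.
move=> e; pose phi (x : T) : 'rV[R]_N := \row_a (- e * (zeta x * G a [::] x)).
have phiE a : component phi a = cst (- e) \* (zeta \* G a [::]).
  by apply/funext => x; rewrite /component mxE.
have wphi a s : (size s <= k)%N ->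
    is_weak_deriv U s (component phi a) (cst (- e) \* L a s).
  by move=> sk; rewrite phiE; apply: is_weak_derivZ => //; exact: wL.
exists phi.
  apply: (sobolev0_infty_compact oU cz zU wphi).
  - move=> a s sk; have [D HD] := bL a s sk; exists (`|e| * D).
    by apply: filterS HD => x HD Ux; rewrite /= normrM normrN ler_wpM2l//; exact: HD.
  - by move=> a s x /(L0 a s) /= ->; rewrite mulr0.
  - by move=> a x /support0; rewrite phiE /= => ->; rewrite mul0r mulr0.
have H : {ae mu, forall x, forall l : 'I_(jet_dim n N k), U x ->
    jet k U (u \+ phi) x ord0 l = (jet k U u x - e *: Y x) ord0 l}.
  apply: (@filter_forall T 'I_(jet_dim n N k) (fun l x => U x ->
    jet k U (u \+ phi) x ord0 l = (jet k U u x - e *: Y x) ord0 l)) => l.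
  set i := enum_val l; have sk := @size_word n N k i.
  have cE : component (u \+ phi) i.1 = component u i.1 \+ component phi i.1.
    by apply/funext => x; rewrite /component mxE.
  have := weak_deriv_ae oU (is_weak_derivD oU (HG i.1 _ sk) (wphi i.1 _ sk)).
  apply: filterS => x Ex Ux; have := Ex Ux; rewrite -cE => h.
  by rewrite [LHS]jetE -/i h /= !mxE mulNr.
by apply: filterS H => x Hx Ux; apply/rowP => l; exact: Hx.
Qed.

End cutoff_variation.

(** * The integrand *)

Section integrand.
Variables (R : realType) (n m : nat) (U : set 'rV[R]_n).
Local Notation mu := (@lebesgue R n).
Local Notation T := 'rV[R]_n.
Local Notation V := 'rV[R]_m.

(** Test the inequality on the countable dense set of rational vectors. *)
Lemma ae_forall_continuous_ge0 (F : T -> V -> R) :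
  {ae mu, forall x, U x -> continuous (F x)} ->
  (forall X, {ae mu, forall x, U x -> 0 <= F x X}) ->
  {ae mu, forall x, U x -> forall X, 0 <= F x X}.
Proof.
move=> cF F0.
have Fq : {ae mu, forall x, forall q : 'rV[rat]_m, U x -> 0 <= F x (map_mx ratr q)}.
  by apply: ae_forall_countable => q; exact: F0.
apply: filterS2 cF Fq => x cF Fq Ux X; rewrite leNgt; apply/negP => neg.
have oN : nbhs X (F x @^-1` [set s | s < 0]).
  by apply: (cF Ux X); apply: open_nbhs_nbhs; split => //; exact: open_lt.
have /nbhs_ballP [e /= e0 He] := oN.
have [q qX] := dense_rat_rV X e0.
have : F x (map_mx ratr q) < 0 by apply: He; apply/ball_rVP; rewrite distrC.
by rewrite ltNge Fq.
Qed.

Variable c : R -> R -> R.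
Hypothesis c_cont : {within `[0, 1] `*` `[0, +oo[, continuous (fun p : R * R => c p.1 p.2)}.

(** The function c is continuous only relative to its domain, which is why the argument is
required to stay in it. *)
Lemma continuous_radial_comp (S : topologicalType) (g : S -> R) (t : R) :
  0 <= t <= 1 -> (forall x, 0 <= g x) -> continuous g -> continuous (fun x => c t (g x)).
Proof.
move=> t01 g0 cg x.
have mem y : (`[0, 1] `*` `[0, +oo[)%classic (t, g y).
  by split; rewrite /= in_itv/= ?andbT.
have /subspace_continuousP h := c_cont.
have gc : (fun y => (t, g y)) @ x --> within (`[0, 1] `*` `[0, +oo[) (nbhs (t, g x)).
  move=> P Pn.
  have : (fun y => (t, g y)) @ x --> (t, g x).
    exact: (cvg_pair (cvg_cst t : cst t @ x --> t) (cg x)).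
  move=> /(_ _ Pn) h2; change (nbhs x [set y | P (t, g y)]).
  by apply: (@filterS S (nbhs x) _ _ _ _ h2) => y /= /(_ (mem y)).
exact: cvg_comp gc (h _ (mem x)).
Qed.

Lemma radial_ge_gt0 (t a b : R) : 0 < a ->  a <= b -> 0 < t < 1 ->
  (forall t s : R, 0 < t < 1 -> 0 < s -> 0 < c t s) ->
  exists2 c0 : R, 0 < c0 & forall s, a <= s <= b -> c0 <= c t s.
Proof.
move=> a0 ab /andP[t0 t1] cpos.
have cn : continuous (fun s : R => c t `|s|).
  apply: continuous_radial_comp; last exact: norm_continuous.
    by rewrite !ltW.
  by move=> s; exact: normr_ge0.
have [s sab smin] := EVT_min ab (continuous_subspaceT (A := `[a, b]) cn).
have s0 : 0 < s by move: sab; rewrite in_itv /= => /andP[as_ _]; exact: lt_le_trans as_.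
exists (c t s); first by apply: cpos => //; rewrite t0.
move=> s' /[dup] /andP[as' _] s'ab; have := smin s'; rewrite in_itv /= => /(_ s'ab).
by rewrite !ger0_norm// ?ltW// (lt_le_trans a0).
Qed.

(** The exceptional set of the radial condition depends on X; continuity in X removes this
dependence. *)
Lemma radial_ae (H : T -> V -> R) (t : R) : 0 <= t <= 1 ->
  {ae mu, forall x, U x -> continuous (H x)} ->
  (forall X, {ae mu, forall x, U x -> H x (t *: X) <= H x X - c t (enorm X)}) ->
  {ae mu, forall x, U x -> forall X, H x (t *: X) <= H x X - c t (enorm X)}.
Proof.
move=> t01 cH Hr.
have := @ae_forall_continuous_ge0 (fun x X => H x X - c t (enorm X) - H x (t *: X)).
have h1 : {ae mu, forall x, U x -> continuous (fun X => H x X - c t (enorm X) - H x (t *: X))}.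
  apply: filterS cH => x cH Ux X.
  apply: (@continuousB R R V (fun X => H x X - c t (enorm X)) (fun X => H x (t *: X))).
    apply: (@continuousB R R V (H x) (fun X => c t (enorm X))); first exact: cH.
    apply: continuous_radial_comp => //; first by move=> y; exact: enorm_ge0.
    exact: continuous_enorm.
  apply: (@continuous_comp V V R (fun X => t *: X) (H x)); last exact: cH.
  exact: scaler_continuous.
have h2 X : {ae mu, forall x, U x -> 0 <= H x X - c t (enorm X) - H x (t *: X)}.
  by apply: filterS (Hr X) => x h Ux; rewrite subr_ge0; exact: h.
move=> /(_ h1 h2); apply: filterS => x h Ux X.
by rewrite -subr_ge0; exact: h.
Qed.

End integrand.

(** * Decreasing the energy away from the boundary *)

Section energy_decrease.
Variables (R : realType) (n N k : nat) (U : set 'rV[R]_n).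
Hypothesis U_open : open U.
Local Notation mu := (@lebesgue R n).
Local Notation T := 'rV[R]_n.
Local Notation V := 'rV[R]_(jet_dim n N k).
Variable H : T -> V -> R.
Hypothesis H_cont : {ae mu, forall x, U x -> continuous (H x)}.
Hypothesis H_zero : {ae mu, forall x, U x -> H x 0 = 0}.
Variable u : T -> 'rV[R]_N.
Hypothesis u_sobolev : sobolev k +oo%E U u.

Let ae_and (P Q : T -> Prop) : {ae mu, forall x, P x} -> {ae mu, forall x, Q x} ->
  {ae mu, forall x, P x /\ Q x}.
Proof. by apply: filterS2. Qed.

Definition modulus_on (r : R) (w : R -> R) : Prop :=
  [/\ {in `]0, +oo[ &, {homo w : s t / s <= t}},
      {in `]0, +oo[, continuous w}, w s @[s --> 0^'+] --> 0 &
      {ae mu, forall x, U x -> forall X X' : V,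
        enorm X <= r -> enorm X' <= r -> X != X' -> `|H x X - H x X'| <= w (enorm (X - X'))}].

(** Otherwise monotonicity would keep w below a negative number near 0. *)
Lemma modulus_ge0 r w (s : R) : modulus_on r w -> 0 < s -> 0 <= w s.
Proof.
move=> [w_homo _ w_lim _] s0; rewrite leNgt; apply/negP => ws0.
have w_near : \forall s' \near 0^'+, `|0 - w s'| < - w s.
  by move/cvgrPdist_lt : w_lim; apply; rewrite oppr_gt0.
near (0 : R)^'+ => s'.
have s'0 : 0 < s' by near: s'; exact: nbhs_right_gt.
have s's : s' <= s by near: s'; exact: nbhs_right_le.
have ws' : w s' <= w s by apply: w_homo; rewrite ?in_itv /= ?andbT.
have : `|0 - w s'| < - w s by near: s'.
rewrite sub0r normrN ltr0_norm ?(le_lt_trans ws')// ltrN2 => h.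
by have := lt_le_trans h ws'; rewrite ltxx.
Unshelve. all: by end_near. Qed.

(** A monotone modulus may be evaluated at any upper bound of the distance, and then the
case X = X' need not be excluded. *)
Lemma modulus_le r w : modulus_on r w ->
  {ae mu, forall x, U x -> forall (X X' : V) (s : R), 0 < s ->
    enorm X <= r -> enorm X' <= r -> enorm (X - X') <= s -> `|H x X - H x X'| <= w s}.
Proof.
move=> wr; have [w_homo _ _ Hw] := wr; apply: filterS Hw => x Hx Ux X X' s s0 Xr X'r XX'.
have [->|XnX'] := eqVneq X X'; first by rewrite subrr normr0; exact: modulus_ge0 wr s0.
apply: le_trans (Hx Ux X X' Xr X'r XnX') _; apply: w_homo => //; rewrite in_itv/= andbT//.
rewrite lt0r enorm_ge0 andbT; apply: contraNneq XnX' => /enorm_eq0 /eqP.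
by rewrite subr_eq0.
Qed.

Hypothesis H_modulus : forall r : R, 0 < r -> exists w, modulus_on r w.

Lemma energy_bounded : exists C : R, {ae mu, forall x, U x -> H x (jet k U u x) <= C}.
Proof.
have [C C0 HC] := jet_bounded U_open u_sobolev.
have [w wr] := H_modulus C0; exists (w C).
apply: filterS3 HC H_zero (modulus_le wr) => x jx Hx0 Hw Ux.
have := Hw Ux (jet k U u x) 0 C C0 (jx Ux).
rewrite enorm0 (ltW C0) subr0 => /(_ isT (jx Ux)); rewrite Hx0// subr0.
by apply: le_trans; exact: ler_norm.
Qed.

Variable c : R -> R -> R.
Hypothesis c_cont : {within `[0, 1] `*` `[0, +oo[, continuous (fun p : R * R => c p.1 p.2)}.
Hypothesis c_ge0 : forall t s : R, 0 <= t <= 1 -> 0 <= s -> 0 <= c t s.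
Hypothesis c_gt0 : forall t s : R, 0 < t < 1 -> 0 < s -> 0 < c t s.
Hypothesis H_radial : forall (t : R) (X : V), 0 <= t <= 1 ->
  {ae mu, forall x, U x -> H x (t *: X) <= H x X - c t (enorm X)}.

(** The core of the argument.  The three numbers to beat M are the level m of the energy
off K plus an error, the same level reached on K, and M minus the radial gain. *)
Lemma energy_decrease (K : set T) (M m : R) : compact K -> K `<=` U ->
  0 <= m < M ->
  {ae mu, forall x, U x -> H x (jet k U u x) <= M} ->
  {ae mu, forall x, U x -> ~ K x -> H x (jet k U u x) <= m} ->
  exists phi, sobolev0_infty k U phi /\ exists2 M' : R, M' < M &
    {ae mu, forall x, U x -> H x (jet k U (u \+ phi) x) <= M'}.
Proof.
move=> cK KU /andP[m0 mM] HM Hm.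
have [zeta [A [tz oA KA zA _]]] := cutoff cK U_open KU.
have [Y [C [C0 HC YA var]]] := cutoff_variation U_open u_sobolev tz oA zA.
have [C1 C10 HC1] := jet_bounded U_open u_sobolev.
pose D := (jet_dim n N k)%:R * (C1 + C) : R.
have D0 : 0 <= D by rewrite mulr_ge0// addr_ge0// ltW.
(* D bounds the varied jets and C1 the jet of u. *)
pose r := D + C1.
have C1r : C1 <= r by rewrite lerDr.
have r0 : 0 < r by apply: lt_le_trans C1r.
have [w wr] := H_modulus r0; have [_ _ w_lim _] := wr.
pose eta := (M - m) / 2; have eta0 : 0 < eta by rewrite divr_gt0// subr_gt0.
have [s s0 ws] : exists2 s : R, 0 < s & w s < eta.
  have w_near : \forall s \near 0^'+, `|0 - w s| < eta.
    by move/cvgrPdist_lt : w_lim; apply.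
  near (0 : R)^'+ => s; exists s; first by near: s; exact: nbhs_right_gt.
  apply: le_lt_trans (ler_norm _) _; rewrite -normrN -sub0r; by near: s.
(* The perturbation e Y has norm at most s, and t = 1 - e stays inside (0, 1). *)
pose e := Num.min 2^-1 (s / C).
have e0 : 0 < e by rewrite lt_min invr_gt0 ltr0n divr_gt0.
have e2 : e <= 2^-1 by rewrite ge_min lexx.
have eC : e * C <= s by rewrite -ler_pdivlMr// ge_min lexx orbT.
pose t := 1 - e; have t01 : 0 < t < 1 by rewrite /t; apply/andP; split; lra.
have t01' : 0 <= t <= 1 by have /andP[h1 h2] := t01; rewrite !ltW.
(* Below s1 the modulus keeps H(x, X) under eta, hence under the level m + eta. *)
pose s1 := Num.min s r.
have s10 : 0 < s1 by rewrite lt_min s0.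
have s1r : s1 <= r by rewrite ge_min lexx orbT.
have [c0 c00 Hc0] := radial_ge_gt0 c_cont s10 s1r t01 c_gt0.
have [phi Wphi jphi] := var e.
exists phi; split => //.
exists (Num.max (m + eta) (M - c0)).
  by rewrite gt_max; apply/andP; split; [rewrite /eta; lra|rewrite ltrBlDr ltrDl].
have Hrad := radial_ae c_cont t01' H_cont (fun X => H_radial X t01').
have ae1 := ae_and HM (ae_and Hm (ae_and HC HC1)).
have ae2 := ae_and jphi (ae_and (modulus_le wr) (ae_and Hrad H_zero)).
apply: filterS2 ae1 ae2 => x [HMx [Hmx [HCx HC1x]]] [jx [Hwx [Hradx H0x]]] Ux.
rewrite (jx Ux) le_max; set X := jet k U u x.
have XC1 : enorm X <= C1 by exact: HC1x.
have [Kx|nKx] := pselect (K x).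
  rewrite (YA x (KA x Kx)) -/X.
  have -> : X - e *: X = t *: X by rewrite /t scalerBl scale1r.
  have Hr := Hradx Ux X.
  have [hm|hm] := leP (H x X) (m + eta).
    apply/orP; left; apply: le_trans Hr _; apply: le_trans hm.
    by rewrite lerBlDr lerDl c_ge0// enorm_ge0.
  apply/orP; right; apply: le_trans Hr _; apply: lerB; first exact: HMx.
  apply: Hc0; rewrite (le_trans XC1 C1r) andbT leNgt; apply/negP => Xs.
  have Xs' : enorm (X - 0) <= s.
    by rewrite subr0; apply: le_trans (ltW Xs) _; rewrite ge_min lexx.
  have := Hwx Ux X 0 s s0 (le_trans XC1 C1r); rewrite enorm0 (ltW r0) => /(_ isT Xs').
  rewrite H0x// subr0 => h.
  have := le_lt_trans (le_trans (ler_norm _) h) ws => h'.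
  by have := lt_trans hm h'; rewrite gtrDr ltNge m0.
apply/orP; left.
have dXY : enorm (X - e *: Y x - X) <= s.
  rewrite addrAC subrr add0r enormN enormZ gtr0_norm//.
  by apply: le_trans eC; rewrite ler_pM2l//; exact: HCx.
have rXY : enorm (X - e *: Y x) <= r.
  apply: (@le_trans _ _ D); last by rewrite lerDl ltW.
  have entry (P Q : V) l : (P - e *: Q) ord0 l = P ord0 l - e * Q ord0 l by rewrite !mxE.
  apply: enorm_le => l; rewrite entry; apply: le_trans (ler_normB _ _) _; apply: lerD.
    exact: le_trans (coord_le_enorm X l) XC1.
  rewrite normrM gtr0_norm// -[leRHS]mul1r; apply: ler_pM => //; first exact: ltW.
    by apply: le_trans e2 _; lra.
  exact: le_trans (coord_le_enorm (Y x) l) (HCx Ux).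
have := Hwx Ux _ X s s0 rXY (le_trans XC1 C1r) dXY => h.
have h1 := ler_norm (H x (X - e *: Y x) - H x X).
have h2 := Hmx Ux nKx.
rewrite -/X in h2.
by rewrite -[leLHS](subrK (H x X)) addrC; apply: lerD => //; apply: le_trans h1 (le_trans h (ltW ws)).
Unshelve. all: by end_near. Qed.

End energy_decrease.

Theorem proposition1p3 (R : realType) (n N k : nat)
  (n_gt0 : (0 < n)%N) (N_gt0 : (0 < N)%N) (k_gt0 : (0 < k)%N)
  (U : set 'rV[R]_n) (U_open : open U) (U_bounded : bounded_set U)
  (H : 'rV[R]_n -> 'rV[R]_(jet_dim n N k) -> R)
  (H_ge0 : forall (x : 'rV[R]_n) (X : 'rV[R]_(jet_dim n N k)), U x -> 0 <= H x X)
  (H_carath : caratheodory_fun U H)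
  (H_zero : {ae @lebesgue R n, forall x, U x -> H x 0 = 0})
  (H_radial : exists c : R -> R -> R,
    [/\ {within `[0, 1] `*` `[0, +oo[, continuous (fun p : R * R => c p.1 p.2)},
        forall t s : R, 0 <= t <= 1 -> 0 <= s -> 0 <= c t s,
        (forall s : R, 0 <= s -> c 1 s = 0) /\
          (forall t : R, 0 <= t <= 1 -> c t 0 = 0),
        forall t s : R, 0 < t < 1 -> 0 < s -> 0 < c t s &
        forall (t : R) (X : 'rV[R]_(jet_dim n N k)), 0 <= t <= 1 -> {ae @lebesgue R n, forall x, U x ->
          H x (t *: X) <= H x X - c t (enorm X)}])
  (H_modulus : forall r : R, 0 < r -> exists w : R -> R,
    [/\ {in `]0, +oo[ &, {homo w : s t / s <= t}},
        {in `]0, +oo[, continuous w},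
        w s @[s --> 0^'+] --> 0 &
        {ae @lebesgue R n, forall x, U x -> forall X X' : 'rV[R]_(jet_dim n N k),
          enorm X <= r -> enorm X' <= r -> X != X' ->
          `|H x X - H x X'| <= w (enorm (X - X'))}])
  (u : 'rV[R]_n -> 'rV[R]_N)
  (u_sobolev : sobolev k +oo%E U u)
  (u_min : forall phi : 'rV[R]_n -> 'rV[R]_N, sobolev0_infty k U phi ->
    (E_infty H u U <= E_infty H (u \+ phi)%R U)%E) :
  ess_sup_on U (fun x => H x (jet k U u x)) =
  ereal_sup [set ess_limsup U (fun y => H y (jet k U u y)) x | x in boundary U].
Proof.
pose h x := H x (jet k U u x); rewrite -/h.
(* Over the empty set both sides are the least extended real. *)
have [->|U0] := eqVneq U set0.
  have bd0 : boundary (set0 : set 'rV[R]_n) = set0 by rewrite /boundary closure0 set0D.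
  rewrite bd0 image_set0 ereal_sup0; apply/eqP; rewrite -leeNy_eq.
  by apply/ess_sup_onP; apply: aeW.
have {}U0 : U !=set0 by exact/set0P.
set m := ereal_sup _; set M := ess_sup_on U h.
apply/eqP; rewrite eq_le; apply/andP; split; last first.
  by apply: ge_ereal_sup => _ [x _ <-]; exact: ess_limsup_le.
rewrite leNgt; apply/negP => mM.
have m0 : (0 <= m)%E.
  have [x bx] := boundary_nonempty n_gt0 U_open U_bounded U0.
  apply: (@le_trans _ _ (ess_limsup U h x)); last by apply: ereal_sup_ubound; exists x.
  by apply: ess_limsup_ge0 => //; [exact: bx.1|move=> y Uy; exact: H_ge0].
have H_mod r : 0 < r -> exists w, modulus_on U H r w by exact: H_modulus.
have [c [c_cont c_ge0 _ c_gt0 Hc]] := H_radial.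
have M_lty : (M < +oo)%E.
  have [C HC] := energy_bounded U_open H_zero u_sobolev H_mod.
  apply: (@le_lt_trans _ _ C%:E); last by rewrite ltry.
  by apply/ess_sup_onP; apply: filterS HC => x HC Ux; rewrite lee_fin; exact: HC.
have M_fin : M \is a fin_num by rewrite ge0_fin_numE// (le_trans m0 (ltW mM)).
have m_fin : m \is a fin_num by rewrite ge0_fin_numE// (lt_trans mM M_lty).
have mM' : fine m < fine M by apply: fine_lt.
pose m' := (fine m + fine M) / 2.
have m'M : 0 <= m' < fine M.
  have := fine_ge0 m0; rewrite /m' => m0'; apply/andP; split; lra.
have mm' : (m < m'%:E)%E by rewrite -(fineK m_fin) lte_fin /m'; lra.
have small x : boundary U x -> exists2 e : R, 0 < e &
    (ess_sup_on (eball x e `&` U) h < m'%:E)%E.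
  move=> bx; apply: ess_limsup_lt; apply: le_lt_trans mm'.
  by apply: ereal_sup_ubound; exists x.
(* W is an open neighbourhood of the boundary on which the energy is below m' almost everywhere. *)
pose W := \bigcup_(p in [set p : 'rV[R]_n * R | 0 < p.2 /\
  (ess_sup_on (eball p.1 p.2 `&` U) h < m'%:E)%E]) eball p.1 p.2.
have oW : open W by apply: bigcup_open => p _; exact: open_eball.
have bW : boundary U `<=` W.
  move=> x bx; have [e e0 he] := small x bx.
  by exists (x, e) => //=; exact: eball_center.
pose K := closure U `\` W.
have KU : K `<=` U.
  move=> x [Ux Wx]; apply: contrapT => nUx; apply: Wx; apply: bW.
  by rewrite boundary_openE.
have cK : compact K.
  apply: bounded_closed_compact.
    have [B [Br HB]] := U_bounded; exists B; split => // B' BB' x /KU; exact: HB.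
  by apply: closedI; [exact: closed_closure|exact: open_closedC].
have Hm : {ae @lebesgue R n, forall x, U x -> ~ K x -> H x (jet k U u x) <= m'}.
  have aeUW : {ae @lebesgue R n, forall x, (U `&` W) x -> H x (jet k U u x) <= m'}.
    apply: ae_local => x [Ux [[y e] /= [e0 hy] yx]].
    have /nbhs_ballP [d /= d0 Hd] : nbhs x (eball y e `&` U).
      by apply: open_nbhs_nbhs; split => //; apply: openI => //; exact: open_eball.
    exists d => //; have /ess_sup_onP := ltW hy; apply: filterS => z hz xz.
    by rewrite -lee_fin; apply: hz; apply: Hd; apply/ball_rVP.
  apply: filterS aeUW => x hx Ux nK; apply: hx; split => //.
  by apply: contrapT => nW; apply: nK; split => //; exact: subset_closure.
have HM : {ae @lebesgue R n, forall x, U x -> H x (jet k U u x) <= fine M}.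
  have /ess_sup_onP := lexx M; apply: filterS => x hx Ux.
  by rewrite -lee_fin fineK//; exact: hx.
have [phi [Wphi [M' M'M HM']]] := energy_decrease U_open H_carath.2 H_zero u_sobolev
  H_mod c_cont c_ge0 c_gt0 Hc cK KU m'M HM Hm.
have : (E_infty H (u \+ phi)%R U <= M'%:E)%E.
  by apply/ess_sup_onP; apply: filterS HM' => x hx Ux; rewrite lee_fin; exact: hx.
move=> /(le_trans (u_min _ Wphi)); rewrite leNgt => /negP; apply.
by rewrite -[E_infty _ _ _]/M -(fineK M_fin) lte_fin.
Qed.
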